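(* Let $\Omega\subset\mathbb R^n$ be a bounded open set with $C^2$ boundary, let $L,F,G$ satisfy the assumptions below. Let $(u,m)$ be a mild solution of the constrained MFG problem in $\overline\Omega$ and let $(t,x)\in\partial Q_m$. Then $$-p_1+H^\tau(x,p_2)=F(x,m(t))\qquad\forall(p_1,p_2)\in D^+u(t,x).$$
   Context: $T>0$; $U\supset\overline\Omega$ open; $\nu(x)$ the outward unit normal at $x\in\partial\Omega$; $\mathcal P(\overline\Omega)$ with the Kantorovich–Rubinstein distance $d_1$. Assumptions: (D1) $|F(x,m_1)-F(x,m_2)|+|G(x,m_1)-G(x,m_2)|\le\kappa d_1(m_1,m_2)$; (D2) $F(\cdot,m),G(\cdot,m)\in C^1_b(U)$, $|D_xF|+|D_xG|\le\kappa$; (D3) $x\mapsto F(x,m)$ semiconcave with linear modulus uniformly in $m$; (L0) $L\in C^1(U\times\mathbb R^n)$, $|L(x,0)|+|D_xL(x,0)|+|D_vL(x,0)|\le M$; (L1) $D_vL$ differentiable, $I/\mu\le D^2_{vv}L\le\mu I$, $\|D^2_{vx}L(x,v)\|\le\mu(1+|v|)$; (L2) $|D_xL(x,v)-D_xL(x,w)|\le C(R)|v-w|$ for $v,w\in B_R$; (L3) $x\mapsto L(x,v)$ semiconcave with linear modulus uniformly in $v\in B_R$. $H(x,p)=\sup_v\{-\langle p,v\rangle-L(x,v)\}$. Tangential Hamiltonian: for $x\in\partial\Omega$, $H^\tau(x,p)=\sup\{-\langle p,v\rangle-L(x,v):v\in\mathbb R^n,\ \langle v,\nu(x)\rangle=0\}$.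 $\Gamma$: absolutely continuous curves $[0,T]\to\overline\Omega$; $\Gamma_t[x]=\{\gamma:\gamma(t)=x\}$; $e_t(\gamma)=\gamma(t)$; $m^\eta(t)=e_t\sharp\eta$; $J_\eta[\gamma]=\int_0^T[L(\gamma,\dot\gamma)+F(\gamma,m^\eta(t))]dt+G(\gamma(T),m^\eta(T))$; $\Gamma^\eta[x]$ minimizers of $J_\eta$ over $\Gamma_0[x]$. Constrained MFG equilibrium for $m_0$: Borel probability $\eta$ on $\Gamma$ with $e_0\sharp\eta=m_0$ and $\mathrm{supp}\,\eta\subset\bigcup_x\Gamma^\eta[x]$. Mild solution: $(u,m)\in C([0,T]\times\overline\Omega)\times C([0,T];\mathcal P(\overline\Omega))$ with, for some equilibrium $\eta$, $m(t)=e_t\sharp\eta$ and $u(t,x)=\inf_{\gamma\in\Gamma_t[x]}\{\int_t^T[L(\gamma,\dot\gamma)+F(\gamma(s),m(s))]ds+G(\gamma(T),m(T))\}$. $\partial Q_m=\{(t,x)\in(0,T)\times\partial\Omega:x\in\mathrm{supp}(m(t))\}$. $D^+u(t,x)$ is the set of $(p_1,p_2)\in\mathbb R\times\mathbb R^n$ with $\limsup_{(s,y)\to(t,x),(s,y)\in(0,T)\times\overline\Omega}\frac{u(s,y)-u(t,x)-p_1(s-t)-\langle p_2,y-x\rangle}{|s-t|+|y-x|}\le0$. *)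

(* Defs.v *)
From HB Require Import structures.
From mathcomp Require Import all_boot all_order all_algebra.
From mathcomp Require Import all_classical all_reals all_analysis.
Set Implicit Arguments.
Unset Strict Implicit.
Unset Printing Implicit Defensive.
Import Order.TTheory GRing.Theory Num.Theory.
Import numFieldNormedType.Exports.
Local Open Scope ring_scope.
Local Open Scope classical_set_scope.

Section MFGDefs.
Variables (R : realType) (n : nat).
Implicit Types (x y v w p xi : 'rV[R]_n).

Definition dot (u v : 'rV[R]_n) : R := \sum_(i < n) u ord0 i * v ord0 i.
Definition enorm (v : 'rV[R]_n) : R := Num.sqrt (dot v v).
Definition ev (i : 'I_n) : 'rV[R]_n := delta_mx ord0 i.

Definition grad (f : 'rV[R]_n -> R) (x : 'rV[R]_n) : 'rV[R]_n :=
  \row_(i < n) 'D_(ev i) f x.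

Definition C1on (A : set 'rV[R]_n) (f : 'rV[R]_n -> R) : Prop :=
  (forall x, A x -> differentiable f x) /\
  (forall (i : 'I_n) x, A x -> {for x, continuous (fun y => 'D_(ev i) f y)}).

Definition C2on (A : set 'rV[R]_n) (f : 'rV[R]_n -> R) : Prop :=
  C1on A f /\ forall i : 'I_n, C1on A (fun y => 'D_(ev i) f y).

(** * Domain: C^2 boundary given by a global C^2 defining function rho
    (Omega = {rho < 0}, grad rho <> 0 on {rho = 0}); outward unit normal *)
Definition C2_defining_function (Omega : set 'rV[R]_n) (rho : 'rV[R]_n -> R)
  : Prop :=
  C2on setT rho /\ Omega = [set x | rho x < 0] /\
  (forall x, rho x = 0 -> grad rho x != 0).

Definition outward_normal (rho : 'rV[R]_n -> R) (x : 'rV[R]_n) : 'rV[R]_n :=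
  (enorm (grad rho x))^-1 *: grad rho x.

Definition bdry (Omega : set 'rV[R]_n) : set 'rV[R]_n :=
  closure Omega `\` Omega.

Definition semiconcave_lin (U : set 'rV[R]_n) (C : R) (f : 'rV[R]_n -> R)
  : Prop :=
  forall x y, (forall s : R, 0 <= s <= 1 -> U (s *: x + (1 - s) *: y)) ->
  forall l : R, 0 <= l <= 1 ->
    l * f x + (1 - l) * f y - f (l *: x + (1 - l) *: y)
      <= C * l * (1 - l) * enorm (x - y) ^+ 2.

Definition Lz (L : 'rV[R]_n -> 'rV[R]_n -> R) (z : 'rV[R]_n * 'rV[R]_n) : R :=
  L z.1 z.2.
Definition DxL (L : 'rV[R]_n -> 'rV[R]_n -> R) x v : 'rV[R]_n :=
  \row_(i < n) 'D_((ev i, 0)) (Lz L) (x, v).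
Definition DvL (L : 'rV[R]_n -> 'rV[R]_n -> R) x v : 'rV[R]_n :=
  \row_(i < n) 'D_((0, ev i)) (Lz L) (x, v).
Definition DvvL (L : 'rV[R]_n -> 'rV[R]_n -> R) x v : 'M[R]_n :=
  \matrix_(i < n, j < n)
    'D_((0, ev j)) (fun z : 'rV[R]_n * 'rV[R]_n => DvL L z.1 z.2 ord0 i) (x, v).
Definition DvxL (L : 'rV[R]_n -> 'rV[R]_n -> R) x v : 'M[R]_n :=
  \matrix_(i < n, j < n)
    'D_((ev j, 0)) (fun z : 'rV[R]_n * 'rV[R]_n => DvL L z.1 z.2 ord0 i) (x, v).

Definition Htau (L : 'rV[R]_n -> 'rV[R]_n -> R) (rho : 'rV[R]_n -> R)
  (x p : 'rV[R]_n) : R :=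
  sup [set - dot p v - L x v | v in [set v | dot v (outward_normal rho x) = 0]].

(** * Probability measures on Rbar^n (Borel sigma-algebra, generated by the
      coordinate maps) *)
Definition coord_gen : set (set 'rV[R]_n) :=
  [set S | exists (i : 'I_n) (B : set R),
     measurable B /\ S = [set x : 'rV[R]_n | B (x ord0 i)]].
Definition Pt := g_sigma_algebraType coord_gen.

Definition in_PO (Omega : set 'rV[R]_n) (m : probability Pt R) : Prop :=
  m (closure Omega : set Pt) = 1%E.

Definition lip1_on (A : set 'rV[R]_n) (f : 'rV[R]_n -> R) : Prop :=
  forall x y, A x -> A y -> `|f x - f y| <= enorm (x - y).

Definition d1 (Omega : set 'rV[R]_n) (m1 m2 : probability Pt R) : R :=
  sup [set fine (\int[m1]_(x in (closure Omega : set Pt)) (f x)%:E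
                 - \int[m2]_(x in (closure Omega : set Pt)) (f x)%:E)%E
      | f in lip1_on (closure Omega)].

Definition supp_m (m : probability Pt R) : set 'rV[R]_n :=
  [set x | forall r : R, 0 < r -> (0 < m ([set y | (enorm (y - x) < r)%R] : set Pt))%E].

Definition hyp_D1 (U Omega : set 'rV[R]_n) (F G : 'rV[R]_n -> probability Pt R -> R)
  (kappa : R) : Prop :=
  forall x m1 m2, U x -> in_PO Omega m1 -> in_PO Omega m2 ->
    `|F x m1 - F x m2| + `|G x m1 - G x m2| <= kappa * d1 Omega m1 m2.

Definition hyp_D2 (U Omega : set 'rV[R]_n) (F G : 'rV[R]_n -> probability Pt R -> R)
  (kappa : R) : Prop :=
  forall m, in_PO Omega m ->
    C1on U (fun x => F x m) /\ C1on U (fun x => G x m) /\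
    (exists B : R, forall x, U x -> `|F x m| <= B /\ `|G x m| <= B) /\
    (forall x, U x ->
       enorm (grad (fun y => F y m) x) + enorm (grad (fun y => G y m) x) <= kappa).

Definition hyp_D3 (U Omega : set 'rV[R]_n) (F : 'rV[R]_n -> probability Pt R -> R)
  : Prop :=
  exists C : R, forall m, in_PO Omega m -> semiconcave_lin U C (fun x => F x m).

Definition hyp_L0 (U : set 'rV[R]_n) (L : 'rV[R]_n -> 'rV[R]_n -> R) (M : R)
  : Prop :=
  (forall x v, U x ->
     differentiable (Lz L) (x, v) /\
     forall i : 'I_n,
       {for (x, v), continuous (fun z : 'rV[R]_n * 'rV[R]_n => DxL L z.1 z.2 ord0 i)} /\
       {for (x, v), continuous (fun z : 'rV[R]_n * 'rV[R]_n => DvL L z.1 z.2 ord0 i)}) /\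
  (forall x, U x -> `|L x 0| + enorm (DxL L x 0) + enorm (DvL L x 0) <= M).

Definition hyp_L1 (U : set 'rV[R]_n) (L : 'rV[R]_n -> 'rV[R]_n -> R) (mu : R)
  : Prop :=
  0 < mu /\
  (forall x v (i : 'I_n), U x ->
     differentiable (fun z : 'rV[R]_n * 'rV[R]_n => DvL L z.1 z.2 ord0 i) (x, v)) /\
  (forall x v xi, U x ->
     enorm xi ^+ 2 / mu <= dot (xi *m DvvL L x v) xi <= mu * enorm xi ^+ 2) /\
  (forall x v xi, U x ->
     enorm (xi *m (DvxL L x v)^T) <= mu * (1 + enorm v) * enorm xi).

Definition hyp_L2 (U : set 'rV[R]_n) (L : 'rV[R]_n -> 'rV[R]_n -> R) : Prop :=
  forall R0 : R, 0 < R0 -> exists C : R, forall x v w, U x ->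
    enorm v <= R0 -> enorm w <= R0 ->
    enorm (DxL L x v - DxL L x w) <= C * enorm (v - w).

Definition hyp_L3 (U : set 'rV[R]_n) (L : 'rV[R]_n -> 'rV[R]_n -> R) : Prop :=
  forall R0 : R, 0 < R0 -> exists C : R, forall v,
    enorm v <= R0 -> semiconcave_lin U C (fun x => L x v).

Definition abs_cont_on (T : R) (g : R -> 'rV[R]_n) : Prop :=
  forall eps : R, 0 < eps -> exists2 delta : R, 0 < delta &
    forall (k : nat) (a b : nat -> R),
      (forall i, (i < k)%N -> 0 <= a i /\ a i <= b i /\ b i <= T) ->
      (forall i, (i.+1 < k)%N -> b i <= a i.+1) ->
      \sum_(i < k) (b i - a i) < delta ->
      \sum_(i < k) enorm (g (b i) - g (a i)) < eps.

Definition Gam (Omega : set 'rV[R]_n) (T : R) : set (R -> 'rV[R]_n) :=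
  [set g | abs_cont_on T g /\ forall s, 0 <= s <= T -> closure Omega (g s)].

(** sigma-algebra on curves: generated by Gamma and the evaluation maps e_t,
    t in [0,T] (its trace on Gamma is the Borel sigma-algebra of Gamma for the
    uniform topology) *)
Definition curve_gen (Omega : set 'rV[R]_n) (T : R) : set (set (R -> 'rV[R]_n)) :=
  [set S | S = Gam Omega T \/
     exists (t : R) (i : 'I_n) (B : set R),
       0 <= t <= T /\ measurable B /\ S = [set g | B (g t ord0 i)]].
Definition CurveM (Omega : set 'rV[R]_n) (T : R) :=
  g_sigma_algebraType (curve_gen Omega T).

Definition cost (T : R) (L : 'rV[R]_n -> 'rV[R]_n -> R)
  (F G : 'rV[R]_n -> probability Pt R -> R) (m : R -> probability Pt R)
  (t : R) (g : R -> 'rV[R]_n) : \bar R :=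
  (\int[lebesgue_measure]_(s in `[t, T]%classic)
      (L (g s) (derive1 g s) + F (g s) (m s))%:E
   + (G (g T) (m T))%:E)%E.

Definition supp_eta (Omega : set 'rV[R]_n) (T : R)
  (eta : probability (CurveM Omega T) R) : set (R -> 'rV[R]_n) :=
  [set g | Gam Omega T g /\ forall eps : R, 0 < eps ->
     (0 < eta ([set g' | Gam Omega T g' /\
                 forall s, (0 <= s <= T)%R -> (enorm (g' s - g s) < eps)%R]
               : set (CurveM Omega T)))%E].

Definition is_minimizer (Omega : set 'rV[R]_n) (T : R)
  (L : 'rV[R]_n -> 'rV[R]_n -> R) (F G : 'rV[R]_n -> probability Pt R -> R)
  (m : R -> probability Pt R) (g : R -> 'rV[R]_n) : Prop :=
  Gam Omega T g /\
  forall g', Gam Omega T g' -> g' 0 = g 0 ->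
    (cost T L F G m 0 g <= cost T L F G m 0 g')%E.

Definition mild_solution (Omega : set 'rV[R]_n) (T : R)
  (L : 'rV[R]_n -> 'rV[R]_n -> R) (F G : 'rV[R]_n -> probability Pt R -> R)
  (u : R -> 'rV[R]_n -> R) (m : R -> probability Pt R) : Prop :=
  {within [set z : R * 'rV[R]_n | 0 <= z.1 <= T /\ closure Omega z.2],
     continuous (fun z : R * 'rV[R]_n => u z.1 z.2)} /\
  (forall t, 0 <= t <= T -> in_PO Omega (m t)) /\
  (forall t, 0 <= t <= T -> forall eps : R, 0 < eps -> exists2 delta : R, 0 < delta &
     forall s, 0 <= s <= T -> `|s - t| < delta -> d1 Omega (m s) (m t) < eps) /\
  exists eta : probability (CurveM Omega T) R,
    eta (Gam Omega T : set (CurveM Omega T)) = 1%E /\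
    (forall t, 0 <= t <= T -> forall A : set Pt, measurable A ->
       m t A = eta ([set g | A (g t)] : set (CurveM Omega T))) /\
    (forall g, supp_eta eta g -> is_minimizer Omega T L F G m g) /\
    (forall t x, 0 <= t <= T -> closure Omega x ->
       ((u t x)%:E = ereal_inf [set cost T L F G m t g
                                | g in [set g | Gam Omega T g /\ g t = x]])%E).

Definition dQ (Omega : set 'rV[R]_n) (T : R) (m : R -> probability Pt R)
  (t : R) (x : 'rV[R]_n) : Prop :=
  0 < t < T /\ bdry Omega x /\ supp_m (m t) x.

(** (p1, p2) in D^+ u(t,x) (limsup over (0,T) x closure Omega, unfolded) *)
Definition superdiff (Omega : set 'rV[R]_n) (T : R) (u : R -> 'rV[R]_n -> R)
  (t : R) (x : 'rV[R]_n) (p1 : R) (p2 : 'rV[R]_n) : Prop :=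
  forall eps : R, 0 < eps -> exists2 delta : R, 0 < delta &
    forall s y, 0 < s < T -> closure Omega y ->
      `|s - t| + enorm (y - x) < delta ->
      u s y - u t x - p1 * (s - t) - dot p2 (y - x)
        <= eps * (`|s - t| + enorm (y - x)).

End MFGDefs.

(* Main.v *)
(* Write Phi(v) = L(x, v) + F(x, m(t)) + p1 + <p2, v>.  The theorem says that the
   infimum of Phi over tangential velocities is 0.

   Phi >= 0 on tangential v: a velocity w pointing strictly inwards gives an
   admissible segment starting from (t, x); comparing the dynamic programming
   inequality along it with the superdifferential inequality gives Phi(w) >= 0, and
   tangential velocities are limits of inward ones.

   Almost zero values: since x is in the support of m(t), a minimizer g passes
   arbitrarily close to x at time t.  On [t - h, t] the dynamic programming equality,
   Jensen's inequality and the superdifferential bound Phi(v) above by a small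
   quantity, where v is the mean velocity of g.  To see that v is almost tangential,
   let w be the mean velocity on [t, t + h]: as g stays in the closed domain, v cannot
   point much inwards nor w much outwards, while replacing g on [t - h, t + h] by
   the chord, pushed slightly inwards to stay in the domain, shows by strong
   convexity of L(x, .) that |v - w| is small.  Projecting v on the tangent space
   changes Phi little.  The curve g need not be differentiable at t. *)

Require Import Defs.
From HB Require Import structures.
From mathcomp Require Import all_boot all_order all_algebra.
From mathcomp Require Import all_classical all_reals all_analysis.
From mathcomp Require Import measurable_realfun.
From mathcomp Require Import ring lra.
Import Order.TTheory GRing.Theory Num.Theory.
Import numFieldNormedType.Exports.
Local Open Scope ring_scope.
Local Open Scope classical_set_scope.

Set Implicit Arguments.
Unset Strict Implicit.
Unset Printing Implicit Defensive.

(** * Integration without measurability *)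

(** All errors are expressed through one small [om], and the order of choices matters. The time step
    h is fixed before the minimizer g: minimizers share a modulus of continuity, obtained from a
    common bound on their action, so one h serves all of them. Only then is g taken with |g(t) - x|
    <= om h, so that g(t) can stand for x in every difference quotient. Actions are bounded from one
    side at a time: from below by integrating a supporting affine function of L(x, .), whose
    integral depends on g only through its endpoints; from above by a constant, along explicit
    curves. Freezing L at x costs om (1 + |velocity|^2), and no pointwise bound on the velocity of g
    is at hand; strong convexity absorbs this term. The bound on |v| must not depend on [om], since
    the tangential projection is priced with it. That an absolutely continuous curve is recovered
    from its derivative comes from the Radon-Nikodym and Lebesgue differentiation theorems, applied
    to Stieltjes measures. *)

(* Integrands [s |-> L (g s) (g' s) + F (g s) (m s)] are not known to be
   measurable, but [\int] is then still the lower integral of the positive part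
   minus that of the negative part, and this is monotone and additive over
   measurable sets. *)
Section lower_integral.
Context d (T : measurableType d) (R : realType) (mu : {measure set T -> \bar R}).
Local Open Scope ereal_scope.
Import HBNNSimple.
Implicit Types (f g : T -> \bar R) (D A B N : set T).

Lemma ge0_lower_integral_le D f g : (forall x, D x -> 0 <= f x) ->
  (forall x, D x -> f x <= g x) -> \int[mu]_(x in D) f x <= \int[mu]_(x in D) g x.
Proof.
move=> f0 fg; rewrite !ge0_integralE//; last first.
  by move=> x Dx; rewrite (le_trans (f0 _ Dx))// fg.
apply: ge_ereal_sup => _ [h hf <-]; apply: ereal_sup_ubound; exists h => //= x.
apply: (le_trans (hf x)); rewrite /patch; case: ifPn => // /set_mem Dx.
exact: fg.
Qed.

(** A simple function below f on the union splits into its restrictions to A and B; conversely,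
    simple functions below f on A and on B add up to one on the union. An infinite value is set
    aside first, so that the two suprema can be taken one after the other by subtraction. *)
Lemma ge0_lower_integral_setU A B f : measurable A -> measurable B ->
  [disjoint A & B] -> (forall x, (A `|` B) x -> 0 <= f x) ->
  \int[mu]_(x in A `|` B) f x = \int[mu]_(x in A) f x + \int[mu]_(x in B) f x.
Proof.
move=> mA mB AB0 f0.
have fA0 x : A x -> 0 <= f x by move=> ?; apply: f0; left.
have fB0 x : B x -> 0 <= f x by move=> ?; apply: f0; right.
have dAB x : A x -> B x -> False.
  by move=> Ax Bx; move/disj_setPS : AB0 => /(_ x); exact.
apply/eqP; rewrite eq_le; apply/andP; split.
  rewrite [leLHS]ge0_integralE//; apply: ge_ereal_sup => _ [h hf <-].
  have -> : sintegral mu h =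
      sintegral mu (proj_nnsfun h mA) + sintegral mu (proj_nnsfun h mB).
    rewrite -sintegralD; apply: eq_sintegral => x /=; rewrite !mindicE.
    have := hf x; rewrite /patch; case: ifPn => [|].
      rewrite inE => -[Ax|Bx] _.
        rewrite mem_set// memNset ?mulr1 ?mulr0 ?addr0// => Bx; exact: dAB Bx.
      rewrite memNset ?mem_set// ?mulr1 ?mulr0 ?add0r// => Ax; exact: dAB Bx.
    rewrite notin_setE => /not_orP[nA nB]; rewrite !memNset//.
    rewrite lee_fin => h0; have -> : h x = 0%R.
      by apply/eqP; rewrite eq_le h0 fun_ge0.
    by rewrite !mul0r addr0.
  apply: leeD; rewrite ge0_integralE//; apply: ereal_sup_ubound.
  - exists (proj_nnsfun h mA) => //= x; rewrite mindicE /patch.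
    have := hf x; rewrite /patch in_setU.
    by case: (x \in A); rewrite /= ?mulr1 ?mulr0//.
  - exists (proj_nnsfun h mB) => //= x; rewrite mindicE /patch.
    have := hf x; rewrite /patch in_setU.
    by case: (x \in B); rewrite ?orbT /= ?mulr1 ?mulr0//.
have [->|Xfin] := eqVneq (\int[mu]_(x in A `|` B) f x) +oo; first exact: leey.
have Xn : \int[mu]_(x in A `|` B) f x \is a fin_num.
  by rewrite ge0_fin_numE ?ltey// integral_ge0.
have key (hA hB : {nnsfun T >-> R}) : (forall x, (hA x)%:E <= (f \_ A) x) ->
    (forall x, (hB x)%:E <= (f \_ B) x) ->
    sintegral mu hA + sintegral mu hB <= \int[mu]_(x in A `|` B) f x.
  move=> HA HB; rewrite -sintegralD [leRHS]ge0_integralE//.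
  apply: ereal_sup_ubound; exists (add_nnsfun hA hB) => //= x.
  rewrite EFinD; have := HA x; have := HB x; rewrite /patch in_setU.
  have [/set_mem Ax|nA] := boolP (x \in A).
    rewrite memNset /=; last by move=> Bx; exact: (dAB x).
    by move=> hb ha; rewrite -[leRHS]adde0; exact: leeD.
  by case: (x \in B) => /= hb ha; rewrite -[leRHS]add0e; exact: leeD.
have sA (hA : {nnsfun T >-> R}) : (forall x, (hA x)%:E <= (f \_ A) x) ->
    sintegral mu hA \is a fin_num.
  move=> HA; rewrite ge0_fin_numE ?sintegral_ge0//.
  apply: (@le_lt_trans _ _ (\int[mu]_(x in A `|` B) f x)); last by rewrite ltey.
  have := key hA nnsfun0 HA; rewrite sintegral0 adde0; apply => x.
  by rewrite /patch; case: ifPn => // /set_mem /fB0.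
have IB (hA : {nnsfun T >-> R}) : (forall x, (hA x)%:E <= (f \_ A) x) ->
    \int[mu]_(x in B) f x <= \int[mu]_(x in A `|` B) f x - sintegral mu hA.
  move=> HA; rewrite [leLHS]ge0_integralE//; apply: ge_ereal_sup => _ [h hf <-].
  rewrite leeBrDl; [exact: key|exact: sA].
have IBn : \int[mu]_(x in B) f x \is a fin_num.
  rewrite ge0_fin_numE ?integral_ge0//.
  apply: (@le_lt_trans _ _ (\int[mu]_(x in A `|` B) f x)); last by rewrite ltey.
  have := IB nnsfun0; rewrite sintegral0 sube0; apply => x.
  by rewrite /patch; case: ifPn => // /set_mem /fA0.
rewrite -leeBrDr// [leLHS]ge0_integralE//; apply: ge_ereal_sup => _ [h hf <-].
by rewrite leeBrDr// -leeBrDl ?IB// sA.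
Qed.

Lemma ge0_lower_integral_null N f : measurable N -> mu N = 0 ->
  (forall x, N x -> 0 <= f x) -> \int[mu]_(x in N) f x = 0.
Proof.
move=> mN N0 f0; apply/eqP; rewrite eq_le integral_ge0// andbT.
rewrite ge0_integralE//; apply: ge_ereal_sup => _ [h hf <-].
have -> : sintegral mu h = sintegral mu (h \_ N).
  apply: eq_sintegral => x; rewrite /patch; case: ifPn => // xN.
  have := hf x; rewrite /patch (negbTE xN) lee_fin => h0.
  by apply/eqP; rewrite eq_le h0 fun_ge0.
rewrite -(integral_nnsfun _ mN h).
rewrite (_ : \int[mu]_(x in N) (h x)%:E = \int[mu]_(x in N) `|(h x)%:E|).
  by rewrite (@integral_abs_eq0 _ _ _ mu N (EFin \o h))//; exact/measurable_EFinP/measurable_funTS.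
by apply: eq_integral => x _; rewrite gee0_abs// lee_fin fun_ge0.
Qed.

Lemma lower_integral_setD D N f : measurable D -> measurable N -> mu N = 0 ->
  \int[mu]_(x in D) f x = \int[mu]_(x in D `\` N) f x.
Proof.
move=> mD mN N0.
have key g : (forall x, 0 <= g x) ->
    \int[mu]_(x in D) g x = \int[mu]_(x in D `\` N) g x.
  move=> g0; rewrite -[in LHS](setUIDK D N) ge0_lower_integral_setU//.
  - rewrite ge0_lower_integral_null ?add0e//; first exact: measurableI.
    apply/eqP; rewrite eq_le measure_ge0 andbT -N0 le_measure ?inE//.
    exact: measurableI.
  - exact: measurableI.
  - exact: measurableD.
  - by apply/disj_setPS => x [[_ Nx] [_]].
by rewrite [LHS]integralE [RHS]integralE !key.
Qed.

Lemma lower_integral_le D N f g : measurable D -> measurable N -> mu N = 0 ->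
  (forall x, D x -> ~ N x -> f x <= g x) ->
  \int[mu]_(x in D) f x <= \int[mu]_(x in D) g x.
Proof.
move=> mD mN N0 fg.
rewrite (lower_integral_setD f mD mN N0) (lower_integral_setD g mD mN N0).
rewrite [leLHS]integralE [leRHS]integralE; apply: leeB.
  apply: ge0_lower_integral_le => // x [Dx Nx].
  by rewrite !funeposE ge_max !le_max lexx fg ?orbT.
apply: ge0_lower_integral_le => // x [Dx Nx].
by rewrite !funenegE ge_max !le_max lexx leeN2 fg ?orbT.
Qed.

(** Finiteness of the two negative parts excludes the form oo - oo when the four integrals are
    regrouped. *)
Lemma lower_integral_setU A B f : measurable A -> measurable B ->
  [disjoint A & B] ->
  \int[mu]_(x in A) f^\- x < +oo -> \int[mu]_(x in B) f^\- x < +oo ->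
  \int[mu]_(x in A `|` B) f x = \int[mu]_(x in A) f x + \int[mu]_(x in B) f x.
Proof.
move=> mA mB AB fA fB.
rewrite (integralE _ (A `|` B)) (integralE _ A) (integralE _ B).
rewrite (ge0_lower_integral_setU (f := f^\+) mA mB AB)//.
rewrite (ge0_lower_integral_setU (f := f^\-) mA mB AB)//.
have hB : \int[mu]_(x in B) f^\- x \is a fin_num by rewrite ge0_fin_numE// integral_ge0.
by rewrite fin_num_oppeD// addeACA.
Qed.

End lower_integral.

(** * Absolutely continuous functions *)

Section scalar_ac.
Context {R : realType}.
Implicit Types (f h : R -> R) (s : seq (R * R)) (lo hi : R).

(** Ordered non-overlapping intervals in [lo, hi], as pairs of endpoints. Degenerate intervals are
    allowed, so that unwanted cells can be emptied in place. *)
Fixpoint itv_chain lo hi s : Prop :=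
  if s is p :: s' then [/\ lo <= p.1, p.1 <= p.2 & itv_chain p.2 hi s']
  else lo <= hi.

(** Scalar absolute continuity, with the family of intervals as a list instead of the indexed family
    of [abs_cont_on]: chains can then be concatenated and refined by induction. *)
Definition ac_chain lo hi f := forall e : R, 0 < e -> exists2 d : R, 0 < d &
  forall s, itv_chain lo hi s -> \sum_(p <- s) (p.2 - p.1) < d ->
    \sum_(p <- s) `|f p.2 - f p.1| < e.

Lemma itv_chain_le lo hi s : itv_chain lo hi s -> lo <= hi.
Proof.
elim: s lo => [//|p s ih] lo /= [h1 h2 /ih h3].
exact: le_trans h1 (le_trans h2 h3).
Qed.

Lemma itv_chain_cat lo mi hi s s' :
  itv_chain lo mi s -> itv_chain mi hi s' -> itv_chain lo hi (s ++ s').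
Proof.
elim: s lo => [|p s ih] lo /=; last by move=> [? ? h] h'; split => //; exact: ih.
by case: s' => [|q s'] /=; [exact: le_trans|move=> h [h1 ? ?]; split => //; exact: le_trans h1].
Qed.

Fixpoint cells (a : R) (l : seq R) : seq (R * R) :=
  if l is c :: l' then (a, c) :: cells c l' else [::].

Lemma cells_chain a b l : itv_partition a b l -> itv_chain a b (cells a l).
Proof.
case; elim: l a => [|c l ih] a /=; first by move=> _ /eqP ->.
by move=> /andP[ac p] h; split => //; [exact: ltW|exact: ih].
Qed.

Lemma cells_len a b l : itv_partition a b l ->
  \sum_(p <- cells a l) (p.2 - p.1) = b - a.
Proof.
case; elim: l a => [|c l ih] a /=; first by move=> _ /eqP ->; rewrite big_nil subrr.
by move=> /andP[ac p] h; rewrite big_cons /= ih// addrC subrKA.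
Qed.

Lemma cells_variation a b f l : itv_partition a b l ->
  variation a b f l = \sum_(p <- cells a l) `|f p.2 - f p.1|.
Proof.
move=> h; rewrite (variation_zip _ h) => {h}.
elim: l a => [|c l ih] a /=; first by rewrite !big_nil.
by rewrite !big_cons /= ih.
Qed.

(** Intervals of [s2] still await the supremum over their partitions, while [s1] holds cells of
    partitions already fixed. At each induction step the first interval of [s2] is replaced by the
    cells of an arbitrary partition, which join [s1]; the total length does not change, so the same
    d serves throughout. *)
Lemma ac_chain_tv_aux lo mi hi f (e d : R) s1 s2 :
  (forall s, itv_chain lo hi s -> \sum_(p <- s) (p.2 - p.1) < d ->
    \sum_(p <- s) `|f p.2 - f p.1| < e) ->
  itv_chain lo mi s1 -> itv_chain mi hi s2 ->
  \sum_(p <- s1) (p.2 - p.1) + \sum_(p <- s2) (p.2 - p.1) < d ->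
  (\sum_(p <- s2) total_variation p.1 p.2 f
     <= (e - \sum_(p <- s1) `|f p.2 - f p.1|)%:E)%E.
Proof.
move=> H; elim: s2 s1 mi => [|[a b] s2 ih] s1 mi c1 c2 len.
  rewrite big_nil lee_fin subr_ge0 ltW// H//.
    by rewrite -(cats0 s1); exact: itv_chain_cat c1 c2.
  by move: len; rewrite big_nil addr0.
rewrite big_cons /=; move: c2 => /= [mia ab c2].
have key l : itv_partition a b l ->
    (\sum_(p <- s2) total_variation p.1 p.2 f <=
      (e - \sum_(p <- s1) `|f p.2 - f p.1| - variation a b f l)%:E)%E.
  move=> pl; have := ih (s1 ++ cells a l) b.
  rewrite !big_cat /= -(cells_variation f pl) (cells_len pl).
  move=> h; rewrite -addrA -opprD; apply: h => //.
    apply: itv_chain_cat c1 _; have /= := cells_chain pl.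
    case: (cells a l) => [|q c] /=; first exact: le_trans.
    by move=> [h ? ?]; split => //; exact: le_trans h.
  by move: len; rewrite big_cons /= addrA.
have tv0 : (0 <= \sum_(p <- s2) total_variation p.1 p.2 f)%E.
  move: c2; move: (s2) (b) => s'; elim: s' => [|q s2' ih'] b' /=; first by rewrite big_nil.
  move=> [_ h /ih' h']; rewrite big_cons adde_ge0//.
  exact: total_variation_ge0.
have [l0 pl0] : exists l, itv_partition a b l.
  move: ab; rewrite le_eqVlt => /predU1P[->|ab]; last by exists [:: b]; exact: itv_partition1.
  by exists [::].
have fin : (\sum_(p <- s2) total_variation p.1 p.2 f)%E \is a fin_num.
  by rewrite ge0_fin_numE// (le_lt_trans (key _ pl0))// ltry.
rewrite -leeBrDr// /total_variation; apply: ge_ereal_sup => _ [_ [l pl <-] <-].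
by rewrite leeBrDr// -leeBrDl// -EFinB; exact: key.
Qed.

Lemma ac_chain_tv lo hi f (e d : R) s :
  (forall s, itv_chain lo hi s -> \sum_(p <- s) (p.2 - p.1) < d ->
    \sum_(p <- s) `|f p.2 - f p.1| < e) ->
  itv_chain lo hi s -> \sum_(p <- s) (p.2 - p.1) < d ->
  (\sum_(p <- s) total_variation p.1 p.2 f <= e%:E)%E.
Proof.
move=> H c len; have := @ac_chain_tv_aux lo lo hi f e d [::] s H.
rewrite !big_nil add0r subr0; apply => //=.
Qed.

(** The variation is at most 1 on intervals shorter than the d attached to 1; longer ones are cut
    into steps of length d / 2, by induction on the number of steps. *)
Lemma ac_chain_tv_fin lo hi f : lo <= hi -> ac_chain lo hi f ->
  forall a b, lo <= a -> a <= b -> b <= hi -> total_variation a b f \is a fin_num.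
Proof.
move=> lohi /(_ 1 ltr01)[d d0 H].
have small a b : lo <= a -> a <= b -> b <= hi -> b - a < d ->
    total_variation a b f \is a fin_num.
  move=> la ab bh bad; have := @ac_chain_tv lo hi f 1 d [:: (a, b)] H.
  rewrite !big_seq1 /= ge0_fin_numE ?total_variation_ge0// => h.
  by rewrite (le_lt_trans (h _ _))// ltry.
suff big k a b : lo <= a -> a <= b -> b <= hi -> b - a < k.+1%:R * d / 2 ->
    total_variation a b f \is a fin_num.
  move=> a b la ab bh.
  apply: (big (Num.truncn ((b - a) * 2 / d))) => //.
  rewrite ltr_pdivlMr// -ltr_pdivrMr//.
  by have /truncn_itv/andP[] : 0 <= (b - a) * 2 / d
    by rewrite divr_ge0 ?mulr_ge0 ?subr_ge0// ltW.
elim: k a b => [|k ih] a b la ab bh bad.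
  by apply: small => //; apply: (lt_trans bad); rewrite mul1r ltr_pdivrMr// ltr_pMr// ltr1n.
have [h|h] := ltP (b - a) (d / 2).
  by apply: small => //; apply: (lt_trans h); rewrite ltr_pdivrMr// ltr_pMr// ltr1n.
rewrite (@total_variationD _ a b (a + d / 2))//; last 2 first.
  by rewrite lerDl divr_ge0// ltW.
  by rewrite -lerBrDl.
rewrite fin_numD; apply/andP; split.
  apply: small => //; first by rewrite lerDl divr_ge0// ltW.
    by apply: le_trans bh; rewrite -lerBrDl.
  by rewrite addrAC subrr add0r ltr_pdivrMr// ltr_pMr// ltr1n.
apply: ih => //.
- by apply: (le_trans la); rewrite lerDl divr_ge0// ltW.
- by rewrite -lerBrDl.
- move: bad; rewrite -natr1; lra.
Qed.

(** Jordan decomposition, with V the total variation from lo. V is absolutely continuous because the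
    variations of f over the intervals of a short chain have a small sum. *)
Lemma ac_chain_monotone_split lo hi f : lo <= hi -> ac_chain lo hi f ->
  exists V : R -> R, [/\ forall a b, lo <= a -> a <= b -> b <= hi -> V a <= V b,
    ac_chain lo hi V,
    forall a b, lo <= a -> a <= b -> b <= hi -> V a - f a <= V b - f b &
    ac_chain lo hi (fun x => V x - f x)].
Proof.
move=> lohi acf; have fin := ac_chain_tv_fin lohi acf.
pose V x := fine (total_variation lo x f); exists V.
have VE a b : lo <= a -> a <= b -> b <= hi ->
    V b - V a = fine (total_variation a b f).
  move=> la ab bh; rewrite /V (total_variationD f la ab) fineD ?fin//.
    by rewrite addrAC subrr add0r.
  exact: le_trans ab bh.
have Vge a b : lo <= a -> a <= b -> b <= hi -> `|f b - f a| <= V b - V a.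
  move=> la ab bh; rewrite VE// -lee_fin fineK ?fin//.
  exact: total_variation_ge.
have acV : ac_chain lo hi V.
  move=> e e0; have [|d d0 H] := acf (e / 2); first by rewrite divr_gt0.
  exists d => // s cs len.
  apply: (@le_lt_trans _ _ (e / 2)); last by rewrite ltr_pdivrMr// ltr_pMr// ltr1n.
  rewrite -lee_fin; apply: le_trans (ac_chain_tv H cs len).
  rewrite -sumEFin; move: cs {len}; have : lo <= lo by [].
  move: {2 3}lo => l; elim: s l => [|p s ih] l ll /=; first by rewrite !big_nil.
  move=> [h1 h2 h3]; rewrite !big_cons; apply: leeD; last first.
    by apply: (ih p.2) => //; exact: le_trans ll (le_trans h1 h2).
  have ph := itv_chain_le h3; have lp := le_trans ll h1.
  rewrite VE// ger0_norm ?fineK ?fin// fine_ge0//.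
  exact: total_variation_ge0.
split => //.
- move=> a b la ab bh; rewrite -subr_ge0; exact: le_trans (Vge _ _ la ab bh).
- move=> a b la ab bh; have := Vge _ _ la ab bh; rewrite ler_norml => /andP[_]; lra.
- move=> e e0.
  have [|d1 d10 H1] := acf (e / 2); first by rewrite divr_gt0.
  have [|d2 d20 H2] := acV (e / 2); first by rewrite divr_gt0.
  exists (Num.min d1 d2); first by rewrite lt_min d10.
  move=> s cs; rewrite lt_min => /andP[l1 l2].
  rewrite [ltRHS](splitr e); apply: le_lt_trans (ltrD (H2 _ cs l2) (H1 _ cs l1)).
  rewrite -big_split /=; apply: ler_sum => p _.
  have -> : V p.2 - f p.2 - (V p.1 - f p.1) = (V p.2 - V p.1) - (f p.2 - f p.1) by ring.
  exact: ler_normB.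
Qed.

(* [dcover k] is the union of those cells of the k-th dyadic subdivision of
   ]lo, hi] that lie in [U]; [dyadr] makes the other cells empty, so that all
   cells of one level always form a chain. *)
Section dyadic.
Variables (lo hi : R) (lohi : lo < hi) (U : set R).

Definition dyad (k j : nat) : R := lo + (hi - lo) * j%:R / (2 ^ k)%:R.

Definition dyadr (k j : nat) : R :=
  if `[< `]dyad k j, dyad k j.+1] `<=` U >] then dyad k j.+1 else dyad k j.

Definition dcover (k : nat) : set R :=
  \big[setU/set0]_(i < 2 ^ k) `]dyad k i, dyadr k i]%classic.

Lemma dyad_le k i j : (i <= j)%N -> dyad k i <= dyad k j.
Proof.
move=> ij; rewrite lerD2l ler_pM2r ?invr_gt0 ?ltr0n ?expn_gt0//.
by rewrite ler_pM2l ?subr_gt0// ler_nat.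
Qed.

Lemma dyadr_itv k j : dyad k j <= dyadr k j <= dyad k j.+1.
Proof. by rewrite /dyadr; case: ifP; rewrite ?lexx ?dyad_le. Qed.

Lemma dyadS k j : dyad k j = dyad k.+1 (2 * j).
Proof.
rewrite /dyad expnS !natrM; congr (_ + _).
by rewrite invfM; field; rewrite ?pnatr_eq0 ?expn_eq0.
Qed.

Lemma dyad0 k : dyad k 0 = lo. Proof. by rewrite /dyad mulr0 mul0r addr0. Qed.

Lemma dyadn k : dyad k (2 ^ k) = hi.
Proof. by rewrite /dyad mulfK ?pnatr_eq0 ?expn_eq0// addrC subrK. Qed.

Lemma dcoverP k x : dcover k x <-> exists j, [/\ (j < 2 ^ k)%N,
  dyad k j < x, x <= dyad k j.+1 & `]dyad k j, dyad k j.+1] `<=` U].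
Proof.
rewrite /dcover -(@bigcup_mkord _ (2 ^ k) (fun i => `]dyad k i, dyadr k i]%classic)).
split.
  move=> [j /= jk]; rewrite in_itv /= /dyadr; case: asboolP => [sU /andP[? ?]|_ /andP[h1 h2]].
    by exists j.
  by have := lt_le_trans h1 h2; rewrite ltxx.
move=> [j [jk h1 h2 sU]]; exists j => //=; rewrite in_itv /= h1 /dyadr.
by case: asboolP.
Qed.

Lemma dcover_sub k : dcover k `<=` U.
Proof. by move=> x /dcoverP[j [_ h1 h2]]; apply; rewrite /= in_itv /= h1. Qed.

(** A cell inside U is cut into two cells of the next level, both inside U. *)
Lemma dcover_homo : {homo dcover : n m / (n <= m)%N >-> (n <= m)%O}.
Proof.
apply: homo_leq => [x|? ? ?|k]; [exact: lexx|exact: le_trans|].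
rewrite subsetEset => x /dcoverP[j [jk h1 h2 sU]]; apply/dcoverP.
have jk' : ((2 * j).+1 < 2 ^ k.+1)%N.
  by rewrite expnS; apply: (@leq_trans (2 * j.+1)); rewrite ?leq_pmul2l// mulnS.
have [xl|xr] := leP x (dyad k.+1 (2 * j).+1).
  exists (2 * j)%N; split; rewrite ?(ltnW jk')// -?dyadS// => y /=.
  rewrite in_itv /= => /andP[y1 y2]; apply: sU; rewrite /= in_itv /= y1.
  rewrite (le_trans y2)// (dyadS k j.+1) dyad_le//.
  by rewrite mulnS.
exists (2 * j).+1; split => //.
  by rewrite -addn2 addnC -mulnS -dyadS.
move=> y /=.
rewrite in_itv /= => /andP[y1 y2]; apply: sU; rewrite /= in_itv /=.
rewrite (dyadS k j.+1) mulnS addnC addn2 y2 andbT (le_lt_trans _ y1)//.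
by rewrite (dyadS k j) dyad_le.
Qed.

(** Once the cells are shorter than the radius of a ball around x inside U, the cell that contains x
    lies in U. *)
Lemma dcover_bigcup : open U -> `]lo, hi] `&` U `<=` \bigcup_k dcover k.
Proof.
move=> oU x [/=]; rewrite in_itv /= => /andP[lx xh] Ux.
have /nbhs_ballP[r /= r0 rU] := open_nbhs_nbhs (conj oU Ux).
have w0 : 0 < hi - lo by rewrite subr_gt0.
have [k hk] : exists k, (hi - lo) / r < (2 ^ k)%:R.
  exists (Num.truncn ((hi - lo) / r)).+1.
  have /truncn_itv/andP[_ /lt_le_trans] : 0 <= (hi - lo) / r by rewrite divr_ge0// ltW.
  by apply; rewrite ler_nat ltnW// ltn_expl.
exists k => //.
have ex : exists j, x <= dyad k j by exists (2 ^ k)%N; rewrite dyadn.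
(* Cells are open on the left: the least index whose grid point is at least x is the right end of
   the cell of x. *)
case: (ex_minnP ex) => -[|j] xj minj.
  by move: xj; rewrite dyad0 leNgt lx.
have jx : dyad k j < x by rewrite ltNge; apply/negP => /minj; rewrite ltnn.
apply/dcoverP; exists j; split => //.
  by apply: minj; rewrite dyadn.
have step : dyad k j.+1 - dyad k j < r.
  rewrite [X in X < _](_ : _ = (hi - lo) / (2 ^ k)%:R); last first.
    rewrite /dyad -natr1; field; by rewrite pnatr_eq0 expn_eq0.
  by rewrite ltr_pdivrMr ?ltr0n ?expn_gt0// mulrC -ltr_pdivrMr.
move=> y /=; rewrite in_itv /= => /andP[y1 y2]; apply: rU; rewrite /ball /= ltr_norml.
apply/andP; split; lra.
Qed.

Lemma dcover_measure (mu : {measure set (measurableTypeR R) -> \bar R}) k :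
  mu (dcover k) = (\sum_(i < 2 ^ k) mu `]dyad k i, dyadr k i]%classic)%E.
Proof.
apply: (measure_bigsetU mu (F := fun i => `]dyad k i, dyadr k i]%classic)).
  by move=> i; exact: measurable_itv.
apply/trivIsetP => i j _ _; wlog : i j / (i < j)%N => [wl|ij _].
  by rewrite neq_ltn => /orP[|] h; [|rewrite setIC]; apply: wl; rewrite ?ltn_eqF.
apply/seteqP; split => // x [/=]; rewrite !in_itv /= => /andP[_ x1] /andP[x2 _].
have /andP[_ h] := dyadr_itv k i.
by have := lt_le_trans x2 (le_trans x1 (le_trans h (dyad_le k ij))); rewrite ltxx.
Qed.

Lemma dyad_chain k : itv_chain lo hi [seq (dyad k j, dyadr k j) | j <- iota 0 (2 ^ k)].
Proof.
have gen n i l : (l <= dyad k i) -> (i + n = 2 ^ k)%N ->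
    itv_chain l hi [seq (dyad k j, dyadr k j) | j <- iota i n].
  elim: n i l => [|n ih] i l li /=; first by rewrite addn0 => ik; rewrite -(dyadn k) -ik.
  move=> ink; have /andP[h1 h2] := dyadr_itv k i; split => //.
  by apply: ih; rewrite ?addSnnS.
by apply: gen; rewrite ?dyad0.
Qed.

End dyadic.

End scalar_ac.

(** * The fundamental theorem of calculus for absolutely continuous functions *)

Section ftc_ac.
Context {R : realType}.
Implicit Types (f h : R -> R) (lo hi : R).
Local Notation mu := (@lebesgue_measure R).

(** The projection onto [lo, hi], used to extend functions from the interval to the line by
    constants. *)
Definition clamp lo hi (x : R) : R := Num.max lo (Num.min x hi).

Lemma clamp_itv lo hi x : lo <= hi -> lo <= clamp lo hi x <= hi.
Proof. by move=> h; rewrite /clamp le_max lexx /= ge_max h ge_min lexx orbT. Qed.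

Lemma clamp_id lo hi x : lo <= x <= hi -> clamp lo hi x = x.
Proof. by move=> /andP[h1 h2]; rewrite /clamp (min_idPl h2) (max_idPr h1). Qed.

Lemma clamp_homo lo hi : {homo clamp lo hi : x y / x <= y}.
Proof. by move=> x y xy; rewrite /clamp; apply: le_max2 => //; exact: le_min2. Qed.

Lemma clamp_dist lo hi x y : lo <= hi -> x <= y -> clamp lo hi y - clamp lo hi x <= y - x.
Proof.
move=> ? ?; rewrite /clamp; case: (leP x hi) => ?; case: (leP y hi) => ?;
  case: (leP lo x) => ?; case: (leP lo y) => ?; case: (leP lo hi) => ?; lra.
Qed.

Lemma ac_chain_continuous lo hi f : lo <= hi -> ac_chain lo hi f ->
  continuous (fun x => f (clamp lo hi x)).
Proof.
move=> lh acf x; apply/cvgrPdist_lt => e e0; have [d d0 H] := acf _ e0.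
have key a b : a <= b -> b - a < d -> `|f (clamp lo hi b) - f (clamp lo hi a)| < e.
  move=> ab bad; have := H [:: (clamp lo hi a, clamp lo hi b)].
  rewrite !big_seq1 /=; apply; last exact: le_lt_trans (clamp_dist lh ab) _.
  have /andP[a1 _] := clamp_itv a lh; have /andP[_ b2] := clamp_itv b lh.
  by split => //; exact: clamp_homo.
exists d => //= y; rewrite /= => xy; have [h|/ltW h] := leP x y.
  by rewrite distrC key//; move: xy; rewrite ltr_norml => /andP[]; lra.
by rewrite key//; move: xy; rewrite ltr_norml => /andP[]; lra.
Qed.

Lemma measurable_itvoc (a b : R) : measurable (`]a, b]%classic : set R).
Proof. exact: measurable_itv. Qed.

(* The Stieltjes measure of h is absolutely continuous: a Lebesgue-null set is
   contained in open sets of small measure, which the dyadic covers exhaust.  The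
   density is its Radon-Nikodym derivative. *)
Lemma monotone_ac_density lo hi h : lo < hi ->
  (forall a b, lo <= a -> a <= b -> b <= hi -> h a <= h b) ->
  ac_chain lo hi h ->
  exists phi : R -> R, mu.-integrable setT (EFin \o phi) /\
    forall a b, lo <= a -> a <= b -> b <= hi ->
      (\int[mu]_(x in `]a, b]) (phi x)%:E = (h b - h a)%:E)%E.
Proof.
move=> lohi mono ach; have lh := ltW lohi.
(* If the total increment vanishes, h is constant and the density 0 works; otherwise the increment
   can serve as a normalization. *)
have [hE|hlt] := leP (h hi) (h lo).
  exists (fun=> 0); split.
    exact: (@integrable0 _ _ R mu setT).
  move=> a b la ab bh.
  have -> : h b = h a.
    apply/eqP; rewrite eq_le (mono a b)// andbT.
    apply: le_trans (mono b hi _ _ _) (le_trans hE (mono lo a _ _ _)) => //.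
      exact: le_trans ab.
    exact: le_trans bh.
  by rewrite subrr integral0.
pose c := h hi - h lo; have c0 : 0 < c by rewrite subr_gt0.
(* Extended by constants and divided by its increment c, h becomes a distribution function with
   limits 0 and 1, so its Stieltjes measure is a probability. The factor c is restored in the
   density. *)
pose H0 := fun x : R => (h (clamp lo hi x) - h lo) / c.
have H0nd : {homo H0 : x y / x <= y}.
  move=> x y xy; rewrite /H0 ler_pM2r ?invr_gt0// lerD2r.
  have /andP[a1 _] := clamp_itv x lh; have /andP[_ b2] := clamp_itv y lh.
  by apply: mono => //; exact: clamp_homo.
have H0rc : right_continuous H0.
  apply: right_continuousW => x; rewrite /H0.
  apply: cvgM; last exact: cvg_cst.
  by apply: cvgB; [exact: ac_chain_continuous|exact: cvg_cst].
have H0Ny : H0 x @[x --> -oo] --> (0 : R).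
  apply: cvg_near_cst; near=> x; rewrite /H0.
  rewrite (_ : clamp lo hi x = lo) ?subrr ?mul0r//.
  rewrite /clamp; apply/max_idPl; rewrite ge_min; apply/orP; left.
  by near: x; apply: nbhs_ninfty_le; rewrite num_real.
have H0y : H0 x @[x --> +oo] --> (1 : R).
  apply: cvg_near_cst; near=> x; rewrite /H0.
  rewrite (_ : clamp lo hi x = hi) ?divff ?gt_eqF//.
  rewrite /clamp (min_idPr _); first by apply/max_idPr.
  by near: x; apply: nbhs_pinfty_ge; rewrite num_real.
pose H : cumulativeBounded (0:R) (1:R) := HB.pack H0
  (isCumulative.Build R _ R H0 H0nd H0rc) (isCumulativeBounded.Build R 0 1 H0 H0Ny H0y).
pose nu : probability (measurableTypeR R) R := lebesgue_stieltjes_measure H.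
have nuE a b : a <= b -> nu `]a, b]%classic = (H0 b - H0 a)%:E.
  move=> ab; rewrite /nu /= /lebesgue_stieltjes_measure /measure_extension.
  by rewrite measurable_mu_extE /=; [rewrite wlength_itv_bnd|exact: is_ocitv].
have nuout A : measurable A -> nu A = nu (A `&` `]lo, hi]%classic).
  move=> mA; rewrite -[in LHS](setUIDK A `]lo, hi]%classic) measureU//=; last 3 first.
  - by apply: measurableI => //; exact: measurable_itvoc.
  - by apply: measurableD => //; exact: measurable_itvoc.
  - by rewrite setDE setIACA setICr setI0.
  rewrite [X in (_ + X)%E](_ : _ = 0%E) ?adde0//.
  apply/eqP; rewrite eq_le measure_ge0 andbT.
  apply: (@le_trans _ _ (nu (~` `]lo, hi]%classic))).
    apply: le_measure; rewrite ?inE//.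
    - by apply: measurableD => //; exact: measurable_itvoc.
    - by apply: measurableC; exact: measurable_itvoc.
  rewrite (probability_setC nu (measurable_itvoc lo hi)).
  rewrite nuE//.
  rewrite /H0 !clamp_id ?lexx ?lh// subrr mul0r subr0 divff ?gt_eqF//.
  by rewrite subee.
have dom : nu `<< mu.
  apply/null_content_dominatesP => A mA A0.
  apply/eqP; rewrite eq_le measure_ge0 andbT; apply/lee_addgt0Pr => e e0.
  rewrite add0e.
  (* The tolerance is e * c because increments of [H0] are those of h divided by c. *)
  have [|d d0 Hd] := ach (e * c); first by rewrite mulr_gt0.
  have [|U [oU AU Ud]] := lebesgue_regularity_outer mA _ d0; first by rewrite A0.
  have mU : measurable U by exact: open_measurable.
  have Ud' : (mu U < d%:E)%E.
    rewrite -(setUIDK U A) (le_lt_trans (measureU2 _ _ _))//=.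
    - exact: measurableI.
    - exact: measurableD.
    - rewrite (_ : U `&` A = A) ?A0 ?add0e//.
      by apply/seteqP; split => [x []//|x Ax]; split => //; exact: AU.
  rewrite nuout//.
  have mD k : measurable (dcover lo hi U k).
    by apply: bigsetU_measurable => i _; exact: measurable_itvoc.
  have mDD : measurable (\bigcup_k dcover lo hi U k) by exact: bigcupT_measurable.
  apply: (@le_trans _ _ (nu (\bigcup_k dcover lo hi U k))).
    apply: le_measure; rewrite ?inE//.
      by apply: measurableI => //; exact: measurable_itvoc.
    move=> x [Ax xl]; apply: dcover_bigcup => //; split => //; exact: AU.
  (* By continuity from below it suffices to bound each dyadic cover, whose cells form a chain of
     total length at most the measure of U, hence less than d. *)
  have cvg := nondecreasing_cvg_mu (mu := nu) mD mDD (dcover_homo lohi U).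
  rewrite -(cvg_lim (@ereal_hausdorff R) cvg).
  apply: lime_le; first by apply/cvg_ex; eexists; exact: cvg.
  near=> k; rewrite /= dcover_measure//.
  have /Hd := dyad_chain lohi U k.
  rewrite !big_map [iota 0 _](_ : _ = index_iota 0 (2 ^ k)); last first.
    by rewrite /index_iota subn0.
  rewrite !big_mkord => Hk.
  rewrite (eq_bigr (fun i : 'I_(2 ^ k) =>
      (H0 (dyadr lo hi U k i) - H0 (dyad lo hi k i))%:E)); last first.
    by move=> i _; have /andP[di _] := dyadr_itv lohi U k i; exact: nuE.
  rewrite sumEFin lee_fin.
  have -> : \sum_(i < 2 ^ k) (H0 (dyadr lo hi U k i) - H0 (dyad lo hi k i)) =
      (\sum_(i < 2 ^ k) `|h (dyadr lo hi U k i) - h (dyad lo hi k i)|) / c.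
    rewrite mulr_suml; apply: eq_bigr => i _.
    have /andP[d1 d2] := dyadr_itv lohi U k i.
    have l1 : lo <= dyad lo hi k i by have := dyad_le lohi k (leq0n i); rewrite dyad0.
    have l2 : dyadr lo hi U k i <= hi.
      by rewrite (le_trans d2)//; have := dyad_le lohi k (ltn_ord i); rewrite dyadn.
    rewrite /H0 !clamp_id ?l1 ?l2 ?(le_trans l1 d1) ?(le_trans d1 l2)//.
    rewrite ger0_norm ?subr_ge0 ?mono//; field; exact: lt0r_neq0.
  rewrite ler_pdivrMr// ltW// Hk//.
  rewrite -lte_fin; apply: le_lt_trans Ud'; rewrite -sumEFin.
  apply: (@le_trans _ _ (mu (dcover lo hi U k))); last first.
    apply: le_measure; rewrite ?inE//.
      exact: mD.
    exact: (@dcover_sub _ lo hi U k).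
  rewrite (dcover_measure lohi U mu).
  apply: lee_sum => i _; rewrite [leRHS](lebesgue_measure_itv
    (Interval (BRight (dyad lo hi k i)) (BRight (dyadr lo hi U k i)))) /= lte_fin.
  by case: ltP => // h'; rewrite lee_fin subr_le0.
have [g [g0 gfin gint gE]] := radon_nikodym_sigma_finite dom.
exists (fun x => c * fine (g x)); split.
  rewrite (_ : EFin \o _ = fun x => c%:E * g x)%E; last first.
    by apply/funext => x /=; rewrite EFinM fineK.
  exact: integrableZl.
move=> a b la ab bh.
transitivity (\int[mu]_(x in `]a, b]) (c%:E * g x))%E.
  by apply: eq_integral => x _; rewrite EFinM fineK.
rewrite integralZl//; last first.
  by apply: integrableS gint => //; exact: measurable_itvoc.
rewrite -gE; last exact: measurable_itvoc.
transitivity (c%:E * (H0 b - H0 a)%:E)%E; first by congr (_ * _)%E; exact: nuE.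
rewrite /H0 !clamp_id ?la ?bh ?(le_trans la ab) ?(le_trans ab bh)// -EFinM.
congr EFin; field; exact: lt0r_neq0.
Unshelve. all: by end_near. Qed.

(** The density is the difference of the densities of the two monotone parts. Near an interior point
    f is its primitive up to the constant f(lo), so Lebesgue differentiation identifies the
    derivative almost everywhere. *)
Lemma ac_ftc lo hi f : lo < hi -> ac_chain lo hi f ->
  exists phi : R -> R, [/\ mu.-integrable setT (EFin \o phi),
    forall a b, lo <= a -> a <= b -> b <= hi ->
      (\int[mu]_(x in `]a, b]) (phi x)%:E = (f b - f a)%:E)%E &
    {ae mu, forall x, lo < x < hi -> derivable f x 1 /\ f^`() x = phi x}].
Proof.
move=> lohi acf; have [V [V1 V2 V3 V4]] := ac_chain_monotone_split (ltW lohi) acf.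
have [p [ip pE]] := monotone_ac_density lohi V1 V2.
have [q [iq qE]] := monotone_ac_density lohi V3 V4.
pose phi x := p x - q x.
have iphi : mu.-integrable setT (EFin \o phi).
  rewrite (_ : EFin \o phi = (EFin \o p) \- (EFin \o q))%E; last first.
    by apply/funext => x /=; rewrite -EFinB.
  exact: integrableB.
have phiE a b : lo <= a -> a <= b -> b <= hi ->
    (\int[mu]_(x in `]a, b]) (phi x)%:E = (f b - f a)%:E)%E.
  move=> la ab bh.
  transitivity (\int[mu]_(x in `]a, b]) ((p x)%:E - (q x)%:E))%E.
    by apply: eq_integral => x _; rewrite -EFinB.
  rewrite integralB//.
  - by rewrite pE// qE// -EFinB; congr EFin; ring.
  - by apply: integrableS ip => //; exact: measurable_itvoc.
  - by apply: integrableS iq => //; exact: measurable_itvoc.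
exists phi; split => //.
have lphi : locally_integrable setT phi.
  have := @integrable_locally R phi setT measurableT iphi.
  by rewrite patch_setT.
have iphi' y : mu.-integrable [set` Interval (BRight lo) (BRight y)] (EFin \o phi).
  by apply: integrableS iphi => //; exact: measurable_itv.
have := FTC1 iphi' lphi; apply: filterS; first exact: (ae_filter_ringOfSetsType mu).
move=> x + /andP[lx xh]; move=> /(_ lx)[dx dE].
have near_eq : \forall y \near x,
    \int[mu]_(t in [set` Interval (BRight lo) (BRight y)]) phi t + f lo = f y.
  near=> y; rewrite /Rintegral phiE// ?subrK//.
    apply/ltW; near: y; exact: lt_nbhsr.
  apply/ltW; near: y; exact: lt_nbhsl.
have isd : is_derive x 1 f (phi x).
  apply: near_eq_is_derive near_eq _.
  rewrite -[phi x]addr0; apply: is_deriveD.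
  by split => //; rewrite -dE derive1E.
by split; [exact: ex_derive|rewrite derive1E derive_val].
Unshelve. all: by end_near. Qed.

End ftc_ac.

(** * Euclidean norm and curves *)

Section euclid.
Context {R : realType} {n : nat}.
Implicit Types (u v w q : 'rV[R]_n).

Lemma dotC u v : dot u v = dot v u.
Proof. by apply: eq_bigr => i _; rewrite mulrC. Qed.

Lemma dotDl u v w : dot (u + v) w = dot u w + dot v w.
Proof. by rewrite -big_split; apply: eq_bigr => i _; rewrite !mxE mulrDl. Qed.

Lemma dotZl (a : R) u v : dot (a *: u) v = a * dot u v.
Proof. by rewrite mulr_sumr; apply: eq_bigr => i _; rewrite !mxE mulrA. Qed.

Lemma dotDr u v w : dot w (u + v) = dot w u + dot w v.
Proof. by rewrite !(dotC w) dotDl. Qed.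

Lemma dotZr (a : R) u v : dot v (a *: u) = a * dot v u.
Proof. by rewrite !(dotC v) dotZl. Qed.

Lemma dotNl u v : dot (- u) v = - dot u v.
Proof. by rewrite -scaleN1r dotZl mulN1r. Qed.

Lemma dotNr u v : dot v (- u) = - dot v u.
Proof. by rewrite !(dotC v) dotNl. Qed.

Lemma dot0l v : dot 0 v = 0.
Proof. by rewrite -(scale0r v) dotZl mul0r. Qed.

Lemma dot0r v : dot v 0 = 0.
Proof. by rewrite dotC dot0l. Qed.

Definition dotE := (dotDl, dotDr, dotZl, dotZr, dotNl, dotNr, dot0l, dot0r).

Lemma dot_ge0 v : 0 <= dot v v.
Proof. by apply: sumr_ge0 => i _; rewrite -expr2 sqr_ge0. Qed.

Lemma enorm_ge0 v : 0 <= enorm v. Proof. exact: sqrtr_ge0. Qed.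

Lemma enorm_sqr v : enorm v ^+ 2 = dot v v.
Proof. by rewrite sqr_sqrtr// dot_ge0. Qed.

Lemma enorm0 : enorm (0 : 'rV[R]_n) = 0.
Proof. by rewrite /enorm dot0l sqrtr0. Qed.

Lemma enormZ (a : R) v : enorm (a *: v) = `|a| * enorm v.
Proof.
by rewrite /enorm dotZl dotZr mulrA -expr2 sqrtrM ?sqr_ge0// sqrtr_sqr.
Qed.

Lemma enormN v : enorm (- v) = enorm v.
Proof. by rewrite -scaleN1r enormZ normrN1 mul1r. Qed.

Lemma enormB v w : enorm (v - w) = enorm (w - v).
Proof. by rewrite -enormN opprB. Qed.

Lemma enorm_eq0 v : enorm v = 0 -> v = 0.
Proof.
move=> /eqP; rewrite sqrtr_eq0 => h.
have /eqP : dot v v = 0 by apply/eqP; rewrite eq_le h dot_ge0.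
rewrite psumr_eq0; last by move=> i _; rewrite -expr2 sqr_ge0.
move=> /allP h'; apply/rowP => i; rewrite mxE; apply/eqP.
by have /= := h' i (mem_index_enum i); rewrite mulf_eq0 orbb.
Qed.

Lemma enorm_gt0 v : v != 0 -> 0 < enorm v.
Proof.
move=> v0; rewrite lt_neqAle enorm_ge0 andbT eq_sym; apply: contra v0 => /eqP h.
by rewrite (enorm_eq0 h).
Qed.

(** Cauchy-Schwarz, read off from the squared norm of |v| u - |u| v. *)
Lemma ler_dot u v : dot u v <= enorm u * enorm v.
Proof.
have [/eqP|u0] := eqVneq (enorm u) 0.
  by move=> /eqP /enorm_eq0 ->; rewrite dot0l enorm0 mul0r.
have up : 0 < enorm u by rewrite lt_neqAle eq_sym u0 enorm_ge0.
have [/eqP|v0] := eqVneq (enorm v) 0.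
  by move=> /eqP /enorm_eq0 ->; rewrite dot0r enorm0 mulr0.
have vp : 0 < enorm v by rewrite lt_neqAle eq_sym v0 enorm_ge0.
have := dot_ge0 (enorm v *: u - enorm u *: v).
rewrite !dotE -!enorm_sqr (dotC v u) => h.
rewrite -(ler_pM2l (mulr_gt0 up vp)); nra.
Qed.

Lemma ler_abs_dot u v : `|dot u v| <= enorm u * enorm v.
Proof.
by rewrite ler_norml ler_dot andbT lerNl -dotNl -(enormN u) ler_dot.
Qed.

Lemma ler_enormD u v : enorm (u + v) <= enorm u + enorm v.
Proof.
rewrite -(@ler_pXn2r _ 2)// ?nnegrE ?enorm_ge0 ?addr_ge0 ?enorm_ge0//.
rewrite enorm_sqr sqrrD !enorm_sqr !dotE (dotC v u).
have := ler_dot u v; rewrite -mulr_natl; lra.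
Qed.

Lemma ler_enormB u v w : enorm (u - w) <= enorm (u - v) + enorm (v - w).
Proof. by apply: le_trans (ler_enormD _ _); rewrite subrKA. Qed.

Lemma ler_enorm_dist u v : enorm u - enorm v <= enorm (u - v).
Proof. by rewrite lerBlDr -{1}(subrK v u) ler_enormD. Qed.

Lemma enorm_sqr_le v w :
  enorm w ^+ 2 <= 2 * enorm v ^+ 2 + 2 * enorm (w - v) ^+ 2.
Proof.
have := ler_enorm_dist w v; have := enorm_ge0 w; have := enorm_ge0 v.
have := enorm_ge0 (w - v).
move: (enorm v) (enorm w) (enorm (w - v)) => V W S S0 V0 W0 hw.
have sq := sqr_ge0 (V - S).
have : W ^+ 2 <= (V + S) ^+ 2 by rewrite ler_pXn2r// ?nnegrE//; lra.
lra.
Qed.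

Lemma coord_enorm v i : `|v ord0 i| <= enorm v.
Proof.
rewrite -sqrtr_sqr; apply: ler_wsqrtr; rewrite /dot (bigD1 i)//= -expr2 lerDl.
by apply: sumr_ge0 => j _; rewrite -expr2 sqr_ge0.
Qed.

Lemma coord_norm v i : `|v ord0 i| <= `|v|.
Proof.
rewrite [leRHS]/Num.Def.normr/= mx_normrE.
exact: (le_bigmax _ (fun ij : 'I_1 * 'I_n => `|v ij.1 ij.2|) (ord0, i)).
Qed.

(** The topology of row vectors is that of the maximum norm; this bound and the next translate
    between its balls and the Euclidean ones. *)
Lemma norm_le_enorm v : `|v| <= enorm v.
Proof.
rewrite [leLHS]/Num.Def.normr/= mx_normrE; apply: bigmax_le.
  exact: enorm_ge0.
by move=> [i j] _ /=; rewrite ord1 coord_enorm.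
Qed.

Lemma enorm_le_norm v : enorm v <= n%:R * `|v|.
Proof.
rewrite -(@ler_pXn2r _ 2)// ?nnegrE ?enorm_ge0 ?mulr_ge0//.
rewrite enorm_sqr; apply: (@le_trans _ _ (\sum_(i < n) `|v| ^+ 2)).
  apply: ler_sum => i _; rewrite -expr2 -real_normK ?num_real//.
  by rewrite ler_pXn2r ?nnegrE// coord_norm.
rewrite sumr_const card_ord -[leLHS]mulr_natl exprMn; apply: ler_wpM2r; first exact: sqr_ge0.
by rewrite -natrX ler_nat; case: (n) => // k; rewrite expnS expn1 leq_pmull.
Qed.

Lemma dot_ev v i : dot (ev R i) v = v ord0 i.
Proof.
rewrite /dot (bigD1 i)//= big1 => [|j ji].
  by rewrite /ev mxE !eqxx mul1r addr0.
by rewrite /ev mxE (negbTE ji) andbF mul0r.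
Qed.

End euclid.

Section curves.
Context {R : realType} {n : nat}.
Implicit Types (g : R -> 'rV[R]_n) (q : 'rV[R]_n).
Local Notation mu := (@lebesgue_measure R).

Lemma itv_chain_nth lo hi (s : seq (R * R)) x0 : itv_chain lo hi s ->
  (forall i, (i < size s)%N -> [/\ lo <= (nth x0 s i).1,
     (nth x0 s i).1 <= (nth x0 s i).2 & (nth x0 s i).2 <= hi]) /\
  (forall i, (i.+1 < size s)%N -> (nth x0 s i).2 <= (nth x0 s i.+1).1).
Proof.
elim: s lo => [|p s ih] lo /=; first by split.
move=> [lp pp c]; have [h1 h2] := ih _ c; split.
  move=> [|i] /=; first by move=> _; split => //; exact: itv_chain_le c.
  rewrite ltnS => /h1[a1 a2 a3]; split => //.
  exact: le_trans lp (le_trans pp a1).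
move=> [|i] /=; last by rewrite ltnS => /h2.
by rewrite ltnS => /h1[].
Qed.

Lemma ac_dot T g q : abs_cont_on T g -> ac_chain 0 T (fun s => dot q (g s)).
Proof.
move=> acg e e0; have q0 : 0 < enorm q + 1 by rewrite ltr_wpDl ?enorm_ge0.
have [|d d0 H] := acg (e / (enorm q + 1)); first by rewrite divr_gt0.
exists d => // s cs len; have [h1 h2] := itv_chain_nth (0, 0) cs.
have := H (size s) (fun i => (nth (0, 0) s i).1) (fun i => (nth (0, 0) s i).2).
have E (F : R * R -> R) : \sum_(p <- s) F p = \sum_(i < size s) F (nth (0, 0) s i).
  by rewrite (big_nth (0, 0)) big_mkord.
rewrite -(E (fun p => p.2 - p.1)) -(E (fun p => enorm (g p.2 - g p.1))) => {}H.
have : \sum_(p <- s) enorm (g p.2 - g p.1) < e / (enorm q + 1).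
  by apply: H => // i /h1[].
rewrite ltr_pdivlMr// mulrC mulr_sumr; apply: le_lt_trans.
apply: ler_sum => p _; rewrite -dotNr -dotDr.
apply: (le_trans (ler_abs_dot _ _)); rewrite ler_wpM2r ?enorm_ge0//.
by rewrite lerDl.
Qed.

Lemma curve_ae_derivable T g : 0 < T -> abs_cont_on T g ->
  {ae mu, forall x, 0 < x < T -> derivable g x 1}.
Proof.
move=> T0 acg.
have H i : {ae mu, forall x, 0 < x < T -> derivable (fun s => g s ord0 i) x 1}.
  have [phi [_ _]] := ac_ftc T0 (ac_dot (ev R i) acg).
  apply: filterS; first exact: (ae_filter_ringOfSetsType mu).
  move=> x h /h[d _].
  have -> : (fun s => g s ord0 i) = (fun s => dot (ev R i) (g s)); last exact: d.
  by apply/funext => s; rewrite dot_ev.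
have FF := ae_filter_ringOfSetsType mu.
have : {ae mu, forall x (i : 'I_n), 0 < x < T -> derivable (fun s => g s ord0 i) x 1}.
  exact: filter_forall H.
apply: filterS => x h xT; apply/derivable_mxP => i j; rewrite ord1; exact: h.
Qed.

Lemma is_derive_dot g q x : derivable g x 1 ->
  is_derive x 1 (fun s => dot q (g s)) (dot q (derive1 g x)).
Proof.
move=> dg.
have -> : (fun s => dot q (g s)) = \sum_(i < n) (fun s => q ord0 i * g s ord0 i).
  by apply/funext => s; rewrite fct_sumE.
rewrite derive1E derive_mx// /dot; apply: is_derive_sum => i.
rewrite mxE; have /derivable_mxP/(_ ord0 i) d := dg.
exact: (is_deriveZ (q ord0 i) (derivableP d)).
Qed.

(** The source of every lower bound on an action that involves velocities: an affine function of the
    velocity integrates exactly along the curve, and the lower integral of f dominates it. The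
    inequality is asked only where g is derivable, which is almost everywhere. *)
Lemma curve_integral_ge T g a b (f : R -> R) q (c : R) :
  0 < T -> abs_cont_on T g -> 0 <= a -> a <= b -> b <= T ->
  (forall s, a < s < b -> derivable g s 1 -> dot q (derive1 g s) + c <= f s) ->
  ((dot q (g b - g a) + c * (b - a))%:E <= \int[mu]_(s in `[a, b]) (f s)%:E)%E.
Proof.
move=> T0 acg a0 ab bT H.
have [phi [iphi phiE dphi]] := ac_ftc T0 (ac_dot q acg).
have dg := curve_ae_derivable T0 acg.
have FF := ae_filter_ringOfSetsType mu.
have [N [mN N0 NS]] : {ae mu, forall x, 0 < x < T ->
    derivable g x 1 /\ dot q (derive1 g x) = phi x}.
  apply: filterS2 dphi dg => x h1 h2 xT; split; first exact: h2.
  have [_ <-] := h1 xT; rewrite (derive1E (fun s => dot q (g s))).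
  by rewrite (@derive_val _ _ _ _ _ _ _ (is_derive_dot q (h2 xT))).
have mab : measurable (`[a, b]%classic : set (measurableTypeR R)).
  exact: measurable_itv.
have E : (\int[mu]_(s in `[a, b]) (phi s + c)%:E =
    (dot q (g b - g a) + c * (b - a))%:E)%E.
  transitivity (\int[mu]_(s in `[a, b]) ((phi s)%:E + c%:E))%E.
    by apply: eq_integral => s _; rewrite EFinD.
  rewrite integralD//; last 2 first.
  - by apply: integrableS iphi.
  - apply/integrableP; split; first exact: measurable_cst.
    rewrite integral_cst//= lebesgue_measure_itv/= lte_fin.
    by case: ifP => _; rewrite ?mule0// -EFinB -EFinM ltry.
  rewrite integral_cst//= lebesgue_measure_itv/= lte_fin.
  rewrite -integral_itv_obnd_cbnd; last first.
    by apply: (measurable_int mu); apply: integrableS iphi => //; exact: measurable_itv.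
  rewrite phiE//.
  rewrite dotDr dotNr [RHS]EFinD; congr (_ + _)%E.
  move: ab; rewrite le_eqVlt => /predU1P[->|->]; last by rewrite -EFinB -EFinM.
  by rewrite ltxx subrr mule0 mulr0.
(* The discarded null set holds the points where the derivative fails or differs from the density,
   and the two endpoints. *)
rewrite -E; apply: (@lower_integral_le _ _ _ mu _ (N `|` ([set a] `|` [set b]))) => //.
- by apply: measurableU => //; apply: measurableU; exact: measurable_set1.
- apply/eqP; rewrite measureU0//; last first.
    apply/eqP; rewrite eq_le measure_ge0 andbT.
    apply: (le_trans (measureU2 _ _ _)) => /=; try exact: measurable_set1.
    by rewrite !lebesgue_measure_set1 adde0.
    by apply: measurableU; exact: measurable_set1.
  exact/eqP.
move=> s; rewrite /= in_itv /= => /andP[as_ sb] /not_orP[nN /not_orP[na nb]].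
have sab : a < s < b.
  by rewrite !lt_neqAle as_ sb !andbT; apply/andP; split; apply/eqP; [move/esym|].
have : 0 < s < T.
  by case/andP: sab => ? ?; apply/andP; split; [exact: le_lt_trans a0 _|exact: lt_le_trans bT].
have [|] := pselect (0 < s < T -> derivable g s 1 /\ dot q (derive1 g s) = phi s).
  by move=> + sT => /(_ sT)[ds <-]; rewrite lee_fin; exact: H.
by move=> h; exfalso; apply: nN; exact: NS.
Qed.

End curves.

(** * Integrals of arbitrary functions over segments *)

Section segment_integrals.
Context {R : realType}.
Implicit Types (f g : R -> R) (a b c k : R).
Local Notation mu := (@lebesgue_measure R).
Local Notation seg a b := (`[a, b]%classic : set (measurableTypeR R)).

Let mseg a b : measurable (seg a b). Proof. exact: measurable_itv. Qed.

Let mpair a b : measurable ([set a; b] : set (measurableTypeR R)).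
Proof. by apply: measurableU; exact: measurable_set1. Qed.

Let pair0 a b : mu [set a; b] = 0%E.
Proof.
apply/eqP; rewrite eq_le measure_ge0 andbT.
apply: (le_trans (measureU2 _ _ _)) => /=; try exact: measurable_set1.
by rewrite !lebesgue_measure_set1 adde0.
Qed.

Lemma seg_integral_le a b f g : (forall s, a < s < b -> f s <= g s) ->
  (\int[mu]_(s in `[a, b]) (f s)%:E <= \int[mu]_(s in `[a, b]) (g s)%:E)%E.
Proof.
move=> fg; apply: (lower_integral_le (mseg a b) (mpair a b) (pair0 a b)) => s.
rewrite /= in_itv /= => /andP[as_ sb] /not_orP[na nb]; rewrite lee_fin fg//.
by rewrite !lt_neqAle as_ sb !andbT; apply/andP; split; apply/eqP; [move/esym|].
Qed.

Lemma seg_integral_eq a b f g : (forall s, a < s < b -> f s = g s) ->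
  (\int[mu]_(s in `[a, b]) (f s)%:E = \int[mu]_(s in `[a, b]) (g s)%:E)%E.
Proof.
by move=> fg; apply/eqP; rewrite eq_le !seg_integral_le// => s /fg ->.
Qed.

Lemma seg_integral_cst a b k : a <= b ->
  (\int[mu]_(s in `[a, b]) k%:E = (k * (b - a))%:E)%E.
Proof.
move=> ab; rewrite integral_cst//= lebesgue_measure_itv/= lte_fin.
move: ab; rewrite le_eqVlt => /predU1P[->|->]; last by rewrite -EFinB -EFinM.
by rewrite ltxx subrr mule0 mulr0.
Qed.

Lemma seg_integral_le_cst a b f k : a <= b -> (forall s, a < s < b -> f s <= k) ->
  (\int[mu]_(s in `[a, b]) (f s)%:E <= (k * (b - a))%:E)%E.
Proof. by move=> ab h; rewrite -seg_integral_cst//; exact: seg_integral_le. Qed.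

Lemma seg_integral_ge_cst a b f k : a <= b -> (forall s, a < s < b -> k <= f s) ->
  ((k * (b - a))%:E <= \int[mu]_(s in `[a, b]) (f s)%:E)%E.
Proof. by move=> ab h; rewrite -seg_integral_cst//; exact: seg_integral_le. Qed.

(** The lower bound k makes the negative part integrable, which is what additivity asks for; the
    common endpoint b is removed as a null set. *)
Lemma seg_integral_split a b c f k : a <= b -> b <= c ->
  (forall s, a <= s <= c -> k <= f s) ->
  (\int[mu]_(s in `[a, c]) (f s)%:E =
   \int[mu]_(s in `[a, b]) (f s)%:E + \int[mu]_(s in `[b, c]) (f s)%:E)%E.
Proof.
move=> ab bc fk.
have E : (\int[mu]_(s in `[b, c]) (f s)%:E = \int[mu]_(s in `]b, c]) (f s)%:E)%E.
  rewrite (@lower_integral_setD _ _ _ mu _ [set b])//.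
  - congr (integral mu _ _); apply/seteqP; split => s /=.
      rewrite !in_itv /= => -[/andP[bs ->] /eqP nb]; rewrite andbT.
      by rewrite lt_neqAle bs eq_sym nb.
    rewrite !in_itv /= => /andP[bs ->]; rewrite (ltW bs); split => // sb.
    by move: bs; rewrite sb ltxx.
  - exact: lebesgue_measure_set1.
have neg l r (D : set (measurableTypeR R)) : measurable D -> a <= l -> l <= r -> r <= c ->
   D `<=` seg l r -> (\int[mu]_(s in D) (EFin \o f)^\- s < +oo)%E.
  move=> mD al lr rc Ds.
  apply: (@le_lt_trans _ _ (\int[mu]_(s in D) (`|k|)%:E)%E).
    apply: ge0_lower_integral_le => // s /Ds /=; rewrite in_itv /= => /andP[ls sr].
    rewrite funenegE ge_max /= !lee_fin normr_ge0 andbT.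
    rewrite lerNl (le_trans _ (fk s _))//; first by rewrite lerNl -normrN ler_norm.
    by rewrite (le_trans al ls) (le_trans sr rc).
  rewrite integral_cst//=.
  apply: (@le_lt_trans _ _ (`|k|%:E * mu (seg l r))%E).
    apply: lee_wpmul2l; first by rewrite lee_fin.
    by apply: le_measure; rewrite ?inE.
  rewrite lebesgue_measure_itv/= lte_fin; case: ifP => _.
    by rewrite -EFinB -EFinM ltry.
  by rewrite mule0.
have -> : seg a c = seg a b `|` (`]b, c]%classic : set (measurableTypeR R)).
  apply/seteqP; split => s /=; rewrite !in_itv /=.
    by move=> /andP[h1 h2]; case: (leP s b) => h; [left; rewrite h1|right].
  move=> [/andP[h1 h2]|/andP[h1 h2]]; first by rewrite h1 (le_trans h2).
  by rewrite h2 andbT (le_trans ab (ltW h1)).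
rewrite E lower_integral_setU//.
- apply/disj_setPS => s /= [/=]; rewrite !in_itv /= => /andP[_ h1] /andP[h2 _].
  by move: (lt_le_trans h2 h1); rewrite ltxx.
- exact: (@neg a b).
- apply: (@neg b c) => //.
  by move=> s /=; rewrite !in_itv /= => /andP[/ltW -> ->].
Qed.

End segment_integrals.

(** * Concatenation of curves *)

Section glueing.
Context {R : realType} {n : nat}.
Implicit Types (g : R -> 'rV[R]_n).

Lemma derive1_eq_itv g g' a b s : (forall r, a <= r <= b -> g r = g' r) ->
  a < s < b -> derive1 g s = derive1 g' s.
Proof.
move=> gg' /andP[as_ sb]; rewrite !derive1E; apply: near_eq_derive.
near=> r; apply: gg'; apply/andP; split; apply/ltW; near: r.
  exact: lt_nbhsr.
exact: lt_nbhsl.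
Unshelve. all: by end_near. Qed.

Definition glue (c : R) g1 g2 (s : R) := if s <= c then g1 s else g2 s.

Lemma glue_le c g1 g2 s : s <= c -> glue c g1 g2 s = g1 s.
Proof. by rewrite /glue => ->. Qed.

Lemma glue_ge c g1 g2 s : g1 c = g2 c -> c <= s -> glue c g1 g2 s = g2 s.
Proof.
by move=> gE; rewrite le_eqVlt => /predU1P[<-|]; rewrite /glue ?lexx// leNgt => ->.
Qed.

(** With min and max the glued curve becomes a sum of two stopped curves, so absolute continuity
    follows without singling out the intervals that straddle c. *)
Lemma glueE c g1 g2 s : g1 c = g2 c ->
  glue c g1 g2 s = g1 (Num.min s c) + g2 (Num.max s c) - g1 c.
Proof.
move=> gE; rewrite /glue; case: leP => h; first by rewrite gE addrK.
by rewrite addrC addKr.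
Qed.

Lemma abs_cont_glue T c g1 g2 : 0 <= c <= T -> g1 c = g2 c ->
  abs_cont_on T g1 -> abs_cont_on T g2 -> abs_cont_on T (glue c g1 g2).
Proof.
move=> /andP[c0 cT] gE ac1 ac2 e e0.
have [|d1 d10 H1] := ac1 (e / 2); first by rewrite divr_gt0.
have [|d2 d20 H2] := ac2 (e / 2); first by rewrite divr_gt0.
exists (Num.min d1 d2); first by rewrite lt_min d10.
move=> k a b ab bsa; rewrite lt_min => /andP[l1 l2].
have h1 : \sum_(i < k) enorm (g1 (Num.min (b i) c) - g1 (Num.min (a i) c)) < e / 2.
  apply: (H1 k (fun i => Num.min (a i) c) (fun i => Num.min (b i) c)).
  - move=> i /ab[a0 [abi bT]]; split; first by rewrite le_min a0.
    by split; [exact: le_min2|rewrite ge_min bT].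
  - by move=> i /bsa h; exact: le_min2.
  - apply: le_lt_trans l1; apply: ler_sum => i _.
    have [_ [abi _]] := ab i (ltn_ord i).
    case: (leP (b i) c) => ?; case: (leP (a i) c) => ?; lra.
have h2 : \sum_(i < k) enorm (g2 (Num.max (b i) c) - g2 (Num.max (a i) c)) < e / 2.
  apply: (H2 k (fun i => Num.max (a i) c) (fun i => Num.max (b i) c)).
  - move=> i /ab[a0 [abi bT]]; split; first by rewrite le_max a0.
    by split; [exact: le_max2|rewrite ge_max bT].
  - by move=> i /bsa h; exact: le_max2.
  - apply: le_lt_trans l2; apply: ler_sum => i _.
    have [_ [abi _]] := ab i (ltn_ord i).
    case: (leP (b i) c) => ?; case: (leP (a i) c) => ?; lra.
rewrite (splitr e); apply: le_lt_trans (ltrD h1 h2).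
rewrite -big_split /=; apply: ler_sum => i _; rewrite !glueE//.
apply: le_trans (ler_enormD _ _); rewrite le_eqVlt; apply/orP; left; apply/eqP.
congr enorm; apply/rowP => j; rewrite !mxE; ring.
Qed.

Lemma lipschitz_abs_cont T g (K : R) :
  (forall s r, s <= r -> enorm (g r - g s) <= K * (r - s)) -> abs_cont_on T g.
Proof.
move=> lip e e0.
have K0 : 0 < `|K| + 1 by rewrite ltr_wpDl.
exists (e / (`|K| + 1)); first by rewrite divr_gt0.
move=> k a b ab _; rewrite ltr_pdivlMr// mulrC mulr_sumr; apply: le_lt_trans.
apply: ler_sum => i _; have [_ [abi _]] := ab i (ltn_ord i).
apply: (le_trans (lip _ _ abi)); rewrite ler_wpM2r ?subr_ge0//.
by rewrite (le_trans (ler_norm K))// lerDl.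
Qed.

Lemma Gam_glue (Omega : set 'rV[R]_n) T c g1 g2 : 0 <= c <= T -> g1 c = g2 c ->
  Gam Omega T g1 -> Gam Omega T g2 -> Gam Omega T (glue c g1 g2).
Proof.
move=> c0 gE [ac1 cl1] [ac2 cl2]; split; first exact: abs_cont_glue.
by move=> s sT; rewrite /glue; case: ifP => _; [exact: cl1|exact: cl2].
Qed.

Lemma abs_cont_uniform T g (e : R) : abs_cont_on T g -> 0 < e ->
  exists2 d, 0 < d & forall s r, 0 <= s -> s <= r -> r <= T -> r - s < d ->
    enorm (g r - g s) < e.
Proof.
move=> acg e0; have [d d0 H] := acg _ e0; exists d => // s r s0 sr rT srd.
have := H 1%N (fun=> s) (fun=> r); rewrite !big_ord1; apply => //.
Qed.

End glueing.

(** * Derivatives along lines and Taylor bounds *)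

Section lines.
Context {R : realType}.

Lemma is_derive_line (V : normedModType R) (f : V -> R) (z h : V) (s : R) :
  differentiable f (z + s *: h) ->
  is_derive s 1 (fun r => f (z + r *: h)) ('D_h f (z + s *: h)).
Proof.
move=> df.
have E : (fun r : R => r^-1 *: (f (z + (r *: 1 + s) *: h) - f (z + s *: h))) =
         (fun r : R => r^-1 *: (f (r *: h + (z + s *: h)) - f (z + s *: h))).
  apply/funext => r; congr (_ *: (f _ - _)).
  by rewrite scalerDl -scalerA scale1r addrCA.
split; rewrite /derivable /derive /= E //.
exact: diff_derivable.
Qed.

Lemma derive_MVT01 (f df : R -> R) :
  (forall s : R, 0 <= s <= 1 -> is_derive s 1 f (df s)) ->
  exists2 c, 0 < c < 1 & f 1 - f 0 = df c.
Proof.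
move=> H; have [| |c cI] := @MVT R f df 0 1 ltr01.
- by move=> s; rewrite in_itv /= => /andP[/ltW ? /ltW ?]; apply: H; apply/andP.
- apply: derivable_within_continuous => s; rewrite in_itv /= => sI.
  exact: (@ex_derive _ _ _ _ _ _ _ (H _ sI)).
by rewrite subr0 mulr1 => ->; exists c; move: cI; rewrite in_itv.
Qed.

(** After subtraction of the quadratic polynomial with second derivative k, the mean value theorem
    is applied twice, to [h] and then to [f1]. Pointwise existence of the second derivative is
    enough. *)
Lemma taylor2_ge (f f1 f2 : R -> R) (k : R) :
  (forall s : R, is_derive s 1 f (f1 s)) -> (forall s : R, is_derive s 1 f1 (f2 s)) ->
  (forall s, k <= f2 s) -> f 0 + f1 0 + k / 2 <= f 1.
Proof.
move=> d1 d2 kf.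
pose h (s : R) := f s - (f1 0 *: s + (k / 2) *: (s * s)).
pose h1 (s : R) := f1 s - (f1 0 *: (1 : R) + (k / 2) *: (s *: (1 : R) + s *: (1 : R))).
have dh (s : R) : is_derive s 1 h (h1 s).
  rewrite /h1; apply: is_deriveB; apply: is_deriveD; apply: is_deriveZ.
have [c /andP[c0 c1] E] := @derive_MVT01 h h1 (fun s _ => dh s).
have : 0 <= h1 c.
  have [d _ Ed] : exists2 d, 0 < d < 1 & f1 (0 + 1 * c) - f1 (0 + 0 * c) = c * f2 (d * c).
    apply: (@derive_MVT01 (fun s => f1 (0 + s * c)) (fun s => c * f2 (s * c))) => s _.
    have df : differentiable f1 (0 + s *: c).
      by apply/derivable1_diffP; exact: ex_derive.
    have [d3 d4] := is_derive_line df; split; first exact: d3.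
    rewrite d4 -[s * c]/(s *: c) -[s *: c in RHS]add0r.
    set p := 0 + s *: c in df *.
    rewrite deriveE// -[c in LHS]mulr1 [LHS]linearZ /= -deriveE//.
    by rewrite (@derive_val _ _ _ _ _ _ _ (d2 _)).
  move: Ed; rewrite mul1r mul0r !add0r => Ed.
  have := kf (d * c) => kd; have kc := ler_wpM2l (ltW c0) kd.
  rewrite /h1 !scaler1 /GRing.scale /=; rewrite -Ed in kc; lra.
rewrite -E /h /GRing.scale /=; lra.
Qed.

End lines.

Section gradients.
Context {R : realType} {n : nat}.
Implicit Types (x y v w a b : 'rV[R]_n).

Lemma row_ev a : a = \sum_(i < n) a ord0 i *: ev R i.
Proof. by rewrite {1}(row_sum_delta a). Qed.

Lemma derive_dot_grad (f : 'rV[R]_n -> R) x a : differentiable f x ->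
  'D_a f x = dot (grad f x) a.
Proof.
move=> df; rewrite deriveE// {1}(row_ev a) linear_sum; apply: eq_bigr => i _.
by rewrite linearZ /= -deriveE// mxE mulrC.
Qed.

Lemma derive_pair_l (f : 'rV[R]_n * 'rV[R]_n -> R) z a : differentiable f z ->
  'D_(a, 0) f z = \sum_(i < n) 'D_(ev R i, 0) f z * a ord0 i.
Proof.
move=> df; rewrite deriveE//.
have -> : (a, 0 : 'rV[R]_n) = \sum_(i < n) a ord0 i *: (ev R i, 0).
  rewrite [X in (X, _)]row_ev; elim/big_rec2 : _ => // i u u' _ <-.
  by congr pair; rewrite /= ?scaler0 ?addr0.
rewrite linear_sum; apply: eq_bigr => i _.
by rewrite linearZ /= -deriveE// mulrC.
Qed.

Lemma derive_pair_r (f : 'rV[R]_n * 'rV[R]_n -> R) z a : differentiable f z ->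
  'D_(0, a) f z = \sum_(i < n) 'D_(0, ev R i) f z * a ord0 i.
Proof.
move=> df; rewrite deriveE//.
have -> : (0 : 'rV[R]_n, a) = \sum_(i < n) a ord0 i *: (0, ev R i).
  rewrite [X in (_, X)]row_ev; elim/big_rec2 : _ => // i u u' _ <-.
  by congr pair; rewrite /= ?scaler0 ?addr0.
rewrite linear_sum; apply: eq_bigr => i _.
by rewrite linearZ /= -deriveE// mulrC.
Qed.

Lemma open_enorm (U : set 'rV[R]_n) x : open U -> U x ->
  exists2 r, 0 < r & forall y, enorm (y - x) < r -> U y.
Proof.
move=> oU Ux; have /nbhs_ballP[r /= r0 rU] := open_nbhs_nbhs (conj oU Ux).
exists r => // y yx; apply: rU; rewrite mx_norm_ball /ball_ /=.
by apply: le_lt_trans yx; rewrite enormB; exact: norm_le_enorm.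
Qed.

Lemma continuous_enorm (f : 'rV[R]_n -> R) x : {for x, continuous f} ->
  forall e, 0 < e -> exists2 r, 0 < r & forall y, enorm (y - x) < r -> `|f y - f x| < e.
Proof.
move=> /cvgrPdist_lt cf e e0; have /nbhs_ballP[r /= r0 rU] := cf _ e0.
exists r => // y yx; rewrite distrC; apply: rU; rewrite mx_norm_ball /ball_ /=.
by apply: le_lt_trans yx; rewrite enormB; exact: norm_le_enorm.
Qed.

End gradients.

(** * Estimates on the Lagrangian *)

Section lagrangian.
Context {R : realType} {n : nat}.
Variables (U : set 'rV[R]_n) (L : 'rV[R]_n -> 'rV[R]_n -> R) (M mu : R).
Hypotheses (oU : open U) (hL0 : hyp_L0 U L M) (hL1 : hyp_L1 U L mu).
Implicit Types (x y v w d e : 'rV[R]_n).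

Let mu0 : 0 < mu. Proof. by case: hL1. Qed.

Let dL x v : U x -> differentiable (Lz L) (x, v).
Proof. by move=> Ux; case: hL0 => /(_ x v Ux)[]. Qed.

Let pairE x v (s : R) d : (x, v) + s *: (0, d) = (x, v + s *: d) :> 'rV[R]_n * 'rV[R]_n.
Proof. by congr pair; rewrite /= scaler0 addr0. Qed.

Let pairEl x v (s : R) d : (x, v) + s *: (d, 0) = (x + s *: d, v) :> 'rV[R]_n * 'rV[R]_n.
Proof. by congr pair; rewrite /= scaler0 addr0. Qed.

Lemma is_derive_Lv x v d (s : R) : U x ->
  is_derive s 1 (fun r => L x (v + r *: d)) (dot (DvL L x (v + s *: d)) d).
Proof.
move=> Ux; have := @is_derive_line R _ (Lz L) (x, v) (0, d) s.
rewrite pairE => /(_ (dL _ Ux)); rewrite derive_pair_r; last exact: dL.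
have -> : (fun r : R => Lz L ((x, v) + r *: (0, d))) = fun r => L x (v + r *: d).
  by apply/funext => r; rewrite pairE.
by congr is_derive; apply: eq_bigr => i _; rewrite mxE.
Qed.

Lemma is_derive_DvL x v d (s : R) : U x ->
  is_derive s 1 (fun r => dot (DvL L x (v + r *: d)) d)
    (dot (d *m DvvL L x (v + s *: d)) d).
Proof.
move=> Ux; have [_ [dD _]] := hL1.
have H i : is_derive s 1 (fun r => DvL L x (v + r *: d) ord0 i)
    (\sum_(j < n) DvvL L x (v + s *: d) i j * d ord0 j).
  have := @is_derive_line R _ (fun z => DvL L z.1 z.2 ord0 i) (x, v) (0, d) s.
  rewrite pairE => /(_ (dD _ _ _ Ux)); rewrite derive_pair_r; last exact: dD.
  have -> : (fun r : R => DvL L ((x, v) + r *: (0, d)).1 ((x, v) + r *: (0, d)).2 ord0 i)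
      = fun r => DvL L x (v + r *: d) ord0 i.
    by apply/funext => r; rewrite pairE.
  by congr is_derive; apply: eq_bigr => j _; rewrite mxE.
have -> : (fun r : R => dot (DvL L x (v + r *: d)) d) =
    \sum_(i < n) (fun r => d ord0 i *: DvL L x (v + r *: d) ord0 i).
  by apply/funext => r; rewrite fct_sumE; apply: eq_bigr => i _; rewrite /GRing.scale /= mulrC.
have -> : dot (d *m DvvL L x (v + s *: d)) d = \sum_(i < n)
    (d ord0 i *: \sum_(j < n) DvvL L x (v + s *: d) i j * d ord0 j).
  rewrite /dot; under eq_bigr => j _ do rewrite mxE mulr_suml.
  rewrite exchange_big /=; apply: eq_bigr => i _.
  by rewrite scaler_sumr; apply: eq_bigr => j _; rewrite /GRing.scale /= mulrA.
by apply: is_derive_sum => i; exact: is_deriveZ.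
Qed.

Lemma is_derive_DvL_space x d w v (s : R) : U (x + s *: d) ->
  is_derive s 1 (fun r => dot (DvL L (x + r *: d) w) v)
    (dot (d *m (DvxL L (x + s *: d) w)^T) v).
Proof.
move=> Us; have [_ [dD _]] := hL1.
have Hi i : is_derive s 1 (fun r => DvL L (x + r *: d) w ord0 i)
    (\sum_(j < n) DvxL L (x + s *: d) w i j * d ord0 j).
  have := @is_derive_line R _ (fun z => DvL L z.1 z.2 ord0 i) (x, w) (d, 0) s.
  rewrite pairEl => /(_ (dD _ _ _ Us)).
  rewrite derive_pair_l; last exact: dD Us.
  have -> : (fun r : R => DvL L ((x, w) + r *: (d, 0)).1 ((x, w) + r *: (d, 0)).2 ord0 i)
      = fun r => DvL L (x + r *: d) w ord0 i.
    by apply/funext => r; rewrite pairEl.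
  by congr is_derive; apply: eq_bigr => j _; rewrite mxE.
have -> : (fun r : R => dot (DvL L (x + r *: d) w) v) =
    \sum_(i < n) (fun r => v ord0 i *: DvL L (x + r *: d) w ord0 i).
  by apply/funext => r; rewrite fct_sumE; apply: eq_bigr => i _; rewrite /GRing.scale /= mulrC.
have -> : dot (d *m (DvxL L (x + s *: d) w)^T) v = \sum_(i < n)
    (v ord0 i *: \sum_(j < n) DvxL L (x + s *: d) w i j * d ord0 j).
  rewrite /dot; apply: eq_bigr => i _; rewrite mxE /GRing.scale /= mulrC.
  by congr (_ * _); apply: eq_bigr => j _; rewrite !mxE mulrC.
by apply: is_derive_sum => i; exact: is_deriveZ.
Qed.

Local Opaque DxL DvL DvvL DvxL.

Lemma L_tangent_ge x v w : U x ->
  L x v + dot (DvL L x v) (w - v) + enorm (w - v) ^+ 2 / (2 * mu) <= L x w.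
Proof.
move=> Ux; have [_ [_ [hvv _]]] := hL1.
have := @taylor2_ge R _ _ _ (enorm (w - v) ^+ 2 / mu)
  (fun s => is_derive_Lv v (w - v) s Ux) (fun s => is_derive_DvL v (w - v) s Ux).
rewrite !scale0r scale1r addr0 addrCA subrr addr0 => H.
have -> : enorm (w - v) ^+ 2 / (2 * mu) = enorm (w - v) ^+ 2 / mu / 2.
  by rewrite invfM mulrA mulrAC.
by apply: H => s; have /andP[] := hvv x (v + s *: (w - v)) (w - v) Ux.
Qed.

Lemma L_tangent_le x v w : U x ->
  L x w <= L x v + dot (DvL L x v) (w - v) + mu * enorm (w - v) ^+ 2 / 2.
Proof.
move=> Ux; have [_ [_ [hvv _]]] := hL1.
have := @taylor2_ge R (fun r => - L x (v + r *: (w - v)))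
  (fun r => - dot (DvL L x (v + r *: (w - v))) (w - v))
  (fun s => - dot ((w - v) *m DvvL L x (v + s *: (w - v))) (w - v))
  (- (mu * enorm (w - v) ^+ 2)).
rewrite !scale0r scale1r addr0 addrCA subrr addr0 => H.
have {H} : - L x v - dot (DvL L x v) (w - v) + - (mu * enorm (w - v) ^+ 2) / 2
    <= - L x w.
  apply: H => s.
  - exact: (@is_deriveN _ _ _ _ _ _ _ (is_derive_Lv v (w - v) s Ux)).
  - exact: (@is_deriveN _ _ _ _ _ _ _ (is_derive_DvL v (w - v) s Ux)).
  - by rewrite lerN2; have /andP[] := hvv x (v + s *: (w - v)) (w - v) Ux.
lra.
Qed.

Let hM x : U x -> `|L x 0| <= M /\ enorm (DvL L x 0) <= M.
Proof.
move=> Ux; have [_ /(_ x Ux)] := hL0.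
move: (enorm_ge0 (DxL L x 0)) (enorm_ge0 (DvL L x 0)) (normr_ge0 (L x 0)).
by move: (enorm _) (enorm _) `|_| => a b c *; split; lra.
Qed.

Lemma L_coercive x v : U x ->
  enorm v ^+ 2 / (4 * mu) - (M + mu * M ^+ 2) <= L x v.
Proof.
move=> Ux; have [h1 h2] := hM Ux; have := L_tangent_ge 0 v Ux; rewrite subr0.
move: h1; rewrite ler_norml => /andP[h1 _].
have := ler_abs_dot (DvL L x 0) v; rewrite ler_norml => /andP[h3 _].
have h4 := ler_wpM2r (enorm_ge0 v) h2.
(* Half of the quadratic term pays for the linear term - M |v|, by completing the square. *)
have h5 : 0 <= (enorm v / 2 - mu * M) ^+ 2 / mu by rewrite divr_ge0 ?sqr_ge0// ltW.
have E5 : (enorm v / 2 - mu * M) ^+ 2 / mu =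
    enorm v ^+ 2 / (4 * mu) - M * enorm v + mu * M ^+ 2.
  by field; rewrite gt_eqF.
rewrite E5 in h5.
have -> : enorm v ^+ 2 / (2 * mu) = 2 * (enorm v ^+ 2 / (4 * mu)).
  by field; rewrite gt_eqF.
lra.
Qed.

Lemma L_upper x v : U x -> L x v <= M + M * enorm v + mu / 2 * enorm v ^+ 2.
Proof.
move=> Ux; have [h1 h2] := hM Ux; have := L_tangent_le 0 v Ux; rewrite subr0.
move: h1; rewrite ler_norml => /andP[_ h1].
have h3 := ler_dot (DvL L x 0) v.
have h4 := ler_wpM2r (enorm_ge0 v) h2; lra.
Qed.

Lemma L_convex x v e (th : R) : U x -> 0 <= th <= 1 ->
  L x (v + th *: e) <= (1 - th) * L x v + th * L x (v + e).
Proof.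
move=> Ux /andP[t0 t1]; set p := v + th *: e.
have h1 := L_tangent_ge p v Ux; have h2 := L_tangent_ge p (v + e) Ux.
have E1 : v - p = - th *: e by rewrite /p opprD addNKr scaleNr.
have E2 : v + e - p = (1 - th) *: e.
  by rewrite /p opprD addrACA subrr add0r scalerBl scale1r.
have q1 : 0 <= enorm (v - p) ^+ 2 / (2 * mu) by rewrite divr_ge0 ?sqr_ge0// mulr_ge0// ltW.
have q2 : 0 <= enorm (v + e - p) ^+ 2 / (2 * mu) by rewrite divr_ge0 ?sqr_ge0// mulr_ge0// ltW.
move: h1 h2; rewrite E1 E2 !dotZr; rewrite E1 in q1; rewrite E2 in q2 => h1 h2.
have {}h1 : L x p + - th * dot (DvL L x p) e <= L x v by lra.
have {}h2 : L x p + (1 - th) * dot (DvL L x p) e <= L x (v + e) by lra.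
have t1' : 0 <= 1 - th by lra.
have := lerD (ler_wpM2l t1' h1) (ler_wpM2l t0 h2); lra.
Qed.

(** The tangent bounds at the midpoint, towards v and towards w, are added; their linear terms
    cancel. *)
Lemma L_midpoint x v w : U x ->
  enorm (v - w) ^+ 2 / (4 * mu) <= L x v + L x w - 2 * L x (2^-1 *: (v + w)).
Proof.
move=> Ux; set c := 2^-1 *: (v + w).
have h1 := L_tangent_ge c v Ux; have h2 := L_tangent_ge c w Ux.
have E1 : v - c = 2^-1 *: (v - w) by apply/rowP => i; rewrite !mxE; lra.
have E2 : w - c = - 2^-1 *: (v - w) by apply/rowP => i; rewrite !mxE; lra.
move: h1 h2; rewrite E1 E2 !dotZr !enormZ normrN !exprMn.
rewrite real_normK ?num_real// => h1 h2.
have := lerD h1 h2; set D := dot _ _; set E := enorm _ ^+ 2.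
have -> : 2^-1 ^+ 2 * E / (2 * mu) = E / (4 * mu) / 2 by field; rewrite gt_eqF.
lra.
Qed.

(** Taken so large that 4 [Lcst] (1 + |v|^2) dominates L(x, v + e) - L(x, v) for |e| <= 1 + |v|, by
    the quadratic bounds on L from both sides. *)
Definition Lcst : R := 5 * `|M| + 4 * mu + mu * M ^+ 2 + 1.

Lemma Lcst_gt0 : 0 < Lcst.
Proof.
have := normr_ge0 M; have := mulr_ge0 (ltW mu0) (sqr_ge0 M).
rewrite /Lcst; have := mu0; lra.
Qed.

(** By convexity a fraction th of the displacement e costs at most th times the full displacement.
    This prices every change of velocity below: the inward push, the inward tilt of a tangential
    velocity, and the tangential projection. *)
Lemma L_perturb x v e (th : R) : U x -> 0 <= th <= 1 -> enorm e <= 1 + enorm v ->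
  L x (v + th *: e) <= L x v + th * (4 * Lcst * (1 + enorm v ^+ 2)).
Proof.
move=> Ux th01 ev; apply: (le_trans (L_convex v e Ux th01)).
have /andP[t0 t1] := th01.
suff : L x (v + e) - L x v <= 4 * Lcst * (1 + enorm v ^+ 2).
  by move=> /(ler_wpM2l t0); lra.
have h1 := L_upper (v + e) Ux; have h2 := L_coercive v Ux.
have h3 : enorm (v + e) <= 1 + 2 * enorm v by have := ler_enormD v e; lra.
have v0 := enorm_ge0 v; have ve0 := enorm_ge0 (v + e).
have sq := sqr_ge0 (2 * enorm v - 1).
have h4 : enorm (v + e) ^+ 2 <= 2 + 8 * enorm v ^+ 2.
  apply: (@le_trans _ _ ((1 + 2 * enorm v) ^+ 2)); last by lra.
  by rewrite ler_pXn2r// nnegrE addr_ge0// mulr_ge0.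
have h5 : enorm (v + e) <= 2 + 2 * enorm v ^+ 2 by lra.
have h6 : 0 <= enorm v ^+ 2 / (4 * mu) by rewrite divr_ge0 ?sqr_ge0// mulr_ge0// ltW.
have h7 : M * enorm (v + e) <= `|M| * (2 + 2 * enorm v ^+ 2).
  apply: le_trans (ler_wpM2l (normr_ge0 M) h5); rewrite ler_wpM2r//; exact: ler_norm.
have h8 : mu / 2 * enorm (v + e) ^+ 2 <= mu / 2 * (2 + 8 * enorm v ^+ 2).
  by rewrite ler_wpM2l// divr_ge0// ltW.
have h9 := ler_norm M; have h10 := mulr_ge0 (ltW mu0) (sqr_ge0 M).
have h11 := sqr_ge0 (enorm v); have m0 := mu0; have M0 := normr_ge0 M.
have h12 := mulr_ge0 M0 h11; have h13 := mulr_ge0 (ltW m0) h11.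
have h14 := mulr_ge0 h10 h11.
rewrite /Lcst; lra.
Qed.

(** Two mean values: in r for L(y, r v) - L(x, r v), then in space for the resulting difference of
    [DvL]. The bound on [DvxL] is linear in the velocity, and pairing with v makes the growth
    quadratic. *)
Lemma L_space_diff x y v : (forall s, 0 <= s <= 1 -> U (x + s *: (y - x))) ->
  `|L y v - L x v| <= `|L y 0 - L x 0| + 2 * mu * enorm (y - x) * (1 + enorm v ^+ 2).
Proof.
move=> seg; have [_ [_ [_ hvx]]] := hL1.
have Ux : U x by have := seg 0; rewrite scale0r addr0 lexx ler01; exact.
have Uy : U y by have := seg 1; rewrite scale1r addrCA subrr addr0 lexx ler01; exact.
have [c /andP[c0 c1]] := @derive_MVT01 R (fun r => L y (0 + r *: v) - L x (0 + r *: v))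
  (fun s => dot (DvL L y (0 + s *: v)) v - dot (DvL L x (0 + s *: v)) v)
  (fun s _ => @is_deriveB _ _ _ _ _ _ _ _ _ (is_derive_Lv 0 v s Uy) (is_derive_Lv 0 v s Ux)).
rewrite !add0r !scale1r scale0r; set w := c *: v => E.
have H (s : R) (s01 : 0 <= s <= 1) := is_derive_DvL_space w v (seg s s01).
have [r /andP[r0 r1]] := derive_MVT01 H.
rewrite scale1r scale0r addr0 addrCA subrr addr0 => E2.
have r01 : 0 <= r <= 1 by rewrite !ltW.
have b1 := ler_abs_dot ((y - x) *m (DvxL L (x + r *: (y - x)) w)^T) v.
have b2 := hvx _ w (y - x) (seg _ r01).
have wv : enorm w <= enorm v.
  by rewrite /w enormZ gtr0_norm// ler_piMl ?enorm_ge0// ltW.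
have E3 : L y v - L x v = (L y 0 - L x 0) +
    dot ((y - x) *m (DvxL L (x + r *: (y - x)) w)^T) v by rewrite -E2; lra.
rewrite E3; apply: (le_trans (ler_normD _ _)); rewrite lerD2l.
apply: (le_trans b1); apply: (le_trans (ler_wpM2r (enorm_ge0 v) b2)).
have e0 := enorm_ge0 (y - x); have v0 := enorm_ge0 v; have w0 := enorm_ge0 w.
have -> : mu * (1 + enorm w) * enorm (y - x) * enorm v =
   (mu * enorm (y - x)) * ((1 + enorm w) * enorm v) by ring.
have -> : 2 * mu * enorm (y - x) * (1 + enorm v ^+ 2) =
   (mu * enorm (y - x)) * (2 * (1 + enorm v ^+ 2)) by ring.
rewrite ler_wpM2l ?mulr_ge0 ?(ltW mu0)//; nra.
Qed.

Lemma L_continuous x v : U x -> {for (x, v), continuous (Lz L)}.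
Proof. by move=> Ux; exact: differentiable_continuous (dL v Ux). Qed.

Lemma L_space_close x (om : R) : U x -> 0 < om -> exists2 r, 0 < r &
  forall y, enorm (y - x) < r -> U y /\
    forall v, `|L y v - L x v| <= om * (1 + enorm v ^+ 2).
Proof.
move=> Ux om0; have [r1 r10 HU] := open_enorm oU Ux.
have om20 : 0 < om / 2 by rewrite divr_gt0.
have /cvgrPdist_lt/(_ _ om20)[[A B] /= [nA nB] AB] := @L_continuous x 0 Ux.
have /nbhs_ballP[r2 /= r20 HA] := nA.
have Hc y : enorm (y - x) < r2 -> `|L y 0 - L x 0| < om / 2.
  move=> yx; rewrite distrC; apply: (AB (y, 0)); split => /=; last exact: nbhs_singleton nB.
  apply: HA; rewrite mx_norm_ball /ball_ /=.
  by apply: le_lt_trans yx; rewrite enormB; exact: norm_le_enorm.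
(* This radius gives half of om to the quadratic term; the other half goes to the continuity of L(.,
   0). *)
pose r3 := om / (4 * mu); have r30 : 0 < r3 by rewrite divr_gt0// mulr_gt0.
exists (Num.min r1 (Num.min r2 r3)); first by rewrite !lt_min r10 r20.
move=> y; rewrite !lt_min => /and3P[y1 y2 y3]; split; first exact: HU.
move=> v; apply: (le_trans (L_space_diff v _)).
  move=> s /andP[s0 s1]; apply: HU; rewrite addrAC subrr add0r enormZ ger0_norm//.
  by apply: le_lt_trans y1; rewrite ler_piMl ?enorm_ge0.
have h := Hc _ y2.
have h3 : 2 * mu * enorm (y - x) <= om / 2.
  move: y3; rewrite /r3 ltr_pdivlMr ?mulr_gt0//; lra.
have v2 := sqr_ge0 (enorm v).
have v3 : 0 <= 1 + enorm v ^+ 2 by lra.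
have := ler_wpM2r v3 h3; nra.
Qed.

(** Moving the base point from x to y costs om (1 + |w|^2), where w will be an uncontrolled
    velocity. Since |w|^2 <= 2 |v|^2 + 2 |w - v|^2, the quadratic gain of the tangent bound absorbs
    the part in w - v when 4 om mu <= 1, and the error left depends on v alone. *)
Lemma L_tangent_close x y v w (om : R) : U x -> 0 <= om -> 4 * om * mu <= 1 ->
  `|L y w - L x w| <= om * (1 + enorm w ^+ 2) ->
  L x v + dot (DvL L x v) (w - v) - 2 * om * (1 + enorm v ^+ 2) <= L y w.
Proof.
move=> Ux om0 om1; rewrite ler_norml => /andP[h1 _].
have h2 := L_tangent_ge v w Ux.
have h4 := enorm_sqr_le v w.
have h5 : 2 * om * enorm (w - v) ^+ 2 <= enorm (w - v) ^+ 2 / (2 * mu).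
  rewrite ler_pdivlMr ?mulr_gt0//.
  by rewrite mulrAC -mulrA; have := ler_wpM2r (sqr_ge0 (enorm (w - v))) om1; lra.
have h6 := ler_wpM2l om0 h4; lra.
Qed.

End lagrangian.

(** * The support of the equilibrium *)

Section support.
Context {R : realType} {n : nat}.
Implicit Types (g : R -> 'rV[R]_n).

Lemma measurable_enorm d (X : measurableType d) (f : X -> 'rV[R]_n) a :
  (forall i, measurable_fun setT (fun z => f z ord0 i)) ->
  measurable_fun setT (fun z => enorm (f z - a)).
Proof.
move=> mf; rewrite /enorm.
apply: (measurableT_comp (f := @Num.sqrt R)).
  by apply: continuous_measurable_fun => z; exact: sqrt_continuous.
rewrite /dot; apply: measurable_sum => i.
under eq_fun do rewrite !mxE.
by apply: measurable_funM; apply: measurable_funD.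
Qed.

Lemma eq_measurable d (X : measurableType d) (A B : set X) :
  A = B -> measurable A -> measurable B.
Proof. by move=> ->. Qed.

Variables (Omega : set 'rV[R]_n) (T : R).
Hypothesis T0 : 0 < T.

Lemma measurable_eval r i : 0 <= r <= T ->
  measurable_fun setT (fun g : CurveM Omega T => g r ord0 i).
Proof.
move=> rT _ B mB; rewrite setTI; apply: sub_sigma_algebra; right.
by exists r, i, B.
Qed.

Lemma measurable_Gam : measurable (Gam Omega T : set (CurveM Omega T)).
Proof. by apply: sub_sigma_algebra; left. Qed.

Definition grid (N i : nat) : R := T * i%:R / N.+1%:R.

Lemma grid_itv N i : (i <= N.+1)%N -> 0 <= grid N i <= T.
Proof.
move=> iN; rewrite /grid divr_ge0 ?mulr_ge0 ?(ltW T0)//=.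
by rewrite ler_pdivrMr ?ltr0n// ler_pM2l// ler_nat.
Qed.

Lemma gridS N i : grid N i.+1 - grid N i = T / N.+1%:R.
Proof. by rewrite /grid -mulrBl -mulrBr -natr1 [i%:R + 1]addrC addrK mulr1. Qed.

Lemma grid_cell N s : 0 <= s <= T ->
  exists2 i, (i <= N)%N & grid N i <= s <= grid N i.+1.
Proof.
move=> /andP[s0 sT].
have N0 : 0 < N.+1%:R :> R by rewrite ltr0n.
have ex : exists i, s <= grid N i.+1.
  by exists N; rewrite /grid mulfK ?gt_eqF.
case: (ex_minnP ex) => i si mini; exists i.
  by apply: mini; rewrite /grid mulfK ?gt_eqF.
rewrite si andbT; case: i si mini => [|i] si mini.
  by rewrite /grid mulr0 mul0r.
by rewrite leNgt; apply/negP => /ltW /mini; rewrite ltnn.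
Qed.

Lemma grid_fine (d : R) : 0 < d -> exists N, T / N.+1%:R < d.
Proof.
move=> d0; exists (Num.truncn (T / d)); rewrite ltr_pdivrMr ?ltr0n//.
by rewrite mulrC -ltr_pdivrMr// truncnS_gt.
Qed.

Definition curve_ball g (eps : R) : set (R -> 'rV[R]_n) :=
  [set g' | Gam Omega T g' /\ forall s, 0 <= s <= T -> enorm (g' s - g s) < eps].

Lemma dist_continuous g g' : abs_cont_on T g -> abs_cont_on T g' ->
  continuous (fun s => enorm (g' (clamp 0 T s) - g (clamp 0 T s))).
Proof.
move=> acg acg' x; apply/cvgrPdist_lt => e e0.
have T0' := ltW T0; have e2 : 0 < e / 2 by rewrite divr_gt0.
have [d1 d10 H1] := abs_cont_uniform acg e2.
have [d2 d20 H2] := abs_cont_uniform acg' e2.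
have key s r : s <= r -> r - s < Num.min d1 d2 ->
    `|enorm (g' (clamp 0 T r) - g (clamp 0 T r)) -
      enorm (g' (clamp 0 T s) - g (clamp 0 T s))| < e.
  move=> sr; rewrite lt_min => /andP[l1 l2].
  have /andP[s0 _] := clamp_itv s T0'; have /andP[_ rT] := clamp_itv r T0'.
  have sr' := @clamp_homo R 0 T _ _ sr; have sr2 := clamp_dist T0' sr.
  have h1 := H1 _ _ s0 sr' rT (le_lt_trans sr2 l1).
  have h2 := H2 _ _ s0 sr' rT (le_lt_trans sr2 l2).
  move: (g (clamp 0 T s)) (g (clamp 0 T r)) (g' (clamp 0 T s)) (g' (clamp 0 T r)) h1 h2.
  move=> a b a' b' h1 h2.
  have h3 := ler_enorm_dist (b' - b) (a' - a).
  have h4 := ler_enorm_dist (a' - a) (b' - b).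
  have h5 : enorm (b' - b - (a' - a)) <= enorm (b' - a') + enorm (b - a).
    rewrite -(enormN (b - a)); apply: le_trans (ler_enormD _ _).
    rewrite (_ : b' - b - (a' - a) = b' - a' - (b - a))//.
    by apply/rowP => i; rewrite !mxE; ring.
  rewrite [enorm (a' - a - _)]enormB in h4; rewrite ltr_norml; apply/andP; split; lra.
exists (Num.min d1 d2); first by rewrite /= lt_min d10.
move=> y /= xy; have [h|/ltW h] := leP x y.
  by rewrite distrC key//; move: xy; rewrite ltr_norml => /andP[]; lra.
by rewrite key//; move: xy; rewrite ltr_norml => /andP[]; lra.
Qed.

(** Expresses a uniform ball by countably many evaluations, hence makes it measurable. The distance
    of two curves attains its maximum, so a strict bound holds with some margin eps / (k + 2), and
    by uniform continuity a bound with margin at the grid points extends to all times. *)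
Lemma curve_ballE g eps : abs_cont_on T g -> 0 < eps ->
  curve_ball g eps = Gam Omega T `&` \bigcup_(k in setT) \bigcap_(N in setT)
    \bigcap_(i in [set i | (i <= N.+1)%N])
      [set g' | enorm (g' (grid N i) - g (grid N i)) <= eps - eps / k.+2%:R].
Proof.
move=> acg e0; apply/seteqP; split => g' [Gg' H]; split => //.
- have [acg' _] := Gg'.
  have [c cI cmax] := @EVT_max R (fun s => enorm (g' (clamp 0 T s) - g (clamp 0 T s)))
    0 T (ltW T0) (continuous_subspaceT (dist_continuous acg acg')).
  move: cI; rewrite in_itv /= => cI.
  have := H c cI; rewrite -subr_gt0; set d := eps - _ => d0.
  pose k := Num.truncn (eps / d); exists k => // N _ i /= iN.
  have gI := grid_itv iN; have := cmax (grid N i); rewrite in_itv /= gI => /(_ isT).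
  rewrite !clamp_id// => h; apply: (le_trans h); rewrite lerBrDr -lerBrDl.
  rewrite -/d ler_pdivrMr ?ltr0n// mulrC -ler_pdivrMr//.
  by rewrite (le_trans (ltW (truncnS_gt (eps / d))))// ler_nat.
- have [k _ Hk] := H; have [acg' _] := Gg'.
  move=> s sT; apply: (@le_lt_trans _ _ (eps - eps / k.+2%:R)); last first.
    by rewrite ltrBlDr ltrDl divr_gt0.
  apply/ler_addgt0Pr => e e1; have e2 : 0 < e / 2 by rewrite divr_gt0.
  have [d1 d10 H1] := abs_cont_uniform acg e2.
  have [d2 d20 H2] := abs_cont_uniform acg' e2.
  have [|N HN] := @grid_fine (Num.min d1 d2); first by rewrite lt_min d10.
  have [i iN /andP[i1 i2]] := grid_cell N sT.
  have /andP[g0 _] := grid_itv (leqW iN).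
  have dd : s - grid N i < Num.min d1 d2.
    apply: le_lt_trans HN; rewrite -(gridS N i); lra.
  move: dd; rewrite lt_min => /andP[dd1 dd2]; have /andP[_ sT'] := sT.
  have h1 := H1 _ _ g0 i1 sT' dd1; have h2 := H2 _ _ g0 i1 sT' dd2.
  have h3 : enorm (g' (grid N i) - g (grid N i)) <= eps - eps / k.+2%:R.
    by apply: Hk => //=; exact: leqW.
  have h4 := ler_enormB (g' s) (g' (grid N i)) (g s).
  have h5 := ler_enormB (g' (grid N i)) (g (grid N i)) (g s).
  rewrite [enorm (g (grid N i) - _)]enormB in h5.
  move: (eps - _) h3 => c h3; lra.
Qed.

Lemma measurable_curve_ball g eps : abs_cont_on T g -> 0 < eps ->
  measurable (curve_ball g eps : set (CurveM Omega T)).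
Proof.
move=> acg e0; rewrite curve_ballE//; apply: measurableI; first exact: measurable_Gam.
apply: bigcupT_measurable => k; apply: bigcapT_measurable => N.
apply: bigcap_measurable; first by exists 0%N.
move=> i /= iN.
have := @measurable_enorm _ (CurveM Omega T) (fun g' => g' (grid N i)) (g (grid N i))
  (fun j => measurable_eval j (grid_itv iN)).
move=> /(_ measurableT `]-oo, (eps - eps / k.+2%:R)]%classic (measurable_itv _)).
by apply: eq_measurable; rewrite setTI; apply/seteqP; split => g' /=; rewrite in_itv.
Qed.

(* Separability of the curve space by hand: a code (N, j, s) prescribes up to
   2 / j.+1 the coordinates of a curve on each of the N.+1 cells of a grid. *)
Definition code : countType := (nat * nat * seq 'rV[int]_n)%type.

Definition code_set (c : code) : set (R -> 'rV[R]_n) :=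
  [set g | Gam Omega T g /\ forall i s k, (i <= c.1.1)%N ->
     grid c.1.1 i <= s <= grid c.1.1 i.+1 ->
     `|g s ord0 k - (nth 0 c.2 i ord0 k)%:~R / c.1.2.+1%:R| <= 2 / c.1.2.+1%:R].

(** The code rounds down the curve at the left end of each cell. Rounding and the oscillation of the
    curve over a cell contribute 1 / (j + 1) each. *)
Lemma code_exists g j : Gam Omega T g -> exists c : code, c.1.2 = j /\ code_set c g.
Proof.
move=> Gg; have [acg _] := Gg.
have j0 : 0 < (j.+1%:R)^-1 :> R by rewrite invr_gt0.
have [d d0 H] := abs_cont_uniform acg j0; have [N HN] := grid_fine d0.
pose z i : 'rV[int]_n := \row_k Num.floor (g (grid N i) ord0 k * j.+1%:R).
have [l Hl] : exists l : seq 'rV[int]_n, forall i, (i <= N)%N -> nth 0 l i = z i.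
  by exists (mkseq z N.+1) => i iN; rewrite nth_mkseq.
exists (N, j, l); split => //; split => //= i s k iN /andP[s1 s2].
rewrite Hl// mxE.
have /andP[g0 _] := grid_itv (leqW iN).
have h1 : `|g s ord0 k - g (grid N i) ord0 k| <= (j.+1%:R)^-1.
  have sT : s <= T.
    by apply: (le_trans s2); have /andP[] := grid_itv (i := i.+1) (N := N) iN.
  have sd : s - grid N i < d by apply: le_lt_trans HN; rewrite -(gridS N i); lra.
  apply: le_trans (ltW (H _ _ g0 s1 sT sd)).
  by have := coord_enorm (g s - g (grid N i)) k; rewrite !mxE.
have h2 : `|g (grid N i) ord0 k - (Num.floor (g (grid N i) ord0 k * j.+1%:R))%:~R / j.+1%:R|
    <= (j.+1%:R)^-1.
  set a := g (grid N i) ord0 k.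
  have -> : a - (Num.floor (a * j.+1%:R))%:~R / j.+1%:R =
     (a * j.+1%:R - (Num.floor (a * j.+1%:R))%:~R) / j.+1%:R.
    by rewrite mulrBl mulfK// pnatr_eq0.
  rewrite normrM [`|j.+1%:R^-1|]ger0_norm ?(ltW j0)// ler_piMl ?(ltW j0)//.
  have /andP[f1 f2] := floor_itv (a * j.+1%:R).
  rewrite intrD1 in f2; rewrite ger0_norm; lra.
set b := _%:~R / _; set a := g (grid N i) ord0 k in h1 h2 *.
apply: (@le_trans _ _ (`|g s ord0 k - a| + `|a - b|)).
  by rewrite -[g s ord0 k - b](subrKA a) ler_normD.
by rewrite mulrDl mul1r lerD.
Qed.

Lemma code_set_close c g g' s : code_set c g -> code_set c g' -> 0 <= s <= T ->
  enorm (g' s - g s) <= n%:R * (4 / c.1.2.+1%:R).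
Proof.
move=> [_ h] [_ h'] sT; apply: (le_trans (enorm_le_norm _)); rewrite ler_wpM2l//.
have [i iN sI] := grid_cell c.1.1 sT.
rewrite [leLHS]/Num.Def.normr/= mx_normrE; apply: bigmax_le.
  by rewrite divr_ge0.
move=> [i1 k] _ /=; rewrite ord1 !mxE.
have h1 := h i s k iN sI; have h2 := h' i s k iN sI.
have -> : 4 / c.1.2.+1%:R = 2 / c.1.2.+1%:R + 2 / c.1.2.+1%:R :> R.
  by rewrite -mulrDl -natrD.
move: h1 h2; set b := _%:~R / _; set a := 2 / _ => h1 h2.
apply: le_trans (lerD h2 h1); rewrite -[_ - _](subrKA b).
by rewrite [`|g s _ _ - b|]distrC ler_normD.
Qed.

(** A Lindelof argument: if A missed the support, each of its admissible curves would be the centre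
    of a null ball, and a fine enough code set around the curve lies in that ball. There are
    countably many codes, so A would be null. *)
Lemma supp_eta_meets (eta : probability (CurveM Omega T) R) (A : set (CurveM Omega T)) :
  eta (Gam Omega T) = 1%E -> measurable A -> (0 < eta A)%E ->
  exists g, supp_eta eta g /\ A g.
Proof.
move=> eG mA A0; apply: contrapT => nex.
have nullb g : Gam Omega T g -> A g -> exists2 eps : R, 0 < eps &
    eta (curve_ball g eps) = 0%E.
  move=> Gg Ag; apply: contrapT => H; apply: nex; exists g; split => //; split => //.
  move=> eps e0; rewrite lt_neqAle measure_ge0 andbT; apply/eqP => h.
  by apply: H; exists eps.
pose P (c : code) (ge : (R -> 'rV[R]_n) * R) := [/\ Gam Omega T ge.1, 0 < ge.2,
  eta (curve_ball ge.1 ge.2) = 0%E & code_set c `<=` curve_ball ge.1 ge.2].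
(* For each code one null ball containing its code set is chosen, if there is any; the union over
   codes is then countable. *)
pose B (c : code) : set (CurveM Omega T) :=
  if pselect (exists ge, P c ge) is left h then
    curve_ball (projT1 (cid h)).1 (projT1 (cid h)).2 else set0.
have B0 c : eta.-negligible (B c).
  rewrite /B; case: pselect => [h|_]; last exact: negligible_set0.
  case: (cid h) => ge /= [Gg e0 b0 _].
  by apply/negligibleP => //; apply: measurable_curve_ball => //; case: Gg.
pose F k : set (CurveM Omega T) := if unpickle k is Some c then B c else set0.
have F0 : eta.-negligible (\bigcup_k F k).
  apply: negligible_bigcup => k; rewrite /F; case: unpickle => [c|]; first exact: B0.
  exact: negligible_set0.
have G0 : eta.-negligible (~` (Gam Omega T : set (CurveM Omega T))).
  apply/negligibleP; first by apply: measurableC; exact: measurable_Gam.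
  by rewrite [LHS](probability_setC eta measurable_Gam) eG subee.
have /negligibleP : eta.-negligible A.
  apply: negligibleS (negligibleU F0 G0) => g Ag.
  have [Gg|] := pselect (Gam Omega T g); last by right.
  left; have [eps e0 b0] := nullb g Gg Ag.
  (* Two curves with the same code differ by at most 4 n / (j + 1), which this j makes smaller than
     eps. *)
  pose j := Num.truncn (n%:R * 4 / eps).
  have [c [cj cg]] := code_exists j Gg.
  have Pc : P c (g, eps).
    split => //= g' cg'; split; first by case: cg'.
    move=> s sT; apply: le_lt_trans (code_set_close cg cg' sT) _.
    rewrite cj mulrA ltr_pdivrMr ?ltr0n// [ltRHS]mulrC -ltr_pdivrMr//.
    exact: truncnS_gt.
  exists (pickle c) => //; rewrite /F pickleK /B.
  case: pselect => [h|]; last by move=> /(_ (ex_intro _ _ Pc)).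
  by case: (cid h) => ge /= [_ _ _]; apply.
by move=> /(_ mA) E; move: A0; rewrite E ltxx.
Qed.

Lemma supp_m_curve (m : R -> probability (Pt R n) R) (eta : probability (CurveM Omega T) R)
    t x (r : R) :
  eta (Gam Omega T) = 1%E -> 0 <= t <= T ->
  (forall A : set (Pt R n), measurable A ->
     m t A = eta ([set g | A (g t)] : set (CurveM Omega T))) ->
  supp_m (m t) x -> 0 < r -> exists2 g, supp_eta eta g & enorm (g t - x) < r.
Proof.
move=> eG tT mE sx r0.
have mB : measurable ([set y | enorm (y - x) < r] : set (Pt R n)).
  have mc i : measurable_fun setT (fun y : Pt R n => y ord0 i).
    move=> _ B mB; rewrite setTI; apply: sub_sigma_algebra.
    by exists i, B.
  have := @measurable_enorm _ (Pt R n) id x mc.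
  move=> /(_ measurableT `]-oo, r[%classic (measurable_itv _)).
  by apply: eq_measurable; rewrite setTI; apply/seteqP; split => y /=; rewrite in_itv.
have mA : measurable ([set g | enorm (g t - x) < r] : set (CurveM Omega T)).
  have := @measurable_enorm _ (CurveM Omega T) (fun g => g t) x
    (fun j => measurable_eval j tT).
  move=> /(_ measurableT `]-oo, r[%classic (measurable_itv _)).
  by apply: eq_measurable; rewrite setTI; apply/seteqP; split => y /=; rewrite in_itv.
have := sx r r0; rewrite mE// => h.
by have [g [sg gA]] := supp_eta_meets eG mA h; exists g.
Qed.

End support.

(** * The domain near a boundary point *)

Section domain.
Context {R : realType} {n : nat}.
Variables (Omega : set 'rV[R]_n) (rho : 'rV[R]_n -> R).
Hypothesis hrho : C2_defining_function Omega rho.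
Implicit Types (x y d : 'rV[R]_n).

Lemma rho_diff x : differentiable rho x.
Proof. by have [[[h _] _] _] := hrho; exact: h. Qed.

Lemma closure_rho x : closure Omega x -> rho x <= 0.
Proof.
move=> clx; rewrite leNgt; apply/negP => rx.
have /cvgrPdist_lt/(_ _ rx) /clx [y [Oy /=]] := differentiable_continuous (rho_diff x).
have [_ [OE _]] := hrho; move: Oy; rewrite OE /= ltr_norml => ry /andP[_]; lra.
Qed.

Lemma rho_closure x : rho x < 0 -> closure Omega x.
Proof. by move=> rx; apply: subset_closure; have [_ [-> _]] := hrho. Qed.

Lemma bdry_rho x : bdry Omega x -> rho x = 0.
Proof.
move=> [clx nO]; apply/eqP; rewrite eq_le closure_rho//= leNgt; apply/negP => rx.
by apply: nO; have [_ [-> _]] := hrho.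
Qed.

Lemma rho_MVT x y : exists2 c, 0 < c < 1 &
  rho y - rho x = dot (grad rho (x + c *: (y - x))) (y - x).
Proof.
have H (s : R) : 0 <= s <= 1 -> is_derive s 1 (fun r => rho (x + r *: (y - x)))
    (dot (grad rho (x + s *: (y - x))) (y - x)).
  move=> _; rewrite -(derive_dot_grad _ (rho_diff _)).
  exact: is_derive_line (rho_diff _).
have [c c01 E] := derive_MVT01 H.
exists c => //; rewrite -E; congr (rho _ - rho _).
  by rewrite scale1r addrC subrK.
by rewrite scale0r addr0.
Qed.

Lemma grad_close x (e : R) : 0 < e -> exists2 r, 0 < r &
  forall y, enorm (y - x) < r -> enorm (grad rho y - grad rho x) <= e.
Proof.
move=> e0; have [[[_ c1] _] _] := hrho.
have n0 : 0 < n%:R + 1 :> R by rewrite ltr_wpDl.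
have e1 : 0 < e / (n%:R + 1) by rewrite divr_gt0.
have H i : \forall y \near x, `|'D_(ev R i) rho x - 'D_(ev R i) rho y| < e / (n%:R + 1).
  exact: (cvgrPdist_lt _ _).1 (c1 i x I) _ e1.
have /nbhs_ballP[r /= r0 rH] := filter_forall (nbhs_filter x) H.
exists r => // y yx.
have yb : ball x r y.
  rewrite mx_norm_ball /ball_ /=.
  by apply: le_lt_trans yx; rewrite enormB; exact: norm_le_enorm.
apply: (le_trans (enorm_le_norm _)).
apply: (@le_trans _ _ (n%:R * (e / (n%:R + 1)))).
  rewrite ler_wpM2l// [leLHS]/Num.Def.normr/= mx_normrE; apply: bigmax_le.
    exact: ltW.
  move=> [i1 i] _ /=; rewrite !mxE distrC; exact/ltW/rH.
rewrite mulrA ler_pdivrMr// mulrC ler_pM2l//; lra.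
Qed.

(** Strict differentiability: both points vary near x, and the error is relative to their
    distance. *)
Lemma rho_close x (e : R) : 0 < e -> exists2 r, 0 < r &
  forall y z, enorm (y - x) < r -> enorm (z - x) < r ->
    `|rho z - rho y - dot (grad rho x) (z - y)| <= e * enorm (z - y).
Proof.
move=> e0; have [r r0 H] := grad_close x e0; exists r => // y z yx zx.
have [c /andP[c0 c1] ->] := rho_MVT y z; rewrite -dotNl -dotDl.
apply: (le_trans (ler_abs_dot _ _)); rewrite ler_wpM2r ?enorm_ge0//; apply: H.
have -> : y + c *: (z - y) - x = (1 - c) *: (y - x) + c *: (z - x).
  by apply/rowP => i; rewrite !mxE; ring.
apply: (le_lt_trans (ler_enormD _ _)); rewrite !enormZ !ger0_norm ?subr_ge0 ?(ltW c0) ?(ltW c1)//.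
have c1' : 0 < 1 - c by lra.
have q1 : (1 - c) * enorm (y - x) < (1 - c) * r by rewrite ltr_pM2l.
have q2 : c * enorm (z - x) < c * r by rewrite ltr_pM2l.
lra.
Qed.

Lemma inward_line x d : rho x = 0 -> dot (grad rho x) d < 0 ->
  exists2 h0, 0 < h0 & forall h, 0 < h < h0 -> rho (x + h *: d) < 0.
Proof.
move=> rx gd; pose k := - dot (grad rho x) d; have k0 : 0 < k by rewrite oppr_gt0.
have d0 := enorm_ge0 d; have d1 : 0 < enorm d + 1 by lra.
(* At this precision the remainder along h d is at most half of the first-order decrease h k. *)
have e0 : 0 < k / (enorm d + 1) / 2 by rewrite !divr_gt0.
have [r r0 H] := rho_close x e0; exists (r / (enorm d + 1)); first by rewrite divr_gt0.
move=> h /andP[h0 hr]; have := H x (x + h *: d).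
rewrite subrr enorm0 [x + _]addrC addrK rx subr0 enormZ gtr0_norm// dotZr => {}H.
have hd : h * enorm d < r.
  by move: hr; rewrite ltr_pdivlMr//; apply: le_lt_trans; rewrite ler_pM2l//; lra.
have := H r0 hd; rewrite ler_norml => /andP[_].
have q : k / (enorm d + 1) / 2 * (h * enorm d) <= h * k / 2.
  have -> : k / (enorm d + 1) / 2 * (h * enorm d) =
     (h * k / 2) * (enorm d / (enorm d + 1)) by field; rewrite gt_eqF.
  rewrite ler_piMr//; first by rewrite !mulr_ge0// ltW.
  by rewrite ler_pdivrMr//; lra.
have : 0 < h * k by rewrite mulr_gt0.
move: q; rewrite /k; set X := k / _ / _ * _; lra.
Qed.

(* The inward push compensates the failure of convexity along the chord, which
   is of first order with a small constant because grad rho is continuous. *)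
Lemma pushed_chord_inside x (om : R) : rho x = 0 -> 0 < om <= 1 ->
  exists2 r, 0 < r & forall y1 y2 (th : R),
    closure Omega y1 -> closure Omega y2 ->
    enorm (y1 - x) < r -> enorm (y2 - x) < r -> 0 <= th <= 1 ->
    closure Omega (y1 + th *: (y2 - y1)
      - (om * (th * (1 - th)) * enorm (y2 - y1)) *: outward_normal rho x).
Proof.
move=> rx /andP[om0 om1]; have [_ [_ /(_ x rx)/enorm_gt0]] := hrho.
set g0 := grad rho x; set ga := enorm g0 => ga0; set nu := outward_normal rho x.
have gnu : dot g0 nu = ga.
  by rewrite /nu /outward_normal dotZr -enorm_sqr -/g0 -/ga expr2 mulKf// gt_eqF.
have nu1 : enorm nu = 1.
  by rewrite /nu /outward_normal enormZ -/g0 -/ga gtr0_norm ?invr_gt0// mulVf// gt_eqF.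
move: nu gnu nu1 => nu gnu nu1.
(* At this precision the chord exceeds the level 0 by at most s ga / 2, where s is the length of the
   push. The push gains s ga up to an error s ga / 4, so the result is strictly negative. *)
have e0 : 0 < om * ga / 4 by rewrite divr_gt0// mulr_gt0.
have [r r0 H] := rho_close x e0; exists (r / 2); first by rewrite divr_gt0.
move=> y1 y2 th c1 c2 b1 b2 /andP[t0 t1].
(* Where the push vanishes, strict negativity is lost, but the point is then y1 or y2. *)
have [->|dn] := eqVneq y2 y1; first by rewrite subrr scaler0 enorm0 mulr0 scale0r addr0 subr0.
have [->|tn0] := eqVneq th 0; first by rewrite scale0r mul0r mulr0 mul0r scale0r addr0 subr0.
have [->|tn1] := eqVneq th 1.
  by rewrite scale1r subrr mulr0 mulr0 mul0r scale0r subr0 addrC subrK.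
have t0' : 0 < th by rewrite lt_neqAle eq_sym tn0.
have t1' : 0 < 1 - th by rewrite subr_gt0 lt_neqAle tn1.
have D0 : 0 < enorm (y2 - y1) by rewrite enorm_gt0// subr_eq0.
apply: rho_closure; set z := y1 + th *: (y2 - y1).
set s := om * (th * (1 - th)) * enorm (y2 - y1).
have s0 : 0 < s by rewrite !mulr_gt0.
have Dr : enorm (y2 - y1) < r.
  by have := ler_enormB y2 x y1; rewrite [enorm (x - y1)]enormB; lra.
have zx : enorm (z - x) < r / 2.
  have -> : z - x = (1 - th) *: (y1 - x) + th *: (y2 - x).
    by apply/rowP => i; rewrite !mxE; ring.
  apply: (le_lt_trans (ler_enormD _ _)); rewrite !enormZ !gtr0_norm//.
  have q1 : (1 - th) * enorm (y1 - x) < (1 - th) * (r / 2) by rewrite ltr_pM2l.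
  have q2 : th * enorm (y2 - x) < th * (r / 2) by rewrite ltr_pM2l.
  lra.
have sr : s <= enorm (y2 - y1) / 4.
  have -> : s = (om * (th * (1 - th))) * enorm (y2 - y1) by [].
  rewrite mulrC ler_pM2l//; have sq := sqr_ge0 (2 * th - 1).
  have q : th * (1 - th) <= 1 / 4 by lra.
  have q0 : 0 < th * (1 - th) by rewrite mulr_gt0.
  have := ler_wpM2r (ltW q0) om1; lra.
have zsx : enorm (z - s *: nu - x) < r.
  rewrite -addrA [- _ - x]addrC addrA; apply: (le_lt_trans (ler_enormD _ _)).
  by rewrite enormN enormZ nu1 mulr1 gtr0_norm//; lra.
have y1r : enorm (y1 - x) < r by lra.
have y2r : enorm (y2 - x) < r by lra.
have zr : enorm (z - x) < r by lra.
have := H y1 z y1r zr; have := H z y2 zr y2r; have := H z (z - s *: nu) zr zsx.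
have E1 : z - s *: nu - z = - s *: nu by rewrite addrC addKr scaleNr.
have E2 : y2 - z = (1 - th) *: (y2 - y1) by apply/rowP => i; rewrite !mxE; ring.
have E3 : z - y1 = th *: (y2 - y1) by rewrite /z addrC addKr.
rewrite E1 E2 E3 -/g0 !dotZr gnu !enormZ nu1 normrN.
rewrite (gtr0_norm s0) (gtr0_norm t0') (gtr0_norm t1') mulr1.
rewrite !ler_norml => /andP[_ h1] /andP[h2 _] /andP[_ h3].
have r1 := closure_rho c1; have r2 := closure_rho c2.
have h2' := ler_wpM2l (ltW t0') h2; have h3' := ler_wpM2l (ltW t1') h3.
have r1' := ler_wpM2l (ltW t1') r1; have r2' := ler_wpM2l (ltW t0') r2.
have om4 : om * ga / 4 * s <= ga / 4 * s.
  by have := ler_wpM2r (ltW (mulr_gt0 ga0 s0)) om1; lra.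
have sga : 0 < s * ga by rewrite mulr_gt0.
have key : rho z <= s * ga / 2.
  have -> : s * ga / 2 = th * (om * ga / 4 * ((1 - th) * enorm (y2 - y1))) +
     (1 - th) * (om * ga / 4 * (th * enorm (y2 - y1))) by rewrite /s; field.
  lra.
lra.
Qed.

End domain.

(** * Choice of parameters and absorption of errors *)

Section real_inequalities.
Context {R : realType}.
Implicit Types (a b c d e k h : R).

Lemma scale_choice a b c d : 0 < a -> 0 < b -> 0 < c -> 0 < d ->
  exists2 k, 0 < k & [/\ 2 * k <= a, 2 * k <= b, 2 * k <= c & 2 * k <= d].
Proof.
move=> a0 b0 c0 d0; exists (Num.min (Num.min a b) (Num.min c d) / 2).
  by rewrite divr_gt0// !lt_min a0 b0 c0.
by rewrite mulrC divfK//; split; rewrite !ge_min lexx ?orbT.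
Qed.

Lemma lt_of_double k a : 0 < k -> 2 * k <= a -> k < a.
Proof. by move=> *; lra. Qed.

(** Lets a proof list all its smallness requirements at once, as pairs of a coefficient and a
    threshold. *)
Lemma small_parameter (s : seq (R * R)) : all (fun p => 0 < p.2) s ->
  exists2 om : R, 0 < om & forall a b, (a, b) \in s -> om * a <= b.
Proof.
elim: s => [_|[a b] s ih] /=; first by exists 1.
move=> /andP[b0 s0]; have [om om0 H] := ih s0.
have a0 : 0 < `|a| + 1 by rewrite ltr_wpDl.
exists (Num.min om (b / (`|a| + 1))); first by rewrite lt_min om0 divr_gt0.
set o' := Num.min _ _.
have o'0 : 0 < o' by rewrite lt_min om0 divr_gt0.
have o1 : o' <= om by rewrite ge_min lexx.
have o2 : o' * (`|a| + 1) <= b by rewrite -ler_pdivlMr// ge_min lexx orbT.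
move=> c d; rewrite inE => /predU1P[[-> ->]|cs].
  apply: le_trans o2; rewrite ler_pM2l//; have := ler_norm a; lra.
have d0 : 0 < d by have /allP/(_ _ cs) := s0.
have [c0|/ltW c0] := leP c 0.
  by apply: le_trans (ltW d0); rewrite pmulr_rle0.
by apply: le_trans (H _ _ cs); rewrite ler_wpM2r.
Qed.

Lemma ler_1Dsqr a : a <= 1 + a ^+ 2.
Proof. by have := sqr_ge0 (a - 1); have := sqr_ge0 a; lra. Qed.

(* s, v, w stand for |v - w|^2, |v|^2 and |w|^2 in the corner estimate. *)
Lemma corner_absorb (mu om C C' s v w : R) : 0 < mu -> 0 <= om -> 0 <= C -> 0 <= s ->
  om * (16 * mu * C) <= 1 -> s / (4 * mu) <= om * C * (1 + v + w) ->
  w <= 2 * v + 2 * s -> 1 + v <= C' -> s <= om * (24 * mu * C * C').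
Proof.
move=> mu0 om0 C0 s0 om4 + w2 b2; rewrite ler_pdivrMr ?mulr_gt0// => b3.
have oC0 : 0 <= om * C by rewrite mulr_ge0.
have k1 := ler_wpM2l oC0 w2; have k2 := ler_wpM2l oC0 b2.
have k3 := ler_wpM2l (ltW mu0) k1; have k4 := ler_wpM2l (ltW mu0) k2.
have k5 := ler_wpM2r s0 om4; have k6 := mulr_ge0 (ltW mu0) oC0; lra.
Qed.

(* a, b, c stand for the normal components of v, w and v - w. *)
Lemma normal_absorb (om C th a b c V W : R) : 0 <= om -> 0 <= th ->
  - a <= om * (2 + V) -> b <= om * (2 + W) -> a = b + c -> c <= th ->
  V <= C -> W <= C + 1 -> om * (3 + C) <= th -> `|a| <= 2 * th.
Proof.
move=> om0 th0 n1 n2 n3 n4 vC wC om6.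
have := ler_wpM2l om0 wC; have := ler_wpM2l om0 vC => k1 k2.
by rewrite ler_norml; apply/andP; split; lra.
Qed.

End real_inequalities.

(** * Dynamic programming and minimizers *)

Section dynamic_programming.
Context {R : realType} {n : nat}.
Variables (Omega U : set 'rV[R]_n) (T kappa M mu : R).
Variables (L : 'rV[R]_n -> 'rV[R]_n -> R).
Variables (F G : 'rV[R]_n -> probability (Pt R n) R -> R).
Variables (u : R -> 'rV[R]_n -> R) (m : R -> probability (Pt R n) R).
Hypotheses (T0 : 0 < T) (oU : open U) (clU : closure Omega `<=` U).
Hypotheses (hD1 : hyp_D1 U Omega F G kappa) (hD2 : hyp_D2 U Omega F G kappa).
Hypotheses (hL0 : hyp_L0 U L M) (hL1 : hyp_L1 U L mu).
Hypothesis mPO : forall t, 0 <= t <= T -> in_PO Omega (m t).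
Hypothesis mcont : forall t, 0 <= t <= T -> forall eps : R, 0 < eps ->
  exists2 delta : R, 0 < delta & forall s, 0 <= s <= T -> `|s - t| < delta ->
    d1 Omega (m s) (m t) < eps.
Hypothesis uE : forall t x, 0 <= t <= T -> closure Omega x ->
  ((u t x)%:E = ereal_inf [set cost T L F G m t g
                           | g in [set g | Gam Omega T g /\ g t = x]])%E.
Implicit Types (g c : R -> 'rV[R]_n) (x y v w : 'rV[R]_n).
Local Notation leb := (@lebesgue_measure R).

Lemma kappa_ge0 x : U x -> 0 <= kappa.
Proof.
move=> Ux; have T00 : 0 <= (0 : R) <= T by rewrite lexx ltW.
have [_ [_ [_ /(_ x Ux)]]] := hD2 (mPO T00).
by apply: le_trans; rewrite addr_ge0// enorm_ge0.
Qed.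

Lemma F_time x s t (e : R) : U x -> 0 <= t <= T -> 0 <= s <= T ->
  d1 Omega (m s) (m t) < e -> `|F x (m s) - F x (m t)| <= kappa * e.
Proof.
move=> Ux tT sT de; have := hD1 Ux (mPO sT) (mPO tT) => h.
apply: (@le_trans _ _ (kappa * d1 Omega (m s) (m t))).
  by apply: le_trans h; rewrite lerDl.
by rewrite ler_wpM2l ?(kappa_ge0 Ux)// ltW.
Qed.

(** Each fixed time has its own bound; the Lipschitz dependence on the measure and the continuity of
    m extend it to nearby times, and [0, T] is compact. *)
Lemma F_bounded : exists K : R, forall s x, 0 <= s <= T -> U x -> `|F x (m s)| <= K.
Proof.
have cov := (compact_near_coveringP _).1 (@segment_compact R 0 T).
have [|K0 [_ HK]] := cov R (pinfty_nbhs R)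
  (fun K s => 0 <= s <= T -> forall x, U x -> `|F x (m s)| <= K) _.
  move=> r; rewrite /= in_itv /= => rT.
  have [_ [_ [[B HB] _]]] := hD2 (mPO rT).
  have [d d0 Hd] := mcont rT ltr01.
  exists ([set s | `|s - r| < d], [set K | B + kappa < K]).
    split => /=.
      by exists d => //= s /=; rewrite distrC.
    by exists (B + kappa); split; [exact: num_real|].
  move=> [s K] /= [sr BK] sT x Ux.
  have h1 := F_time Ux rT sT (Hd s sT sr); have [h2 _] := HB x Ux.
  have h3 := ler_normD (F x (m s) - F x (m r)) (F x (m r)); rewrite subrK in h3.
  lra.
exists (K0 + 1) => s x sT Ux; apply: (HK (K0 + 1)) => //=; by rewrite ltrDl.
Qed.

Definition ig g (s : R) : R := L (g s) (derive1 g s) + F (g s) (m s).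

Definition J g (a b : R) : \bar R := (\int[leb]_(s in `[a, b]) (ig g s)%:E)%E.

Lemma costE t g : cost T L F G m t g = (J g t T + (G (g T) (m T))%:E)%E.
Proof. by []. Qed.

(** Coercivity bounds the running cost from below along all admissible curves, which makes actions
    additive in time. *)
Lemma ig_lower : exists K : R, 0 <= K /\
  forall g s, Gam Omega T g -> 0 <= s <= T -> - K <= ig g s.
Proof.
have [K HK] := F_bounded.
exists (`|M + mu * M ^+ 2| + `|K|); split; first by rewrite addr_ge0.
move=> g s [_ clg] sT; have Ug := clU (clg s sT); rewrite /ig.
have h1 := L_coercive hL0 hL1 (derive1 g s) Ug.
have h2 := HK s _ sT Ug; have h3 := ler_norm K; have h4 := ler_norm (M + mu * M ^+ 2).
have mu0 : 0 < mu by case: hL1.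
have h5 : 0 <= enorm (derive1 g s) ^+ 2 / (4 * mu).
  by rewrite divr_ge0 ?sqr_ge0// mulr_ge0// ltW.
move: h2; rewrite ler_norml => /andP[h2 _].
move: h1 h5; set X := enorm _ ^+ 2 / _; set Y := L _ _; set Z := F _ _ in h2 *.
move: h4; set W := M + _; lra.
Qed.

Lemma J_split g (a b c : R) : Gam Omega T g -> 0 <= a -> a <= b -> b <= c -> c <= T ->
  J g a c = (J g a b + J g b c)%E.
Proof.
move=> Gg a0 ab bc cT; have [K [_ HK]] := ig_lower.
apply: (@seg_integral_split R a b c _ (- K)) => // s /andP[as_ sc].
by apply: HK => //; rewrite (le_trans a0 as_) (le_trans sc cT).
Qed.

Lemma J_gtNy g a b : Gam Omega T g -> 0 <= a -> a <= b -> b <= T -> (-oo < J g a b)%E.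
Proof.
move=> Gg a0 ab bT; have [K [_ HK]] := ig_lower.
apply: (@lt_le_trans _ _ (- K * (b - a))%:E); first by rewrite ltNyr.
apply: seg_integral_ge_cst => // s /andP[as_ sb].
by apply: HK => //; rewrite (le_trans a0 (ltW as_)) (le_trans (ltW sb) bT).
Qed.

Lemma J_eq g g' a b : (forall s, a <= s <= b -> g s = g' s) -> J g a b = J g' a b.
Proof.
move=> gg'; apply: seg_integral_eq => s sab; rewrite /ig (derive1_eq_itv gg' sab).
by case/andP: sab => ? ?; rewrite gg'// !ltW.
Qed.

Lemma Gam_cst x : closure Omega x -> Gam Omega T (fun=> x).
Proof.
move=> clx; split => //; apply: (@lipschitz_abs_cont _ _ _ _ 0) => s r _.
by rewrite subrr enorm0 mul0r.
Qed.

Lemma value_le g t : 0 <= t <= T -> Gam Omega T g ->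
  ((u t (g t))%:E <= cost T L F G m t g)%E.
Proof.
move=> tT Gg; rewrite uE//; last by case: Gg => _; exact.
by apply: ereal_inf_lbound; exists g.
Qed.

(** The curve c on [a, b], continued by any competitor from c(b), is admissible from c(a): one half
    of the dynamic programming principle. *)
Lemma value_step c a b (j : R) : Gam Omega T c -> 0 <= a -> a <= b -> b <= T ->
  (J c a b <= j%:E)%E -> u a (c a) <= j + u b (c b).
Proof.
move=> Gc a0 ab bT Jj; have [_ clc] := Gc.
have aT : 0 <= a <= T by rewrite a0 (le_trans ab bT).
have bT' : 0 <= b <= T by rewrite bT (le_trans a0 ab).
rewrite -lerBlDl -lee_fin uE//; last exact: clc.
apply: le_ereal_inf_tmp => _ [g' [Gg' g'b] <-].
have Gc' := Gam_glue bT' (esym g'b) Gc Gg'.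
have := value_le aT Gc'; rewrite glue_le// !costE (J_split Gc' a0 ab bT (lexx _)).
rewrite (@J_eq _ c); last by move=> s /andP[_ sb]; rewrite glue_le.
rewrite (@J_eq (glue b c g') g'); last by move=> s /andP[bs _]; rewrite glue_ge.
rewrite glue_ge// EFinB => h; rewrite leeBlDl//; apply: (le_trans h).
by rewrite -addeA leeD2r.
Qed.

Definition minimizer g := is_minimizer Omega T L F G m g.

(** Comparison with the curve that rests at the starting point; the bound is the same for all
    starting points. *)
Lemma minimizer_cost : exists K : R, 0 <= K /\ forall g, minimizer g ->
  (J g 0 T <= K%:E)%E.
Proof.
have [K HK] := F_bounded; have TT : 0 <= T <= T by rewrite lexx ltW.
have [_ [_ [[B HB] _]]] := hD2 (mPO TT).
exists (`|M + K| * T + 2 * `|B|); split.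
  by rewrite addr_ge0// mulr_ge0// ltW.
move=> g [Gg gmin]; have [_ clg] := Gg.
have T00 : 0 <= (0 : R) <= T by rewrite lexx ltW.
have := gmin _ (Gam_cst (clg 0 T00)) erefl; rewrite !costE => h.
have Ug := clU (clg 0 T00).
have h1 : (J (fun=> g 0%R) 0 T <= ((M + K) * (T - 0))%:E)%E.
  apply: seg_integral_le_cst; first exact: ltW.
  move=> s /andP[s0 sT]; rewrite /ig /= derive1_cst.
  have sT' : 0 <= s <= T by rewrite !ltW.
  have h2 := HK s _ sT' Ug; have h3 := L_upper hL0 hL1 0 Ug.
  move: h3; rewrite enorm0 expr0n /= !mulr0 !addr0 => h3.
  by apply: lerD => //; apply: le_trans h2; exact: ler_norm.
have [_ g1] := HB _ (clU (clg T TT)); have [_ g2] := HB _ Ug.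
have h4 : (J g 0 T + (G (g T) (m T))%:E <= ((M + K) * T + `|B|)%:E)%E.
  apply: (le_trans h); rewrite EFinD leeD//; first by rewrite subr0 in h1.
  by rewrite lee_fin (le_trans (ler_norm _))// (le_trans g2)// ler_norm.
rewrite -leeBrDr// in h4; apply: (le_trans h4); rewrite lee_fin.
have h5 := ler_norm (M + K); have h6 := ler_wpM2r (ltW T0) h5.
move: g1; rewrite ler_norml => /andP[g1 _]; have := ler_norm B; lra.
Qed.

(** No piece is -oo and the total is not +oo. Finiteness allows the common pieces to be cancelled in
    the comparisons that follow. *)
Lemma minimizer_fin g a b : minimizer g -> 0 <= a -> a <= b -> b <= T ->
  J g a b \is a fin_num.
Proof.
move=> mg a0 ab bT; have [Gg _] := mg.
have aT := le_trans ab bT.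
rewrite fin_numElt (J_gtNy Gg a0 ab bT) /=.
have [K [_ /(_ g mg)]] := minimizer_cost.
rewrite (J_split Gg (lexx _) a0 aT (lexx _)) (J_split Gg a0 ab bT (lexx _)) => h.
rewrite ltey; apply/eqP => E; move: h; rewrite E addye; last first.
  by rewrite gt_eqF// (J_gtNy Gg (le_trans a0 ab) bT (lexx _)).
by rewrite addey// gt_eqF// (J_gtNy Gg (lexx _) a0 aT).
Qed.

Lemma minimizer_tail g g' a : minimizer g -> Gam Omega T g' -> 0 <= a <= T ->
  g' a = g a -> (cost T L F G m a g <= cost T L F G m a g')%E.
Proof.
move=> mg Gg' aT ga; have [Gg gmin] := mg; have /andP[a0 aT'] := aT.
have Gc := Gam_glue aT (esym ga) Gg Gg'.
have := gmin _ Gc (glue_le _ _ a0); rewrite !costE.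
rewrite (J_split Gg (lexx _) a0 aT' (lexx _)) (J_split Gc (lexx _) a0 aT' (lexx _)).
rewrite (@J_eq (glue a g g') g 0 a); last by move=> s /andP[_ sb]; rewrite glue_le.
rewrite (@J_eq (glue a g g') g' a T); last by move=> s /andP[bs _]; rewrite glue_ge.
rewrite glue_ge//; move: (minimizer_fin mg (lexx _) a0 aT').
by move: (J g 0 a) (J g a T) (J g' a T) => j1 j2 j3 fj; rewrite -!addeA leeD2lE.
Qed.

(** The other half of dynamic programming, valid along minimizers: the tail of a minimizer is
    optimal from its current point. *)
Lemma minimizer_value g a b (j : R) : minimizer g -> 0 <= a -> a <= b -> b <= T ->
  (j%:E <= J g a b)%E -> j + u b (g b) <= u a (g a).
Proof.
move=> mg a0 ab bT jJ; have [Gg _] := mg; have [_ clg] := Gg.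
have aT : 0 <= a <= T by rewrite a0 (le_trans ab bT).
have bT' : 0 <= b <= T by rewrite bT (le_trans a0 ab).
rewrite -lee_fin (uE aT (clg a aT)).
apply: le_ereal_inf_tmp => _ [g' [Gg' g'a] <-].
apply: le_trans (minimizer_tail mg Gg' aT g'a).
rewrite costE (J_split Gg a0 ab bT (lexx _)) -addeA EFinD leeD//.
by have := value_le bT' Gg; rewrite costE.
Qed.

Lemma minimizer_local g g' a b : minimizer g -> Gam Omega T g' ->
  0 <= a -> a <= b -> b <= T -> g' a = g a -> g' b = g b -> (J g a b <= J g' a b)%E.
Proof.
move=> mg Gg' a0 ab bT ga gb; have [Gg _] := mg.
have aT : 0 <= a <= T by rewrite a0 (le_trans ab bT).
have bT' : 0 <= b <= T by rewrite bT (le_trans a0 ab).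
have Gc := Gam_glue bT' gb Gg' Gg.
have cga : glue b g' g a = g a by rewrite glue_le.
have := minimizer_tail mg Gc aT cga; rewrite !costE glue_ge//.
rewrite leeD2rE// (J_split Gg a0 ab bT (lexx _)) (J_split Gc a0 ab bT (lexx _)).
rewrite (@J_eq (glue b g' g) g' a b); last by move=> s /andP[_ sb]; rewrite glue_le.
rewrite (@J_eq (glue b g' g) g b T); last by move=> s /andP[bs _]; rewrite glue_ge.
case/andP: bT' => b0 _; move: (minimizer_fin mg b0 bT (lexx _)).
by move: (J g a b) (J g b T) (J g' a b) => j1 j2 j3 fj; rewrite leeD2rE.
Qed.

(** Superlinear growth of L in the velocity turns the common bound on the action into a modulus of
    continuity that does not depend on the minimizer. *)
Lemma minimizer_equicontinuous (e : R) : 0 < e -> exists2 d, 0 < d &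
  forall g a b, minimizer g -> 0 <= a -> a <= b -> b <= T -> b - a <= d ->
    enorm (g b - g a) < e.
Proof.
move=> e0; have [C [C0 HC]] := minimizer_cost; have [K [K0 HK]] := ig_lower.
have [KF HF] := F_bounded; have mu0 : 0 < mu by case: hL1.
(* Bounds the action on any subinterval: the discarded pieces are at least - K times their
   length. *)
pose A := C + K * T + 1.
have A0 : 0 < A by rewrite /A; have := mulr_ge0 K0 (ltW T0); lra.
have [del del0 delA] : exists2 del, 0 < del & del * A = e / 4.
  by exists (e / 4 / A); rewrite ?divfK ?gt_eqF// !divr_gt0.
(* Young's inequality with weight del turns the energy bound A into at most e/4. *)
pose B := mu / del + del * `|M + mu * M ^+ 2| + del * `|KF|.
have del0' := ltW del0.
have B0 : 0 <= B.
  by rewrite /B !addr_ge0 ?mulr_ge0 ?invr_ge0 ?(ltW mu0).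
exists (e / 4 / (B + 1)); first by rewrite !divr_gt0// ltr_wpDl.
move=> g a b mg a0 ab bT bad; have [Gg _] := mg; have [acg clg] := Gg.
have [->|dn] := eqVneq (g b) (g a); first by rewrite subrr enorm0.
set w := g b - g a; have w0 : 0 < enorm w by rewrite enorm_gt0// subr_eq0.
(* In this direction a linear lower bound on the integrand measures the whole displacement. *)
pose q := (enorm w)^-1 *: w.
have q1 : enorm q = 1 by rewrite enormZ gtr0_norm ?invr_gt0// mulVf// gt_eqF.
have qw : dot q w = enorm w by rewrite dotZl -enorm_sqr expr2 mulKf// gt_eqF.
have low : ((dot (del^-1 *: q) (g b - g a) + - (B / del) * (b - a))%:E <= J g a b)%E.
  apply: (curve_integral_ge T0 acg a0 ab bT) => s /andP[as_ sb] _.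
  have sT : 0 <= s <= T by rewrite (le_trans a0 (ltW as_)) (le_trans (ltW sb) bT).
  have Us := clU (clg s sT); rewrite /ig.
  have h1 := L_coercive hL0 hL1 (derive1 g s) Us.
  have h2 := HF s _ sT Us; have h3 := ler_norm KF; have h4 := ler_norm (M + mu * M ^+ 2).
  have h5 := ler_dot q (derive1 g s); rewrite q1 mul1r in h5.
  move: h2; rewrite ler_norml => /andP[h2 _]; rewrite dotZl.
  move: h1 h5; set v := enorm _; set D := dot _ _; set Y := L _ _; set Z := F _ _ in h2 *.
  move=> h1 h5.
  have h6 : del^-1 * v <= v ^+ 2 / (4 * mu) + mu / del ^+ 2.
    have := divr_ge0 (sqr_ge0 (v - 2 * mu / del)) (ltW (mulr_gt0 (ltr0n R 4) mu0)).
    have -> : (v - 2 * mu / del) ^+ 2 / (4 * mu) =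
      v ^+ 2 / (4 * mu) - del^-1 * v + mu / del ^+ 2 by field; rewrite !gt_eqF.
    lra.
  have h7 : del^-1 * D <= del^-1 * v by rewrite ler_wpM2l// invr_ge0 ltW.
  have -> : B / del = mu / del ^+ 2 + `|M + mu * M ^+ 2| + `|KF|.
    by rewrite /B; field; rewrite gt_eqF.
  set W := M + mu * M ^+ 2 in h1 h4 *; lra.
have up : (J g a b <= A%:E)%E.
  have aT := le_trans ab bT.
  have h := HC g mg.
  rewrite (J_split Gg (lexx _) a0 aT (lexx _)) (J_split Gg a0 ab bT (lexx _)) in h.
  have f1 := minimizer_fin mg (lexx _) a0 aT; have f2 := minimizer_fin mg a0 ab bT.
  have f3 := minimizer_fin mg (le_trans a0 ab) bT (lexx _).
  have l1 : ((- K * (a - 0))%:E <= J g 0 a)%E.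
    apply: seg_integral_ge_cst => // s /andP[s0 sa].
    by apply: HK => //; rewrite (ltW s0) (le_trans (ltW sa) aT).
  have l3 : ((- K * (T - b))%:E <= J g b T)%E.
    apply: seg_integral_ge_cst => // s /andP[s0 sa].
    by apply: HK => //; rewrite (ltW sa) (le_trans (le_trans a0 ab) (ltW s0)).
  rewrite -(fineK f1) -(fineK f2) -(fineK f3) -!EFinD !lee_fin in h l1 l3 *.
  rewrite /A; have : K * b - K * a >= 0 by rewrite -mulrBr mulr_ge0 ?subr_ge0.
  lra.
have := le_trans low up; rewrite lee_fin dotZl qw => h.
have h1 : enorm w <= del * A + B * (b - a).
  have := ler_wpM2l (ltW del0) h.
  have -> : del * (del^-1 * enorm w + - (B / del) * (b - a)) =
    enorm w - B * (b - a) by field; rewrite gt_eqF.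
  lra.
have h3 : B * (b - a) <= e / 4.
  have : (B + 1) * (b - a) <= e / 4.
    by move: bad; rewrite ler_pdivlMr ?ltr_wpDl// mulrC.
  have : 0 <= b - a by rewrite subr_ge0.
  lra.
lra.
Qed.

Lemma F_close t x (om : R) : 0 <= t <= T -> U x -> 0 < om -> exists2 r, 0 < r &
  forall s y, 0 <= s <= T -> U y -> `|s - t| < r -> enorm (y - x) < r ->
    `|F y (m s) - F x (m t)| <= om.
Proof.
move=> tT Ux om0; have k0 := kappa_ge0 Ux.
have om2 : 0 < om / 2 by rewrite divr_gt0.
have e0 : 0 < om / 2 / (kappa + 1) by rewrite !divr_gt0// ltr_wpDl.
have [d d0 Hd] := mcont tT e0.
have [[dF _] _] := hD2 (mPO tT).
have [r r0 Hr] := continuous_enorm (differentiable_continuous (dF x Ux)) om2.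
exists (Num.min d r); first by rewrite lt_min d0.
move=> s y sT Uy; rewrite !lt_min => /andP[sd _] /andP[_ yr].
have h1 := F_time Uy tT sT (Hd s sT sd); have h2 := Hr y yr.
have h3 : kappa * (om / 2 / (kappa + 1)) <= om / 2.
  rewrite mulrA ler_pdivrMr ?ltr_wpDl// mulrC ler_pM2l//; lra.
have := ler_normD (F y (m s) - F y (m t)) (F y (m t) - F x (m t)).
rewrite subrKA; lra.
Qed.

Lemma derive1_quad (A B C : 'rV[R]_n) (s : R) :
  derive1 (fun r : R => A + r *: B + (r * r) *: C) s = B + (2 * s) *: C.
Proof.
have H i : is_derive s 1 (fun r : R => (A + r *: B + (r * r) *: C) ord0 i)
    ((B + (2 * s) *: C) ord0 i).
  have -> : (fun r : R => (A + r *: B + (r * r) *: C) ord0 i) =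
      (fun r : R => A ord0 i + (B ord0 i *: r + C ord0 i *: (r * r))).
    by apply/funext => r; rewrite !mxE /GRing.scale /=; ring.
  have -> : (B + (2 * s) *: C) ord0 i =
      0 + (B ord0 i *: (1 : R) + C ord0 i *: (s *: (1 : R) + s *: (1 : R))).
    by rewrite !mxE /GRing.scale /=; ring.
  by apply: is_deriveD; apply: is_deriveD; apply: is_deriveZ.
rewrite derive1E derive_mx.
  apply/rowP => i; rewrite mxE.
  exact: (@derive_val _ _ _ _ _ _ _ (H i)).
by apply/derivable_mxP => i j; rewrite ord1; exact: (@ex_derive _ _ _ _ _ _ _ (H j)).
Qed.

(** The segment from y1 to y2 run at constant speed on [a, b], displaced along - nu by a bump that
    vanishes at both ends. [clamp] makes the curve rest outside [a, b], so that it is a competitor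
    on all of [0, T]. *)
Definition chord (a b om : R) y1 y2 (nu : 'rV[R]_n) (s : R) : 'rV[R]_n :=
  let th := clamp 0 1 ((s - a) / (b - a)) in
  y1 + th *: (y2 - y1) - (om * (th * (1 - th)) * enorm (y2 - y1)) *: nu.

Lemma chord_start a b om y1 y2 nu : chord a b om y1 y2 nu a = y1.
Proof.
rewrite /chord subrr mul0r clamp_id ?lexx ?ler01//.
by rewrite scale0r mul0r mulr0 mul0r scale0r addr0 subr0.
Qed.

Lemma chord_end a b om y1 y2 nu : a < b -> chord a b om y1 y2 nu b = y2.
Proof.
move=> ab; rewrite /chord divff ?subr_eq0 ?gt_eqF// clamp_id ?lexx ?ler01//.
by rewrite scale1r subrr !mulr0 mul0r scale0r subr0 addrC subrK.
Qed.

Lemma chord_abs_cont a b om y1 y2 nu : a < b -> abs_cont_on T (chord a b om y1 y2 nu).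
Proof.
move=> ab; have ba : 0 < b - a by rewrite subr_gt0.
set d := enorm (y2 - y1).
apply: (@lipschitz_abs_cont _ _ _ _ ((d + `|om| * d * enorm nu) / (b - a))).
move=> s r sr; rewrite /chord -/d.
have sr' : (s - a) / (b - a) <= (r - a) / (b - a).
  by rewrite ler_pM2r ?invr_gt0// lerD2r.
have h1 := clamp_dist (@ler01 R) sr'; have h2 := @clamp_homo R 0 1 _ _ sr'.
have /andP[s0 s1] := clamp_itv ((s - a) / (b - a)) (@ler01 R).
have /andP[r0 r1] := clamp_itv ((r - a) / (b - a)) (@ler01 R).
move: h1 h2 s0 s1 r0 r1; rewrite -mulrBl opprB addrA subrK.
set tr := clamp _ _ _; set ts := clamp _ _ _ => h1 h2 s0 s1 r0 r1.
have -> : y1 + tr *: (y2 - y1) - (om * (tr * (1 - tr)) * d) *: nu -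
  (y1 + ts *: (y2 - y1) - (om * (ts * (1 - ts)) * d) *: nu) =
  (tr - ts) *: (y2 - y1) - (om * ((tr - ts) * (1 - tr - ts)) * d) *: nu.
  by apply/rowP => i; rewrite !mxE; ring.
apply: (le_trans (ler_enormD _ _)); rewrite enormN !enormZ -/d !normrM.
have d0 : 0 <= d by exact: enorm_ge0.
rewrite [`|d|]ger0_norm// [`|tr - ts|]ger0_norm ?subr_ge0//.
have h3 : `|1 - tr - ts| <= 1 by rewrite ler_norml; apply/andP; split; lra.
have p0 : 0 <= `|om| * d * enorm nu by rewrite !mulr_ge0 ?enorm_ge0.
have h4 : `|om| * ((tr - ts) * `|1 - tr - ts|) * d * enorm nu <=
    (tr - ts) * (`|om| * d * enorm nu).
  have -> : `|om| * ((tr - ts) * `|1 - tr - ts|) * d * enorm nu =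
    (tr - ts) * (`|om| * d * enorm nu) * `|1 - tr - ts| by ring.
  by rewrite ler_piMr// mulr_ge0// subr_ge0.
apply: (@le_trans _ _ ((tr - ts) * (d + `|om| * d * enorm nu))); first by lra.
have p1 : 0 <= d + `|om| * d * enorm nu by rewrite addr_ge0.
have := ler_wpM2r p1 h1; set P := d + _.
by rewrite [X in _ <= X -> _](_ : _ = P / (b - a) * (r - s))//; field; rewrite gt_eqF.
Qed.

(** The velocity is put in the form required by [L_perturb]: the mean velocity plus om times a
    vector which, for |nu| <= 1, is no longer than the mean velocity. *)
Lemma chord_derive a b om y1 y2 nu s : a < s < b ->
  derive1 (chord a b om y1 y2 nu) s =
  (b - a)^-1 *: (y2 - y1)
  + om *: (- ((1 - 2 * ((s - a) / (b - a))) * enorm ((b - a)^-1 *: (y2 - y1))) *: nu).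
Proof.
move=> sab; have /andP[as_ sb] := sab.
have ba : 0 < b - a by rewrite subr_gt0 (lt_trans as_).
(* On [a, b] the pushed chord is the quadratic polynomial A + r B + r^2 C with these
   coefficients. *)
pose c := (b - a)^-1; pose d := y2 - y1; pose k := om * enorm d.
pose A := y1 - (c * a) *: d + (k * (c * a + c ^+ 2 * a ^+ 2)) *: nu.
pose B := c *: d - (k * (c + 2 * c ^+ 2 * a)) *: nu.
pose C := (k * c ^+ 2) *: nu.
rewrite (@derive1_eq_itv _ _ _ (fun r : R => A + r *: B + (r * r) *: C) a b)//.
  rewrite derive1_quad enormZ gtr0_norm ?invr_gt0// -/c /B /C /k -/d.
  by apply/rowP => i; rewrite !mxE; ring.
move=> r /andP[ar rb]; rewrite /chord clamp_id; last first.
  apply/andP; split; first by apply: divr_ge0; [rewrite subr_ge0|exact: ltW].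
  by rewrite ler_pdivrMr// mul1r lerD2r.
rewrite -/c -/d /A /B /C /k.
by apply/rowP => i; rewrite !mxE; ring.
Qed.

(** The scale on which L and F may be frozen at (t, x) with relative precision om. *)
Definition close_to t x (r om : R) :=
  (forall y, enorm (y - x) < r -> U y /\
    forall v, `|L y v - L x v| <= om * (1 + enorm v ^+ 2)) /\
  (forall s y, 0 <= s <= T -> `|s - t| < r -> enorm (y - x) < r ->
    `|F y (m s) - F x (m t)| <= om).

Lemma close_exists t x (om : R) : 0 <= t <= T -> U x -> 0 < om ->
  exists2 r, 0 < r & close_to t x r om.
Proof.
move=> tT Ux om0; have [r1 r10 H1] := L_space_close oU hL0 hL1 Ux om0.
have [r2 r20 H2] := F_close tT Ux om0.
exists (Num.min r1 r2); first by rewrite lt_min r10.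
split=> [y|s y sT]; rewrite !lt_min; first by move=> /andP[h _]; exact: H1.
move=> /andP[_ s2] /andP[y1 y2]; have [Uy _] := H1 y y1; exact: H2.
Qed.

Let mu_gt0 : 0 < mu. Proof. by case: hL1. Qed.

(** Jensen's inequality with frozen coefficients: [q] and [c] describe the supporting affine
    function of L(x, .) at the mean velocity. In the factor 3, two units come from L and one from
    F. *)
Lemma curve_cost_ge t x (r om : R) g a b : U x -> close_to t x r om ->
  0 <= om -> 4 * om * mu <= 1 -> Gam Omega T g -> 0 <= a -> a < b -> b <= T ->
  (forall s, a <= s <= b -> `|s - t| < r /\ enorm (g s - x) < r) ->
  forall v, v = (b - a)^-1 *: (g b - g a) ->
  (((b - a) * (L x v + F x (m t) - 3 * om * (1 + enorm v ^+ 2)))%:E <= J g a b)%E.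
Proof.
move=> Ux [HL HF] om0 om1 Gg a0 ab bT nr v vE; have [acg _] := Gg.
have ba : 0 < b - a by rewrite subr_gt0.
pose q := DvL L x v.
pose c := L x v - dot q v - 2 * om * (1 + enorm v ^+ 2) + F x (m t) - om.
have h : ((dot q (g b - g a) + c * (b - a))%:E <= J g a b)%E.
  apply: (curve_integral_ge T0 acg a0 (ltW ab) bT) => s /andP[as_ sb] _.
  have sab : a <= s <= b by rewrite !ltW.
  have sT : 0 <= s <= T by rewrite (le_trans a0 (ltW as_)) (le_trans (ltW sb) bT).
  have [st gx] := nr s sab; have [_ hL] := HL _ gx.
  have h1 := L_tangent_close hL0 hL1 v Ux om0 om1 (hL (derive1 g s)).
  have := HF s _ sT st gx; rewrite ler_norml => /andP[h2 _].
  move: h1; rewrite dotDr dotNr -/q /ig /c.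
  move: (dot q (derive1 g s)) (dot q v) (L x v) (L (g s) _) h2 => X1 X2 X3 X4.
  by set Y := 2 * om * _; move: (F (g s) _) (F x _) => X5 X6; lra.
apply: le_trans h; rewrite lee_fin.
have -> : g b - g a = (b - a) *: v by rewrite vE scalerA mulfV ?scale1r// gt_eqF.
rewrite dotZr [c * _]mulrC -mulrDr ler_wpM2l ?(ltW ba)// /c.
have := mulr_ge0 om0 (sqr_ge0 (enorm v)).
move: (dot q v) (L x v) (F x _) => X1 X2 X3; lra.
Qed.

(** The velocity is explicit and at most 2 |v|, so the running cost is bounded pointwise. Freezing L
    and F costs at most 5 om (1 + |v|^2), and the push adds the term in [lam]. *)
Lemma chord_cost_le t x (r om lam : R) y1 y2 nu a b : U x -> close_to t x r om ->
  0 <= om -> 0 <= lam <= 1 -> enorm nu <= 1 -> 0 <= a -> a < b -> b <= T ->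
  (forall s, a <= s <= b -> `|s - t| < r /\ enorm (chord a b lam y1 y2 nu s - x) < r) ->
  forall v, v = (b - a)^-1 *: (y2 - y1) ->
  (J (chord a b lam y1 y2 nu) a b <=
    ((b - a) * (L x v + F x (m t) +
      (5 * om + 4 * Lcst M mu * lam) * (1 + enorm v ^+ 2)))%:E)%E.
Proof.
move=> Ux [HL HF] om0 lam01 nu1 a0 ab bT nr v vE; have /andP[lam0 lam1] := lam01.
have ba : 0 < b - a by rewrite subr_gt0.
rewrite mulrC; apply: seg_integral_le_cst; first exact: ltW.
move=> s sab'; have /andP[as_ sb] := sab'; have sab : a <= s <= b by rewrite !ltW.
have sT : 0 <= s <= T by rewrite (le_trans a0 (ltW as_)) (le_trans (ltW sb) bT).
have [st gx] := nr s sab; have [_ hL] := HL _ gx.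
rewrite /ig (chord_derive _ _ _ _ sab') -vE.
set th := (s - a) / (b - a); set e := - (_ * _) *: nu.
have th01 : 0 <= th <= 1.
  apply/andP; split; first by apply: divr_ge0; [rewrite subr_ge0 ltW|exact: ltW].
  by rewrite ler_pdivrMr// mul1r lerD2r ltW.
have v0 := enorm_ge0 v.
have ev : enorm e <= enorm v.
  rewrite /e enormZ normrN normrM [`|enorm v|]ger0_norm//.
  have h : `|1 - 2 * th| <= 1 by case/andP: th01 => ? ?; rewrite ler_norml; apply/andP; split; lra.
  apply: (@le_trans _ _ (`|1 - 2 * th| * enorm v)).
    by rewrite ler_piMr// mulr_ge0.
  by rewrite ler_piMl.
have h1 : L x (v + lam *: e) <= L x v + lam * (4 * Lcst M mu * (1 + enorm v ^+ 2)).
  by apply: (L_perturb hL0 hL1) => //; lra.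
have w2 : enorm (v + lam *: e) <= 2 * enorm v.
  apply: (le_trans (ler_enormD _ _)); rewrite enormZ ger0_norm//.
  have := ler_wpM2r (enorm_ge0 e) lam1; lra.
have w4 : enorm (v + lam *: e) ^+ 2 <= 4 * enorm v ^+ 2.
  have -> : 4 * enorm v ^+ 2 = (2 * enorm v) ^+ 2 by ring.
  by rewrite ler_pXn2r// nnegrE ?mulr_ge0 ?enorm_ge0.
have := hL (v + lam *: e); rewrite ler_norml => /andP[_ h2].
have := HF s _ sT st gx; rewrite ler_norml => /andP[_ h3].
have h4 := ler_wpM2l om0 w4.
have h5 := mulr_ge0 om0 (sqr_ge0 (enorm v)).
move: h1 h2 h3 h4 h5.
move: (L x (v + lam *: e)) (L x v) (L _ (v + lam *: e)) (F _ (m s)) (F x _).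
move: (enorm (v + lam *: e) ^+ 2) (Lcst M mu) => Z1 Z2 X1 X2 X3 X4 X5; lra.
Qed.

(** * Boundary points of the support *)

Section boundary_point.
Variables (rho : 'rV[R]_n -> R) (t : R) (x : 'rV[R]_n) (p1 : R) (p2 : 'rV[R]_n).
Hypotheses (hrho : C2_defining_function Omega rho) (t_itv : 0 < t < T).
Hypotheses (xb : bdry Omega x) (sd : superdiff Omega T u t x p1 p2).

Let clx : closure Omega x. Proof. by case: xb. Qed.
Let Ux : U x. Proof. exact: clU. Qed.
Let rx : rho x = 0. Proof. exact: (bdry_rho hrho). Qed.
Let tT : 0 <= t <= T. Proof. by case/andP: t_itv => ? ?; rewrite !ltW. Qed.

Let nu := outward_normal rho x.
Let ga := enorm (grad rho x).

Let ga0 : 0 < ga.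
Proof. by have [_ [_ /(_ x rx)/enorm_gt0]] := hrho. Qed.

Let nu1 : enorm nu = 1.
Proof. by rewrite /nu /outward_normal enormZ gtr0_norm ?invr_gt0// mulVf// gt_eqF. Qed.

Let gradE : grad rho x = ga *: nu.
Proof. by rewrite /nu /outward_normal scalerA mulfV ?scale1r// gt_eqF. Qed.

Definition Phi v : R := L x v + F x (m t) + p1 + dot p2 v.

Lemma Phi_inward w : dot (grad rho x) w < 0 -> 0 <= Phi w.
Proof.
move=> gw; rewrite -(addr0 (Phi w)); apply/ler_addgt0Pr => e e0; rewrite addr0.
have w0 := enorm_ge0 w.
pose C := 5 * (1 + enorm w ^+ 2) + (1 + enorm w).
have C0 : 0 < C by rewrite /C; have := sqr_ge0 (enorm w); lra.
have om0 : 0 < e / C by rewrite divr_gt0.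
have [r r0 cl] := close_exists tT Ux om0.
have [de de0 Hde] := sd om0; have [h0 h00 Hh] := inward_line hrho rx gw.
have /andP[t0 tT'] := t_itv; have w1 : 0 < 1 + enorm w by rewrite ltr_wpDr.
have [h h_gt0] : exists2 h, 0 < h &
    h < Num.min h0 (Num.min (T - t) (Num.min r de / (1 + enorm w))).
  have : 0 < Num.min h0 (Num.min (T - t) (Num.min r de / (1 + enorm w))).
    by rewrite !lt_min h00 subr_gt0 tT' divr_gt0// lt_min r0.
  by move: (Num.min _ _) => k k0; exists (k / 2); lra.
rewrite !lt_min ltr_pdivlMr// lt_min => /and3P[hh0 hT /andP[hr hde]].
have hw : h * enorm w < r by move: hr; rewrite mulrDr mulr1; lra.
have hr' : h < r by move: hr; rewrite mulrDr mulr1; have := mulr_ge0 (ltW h_gt0) w0; lra.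
have tth : t < t + h by rewrite ltrDl.
have thE : t + h - t = h by rewrite addrAC subrr add0r.
(* The segment x + (s - t) w, as a chord without push. *)
set c := chord t (t + h) 0 x (x + h *: w) 0.
have cE s : c s = x + (clamp 0 1 ((s - t) / (t + h - t)) * h) *: w.
  by rewrite /c /chord mul0r mul0r scale0r subr0 [x + h *: w]addrC addrK scalerA.
have Gc : Gam Omega T c.
  split; first exact: chord_abs_cont.
  move=> s _; rewrite cE; have /andP[c0 c1] := clamp_itv ((s - t) / (t + h - t)) (@ler01 R).
  move: c0; rewrite le_eqVlt => /predU1P[<-|c0]; first by rewrite mul0r scale0r addr0.
  apply: (rho_closure hrho); apply: Hh; rewrite mulr_gt0//=.
  by apply: le_lt_trans hh0; rewrite ler_piMl// ltW.
have Jc : (J c t (t + h) <= (h * (L x w + F x (m t) +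
    (5 * (e / C) + 4 * Lcst M mu * 0) * (1 + enorm w ^+ 2)))%:E)%E.
  have := @chord_cost_le t x r (e / C) 0 x (x + h *: w) 0 t (t + h) Ux cl (ltW om0).
  rewrite thE lexx ler01 enorm0 ler01 (ltW t0).
  apply => //; first by lra.
    move=> s /andP[ts sth]; split; first by rewrite ger0_norm; lra.
    rewrite -/c cE [x + _]addrC addrK enormZ normrM.
    have /andP[c0 c1] := clamp_itv ((s - t) / (t + h - t)) (@ler01 R).
    rewrite !ger0_norm ?(ltW h_gt0)//; apply: le_lt_trans hw.
    by rewrite -mulrA ler_piMl// mulr_ge0// ltW.
  by rewrite [x + _]addrC addrK scalerA mulVf ?scale1r// gt_eqF.
have th_itv : 0 < t + h < T by apply/andP; split; lra.
have tle : t <= t + h by exact: ltW.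
have thT : t + h <= T by case/andP: th_itv => _ /ltW.
have := value_step Gc (ltW t0) tle thT Jc.
rewrite /c chord_start chord_end//.
have clxh : closure Omega (x + h *: w).
  by apply: (rho_closure hrho); apply: Hh; rewrite h_gt0.
have := Hde (t + h) (x + h *: w) th_itv clxh.
rewrite addrAC subrr add0r [x + _]addrC addrK enormZ gtr0_norm//.
have -> : h + h * enorm w = h * (1 + enorm w) by ring.
move=> /(_ hde); rewrite dotZr addrC => h1 h2.
have eC : e / C * C = e by rewrite divfK// gt_eqF.
have : 0 <= h * (Phi w + e).
  rewrite -eC /Phi /C; move: h1 h2.
  set E := e / C; move: (u t x) (u _ _) (L x w) (F x _) (dot p2 w).
  by move=> U1 U2 X1 X2 X3 h1 h2; lra.
by rewrite pmulr_rge0.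
Qed.

(** w - de nu points strictly inwards, and the tilt changes Phi by at most de C. *)
Lemma Phi_tangent w : dot w nu = 0 -> 0 <= Phi w.
Proof.
move=> wnu; rewrite -(addr0 (Phi w)); apply/ler_addgt0Pr => e e0; rewrite addr0.
have LC0 := Lcst_gt0 M hL1; have P0 := enorm_ge0 p2; have w2 := sqr_ge0 (enorm w).
pose C := 4 * Lcst M mu * (1 + enorm w ^+ 2) + enorm p2 + 1.
have C0 : 0 < C.
  have : 0 <= 4 * Lcst M mu * (1 + enorm w ^+ 2).
    by apply: mulr_ge0; [apply: mulr_ge0 => //; exact: ltW|lra].
  by rewrite /C; move: (4 * _ * _) => Z ?; lra.
pose de := Num.min 1 (e / C).
have de0 : 0 < de by rewrite lt_min ltr01 divr_gt0.
have de1 : de <= 1 by rewrite ge_min lexx.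
have deC : de * C <= e by rewrite -ler_pdivlMr// ge_min lexx orbT.
have := @Phi_inward (w + de *: (- nu)).
have aux (k : 'rV[R]_n) : dot (ga *: k) (w + de *: - k) =
    ga * (dot w k - de * enorm k ^+ 2).
  by rewrite enorm_sqr !dotE (dotC k w); ring.
have aux2 (k : 'rV[R]_n) : dot p2 (w + de *: - k) = dot p2 w - de * dot p2 k.
  by rewrite !dotE; ring.
rewrite gradE aux wnu nu1 expr1n mulr1 sub0r mulrN oppr_lt0 mulr_gt0// => /(_ isT) h.
have h1 : L x (w + de *: (- nu)) <= L x w + de * (4 * Lcst M mu * (1 + enorm w ^+ 2)).
  apply: (L_perturb hL0 hL1) => //; first by rewrite (ltW de0).
  by rewrite enormN nu1 lerDl enorm_ge0.
have h2 : - dot p2 nu <= enorm p2.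
  by rewrite -dotNr; have := ler_dot p2 (- nu); rewrite enormN nu1 mulr1.
have h3 := ler_wpM2l (ltW de0) h2.
apply: (le_trans h); apply: (@le_trans _ _ (Phi w + de * C)); last by rewrite lerD2l.
rewrite /Phi aux2 /C; move: h1 h3; move: (L x (w + _)) (L x w) (F x _) (dot p2 w) (dot p2 nu).
by move: (4 * Lcst M mu * _) => Z X1 X2 X3 X4 X5; lra.
Qed.

Lemma Htau_le : Htau L rho x p2 <= F x (m t) + p1.
Proof.
apply: ge_sup.
  by exists (- dot p2 0 - L x 0); exists 0 => //=; rewrite dot0l.
by move=> _ [v /= vnu <-]; have := Phi_tangent vnu; rewrite /Phi; lra.
Qed.

(** A supremum of reals has a default value on unbounded sets; nonnegativity of Phi on tangential
    velocities provides the upper bound. *)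
Lemma Htau_ge z : dot z nu = 0 -> - dot p2 z - L x z <= Htau L rho x p2.
Proof.
move=> znu; apply: ub_le_sup; last by exists z.
exists (F x (m t) + p1) => _ [v /= vnu <-].
by have := Phi_tangent vnu; rewrite /Phi; lra.
Qed.

(** Dynamic programming bounds u(t - h, g(t - h)) from below and the superdifferential bounds it
    from above. All errors, including the replacement of g(t) by x, are of order om h, so division
    by h leaves a multiple of om. *)
Lemma backward_estimate (om r h : R) g v : 0 < om <= 1 -> 4 * om * mu <= 1 ->
  0 < h -> h < t -> minimizer g -> close_to t x r om ->
  (forall s, t - h <= s <= t -> `|s - t| < r /\ enorm (g s - x) < r) ->
  enorm (g t - x) <= om * h -> `|u t (g t) - u t x| <= om * h ->
  u (t - h) (g (t - h)) - u t x - p1 * (t - h - t) - dot p2 (g (t - h) - x)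
    <= om * (`|t - h - t| + enorm (g (t - h) - x)) ->
  v = h^-1 *: (g t - g (t - h)) ->
  Phi v <= om * (7 + enorm p2) * (1 + enorm v ^+ 2).
Proof.
move=> /andP[om0 om1] om4 h0 ht mg cl nr gx ux + vE; have [Gg _] := mg.
have tht : t - (t - h) = h by rewrite opprB addrCA subrr addr0.
have th0 : 0 <= t - h by lra.
have tht' : t - h < t by lra.
have /andP[_ tT'] := tT.
have := curve_cost_ge Ux cl (ltW om0) om4 Gg th0 tht' tT' nr.
rewrite tht => /(_ v vE) /(minimizer_value mg th0 (ltW tht') tT') h1.
have E : g (t - h) - x = - h *: v + (g t - x).
  rewrite vE scalerA mulNr mulfV ?gt_eqF// scaleN1r.
  by apply/rowP => i; rewrite !mxE; ring.
have hN : t - h - t = - h by rewrite addrAC subrr add0r.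
rewrite hN normrN gtr0_norm// E dotDr dotZr => h2.
have h3 : enorm (- h *: v + (g t - x)) <= h * enorm v + om * h.
  by apply: (le_trans (ler_enormD _ _)); rewrite enormZ normrN gtr0_norm// lerD2l.
have h4 : dot p2 (g t - x) <= enorm p2 * (om * h).
  by apply: (le_trans (ler_dot _ _)); rewrite ler_wpM2l ?enorm_ge0.
have h5 := ler_wpM2l (ltW om0) h3.
move: ux; rewrite ler_norml => /andP[h6 _].
have v0 := enorm_ge0 v; have P0 := enorm_ge0 p2.
have vv : enorm v <= 1 + enorm v ^+ 2.
  by have := sqr_ge0 (enorm v - 1); have := sqr_ge0 (enorm v); lra.
suff : h * Phi v <= h * (om * (7 + enorm p2) * (1 + enorm v ^+ 2)) by rewrite ler_pM2l.
have oh0 : 0 <= om * h by rewrite mulr_ge0 ?ltW.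
have k1 := ler_wpM2l oh0 vv.
have k2 : om * (om * h) <= om * h by rewrite ler_piMl.
have k3 : 0 <= om * h * enorm v ^+ 2 by rewrite mulr_ge0// sqr_ge0.
have k4 : 0 <= enorm p2 * (om * h) * enorm v ^+ 2 by rewrite !mulr_ge0 ?sqr_ge0 ?(ltW om0) ?(ltW h0).
rewrite /Phi; move: h1 h2 h4 h5 h6 k1 k2 k3 k4.
move: (u _ _) (u t x) (u t (g t)) (L x v) (F x _) (dot p2 v) (dot p2 _) (enorm _).
move: (enorm v) (enorm p2) => V P U1 U2 U3 X1 X2 X3 X4 X5.
move: (V ^+ 2) => V2; lra.
Qed.

(* The competitor replaces g on [t - h, t + h] by the pushed chord; strong
   convexity prices the corner that is cut off. *)
Lemma corner_estimate (om r h : R) g v w : 0 < om <= 1 -> 4 * om * mu <= 1 ->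
  0 < h -> h < t -> t + h < T -> minimizer g -> close_to t x (2 * r) om ->
  (forall y1 y2 (th : R), closure Omega y1 -> closure Omega y2 ->
    enorm (y1 - x) < r -> enorm (y2 - x) < r -> 0 <= th <= 1 ->
    closure Omega (y1 + th *: (y2 - y1)
      - (om * (th * (1 - th)) * enorm (y2 - y1)) *: nu)) ->
  (forall s, t - h <= s <= t + h -> `|s - t| < r /\ enorm (g s - x) < r) ->
  v = h^-1 *: (g t - g (t - h)) -> w = h^-1 *: (g (t + h) - g t) ->
  enorm (v - w) ^+ 2 / (4 * mu) <=
    om * (16 + 8 * Lcst M mu) * (1 + enorm v ^+ 2 + enorm w ^+ 2).
Proof.
move=> om01 om4 h0 ht htT mg cl push nr vE wE; have [Gg _] := mg.
have /andP[om0 om1] := om01; have [_ clg] := Gg.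
have r0 : 0 < r.
  have [|] := nr t; first by apply/andP; split; lra.
  by rewrite subrr normr0.
have tht : t - (t - h) = h by rewrite opprB addrCA subrr addr0.
have tht2 : t + h - t = h by rewrite addrAC subrr add0r.
have tht3 : t + h - (t - h) = 2 * h by lra.
have th0 : 0 <= t - h by lra.
have l1 : t - h < t by lra.
have l2 : t < t + h by lra.
have l3 : t - h < t + h by lra.
have /andP[t0 tT'] := tT.
have nr2 s : t - h <= s <= t + h -> `|s - t| < 2 * r /\ enorm (g s - x) < 2 * r.
  by move=> /nr[? ?]; split; lra.
have A1 : ((h * (L x v + F x (m t) - 3 * om * (1 + enorm v ^+ 2)))%:E <= J g (t - h) t)%E.
  have := curve_cost_ge Ux cl (ltW om0) om4 Gg th0 l1 tT'.
  rewrite tht => H; apply: H => // s /andP[? ?]; apply: nr2; apply/andP; split; lra.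
have A2 : ((h * (L x w + F x (m t) - 3 * om * (1 + enorm w ^+ 2)))%:E <= J g t (t + h))%E.
  have := curve_cost_ge Ux cl (ltW om0) om4 Gg t0 l2 (ltW htT).
  rewrite tht2 => H; apply: H => // s /andP[? ?]; apply: nr2; apply/andP; split; lra.
set y1 := g (t - h); set y2 := g (t + h).
have [_ y1r] : `|(t - h) - t| < r /\ enorm (y1 - x) < r by apply: nr; apply/andP; split; lra.
have [_ y2r] : `|(t + h) - t| < r /\ enorm (y2 - x) < r by apply: nr; apply/andP; split; lra.
have cly1 : closure Omega y1 by apply: clg; apply/andP; split; lra.
have cly2 : closure Omega y2 by apply: clg; apply/andP; split; lra.
pose c := chord (t - h) (t + h) om y1 y2 nu.
have Gc : Gam Omega T c.
  split; first exact: chord_abs_cont.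
  by move=> s _; apply: push => //; exact: clamp_itv.
(* The chord stays within r of x and the push is at most a quarter of its length, hence below r / 2;
   this is why the coefficients are frozen up to radius 2 r. *)
have nrc s : t - h <= s <= t + h -> `|s - t| < 2 * r /\ enorm (c s - x) < 2 * r.
  move=> /nr2[st _]; split => //; rewrite /c /chord.
  have := clamp_itv ((s - (t - h)) / (t + h - (t - h))) (@ler01 R).
  set th := clamp _ _ _ => /andP[th_0 th_1].
  set z := (om * _ * _) *: nu.
  have -> : y1 + th *: (y2 - y1) - z - x = (1 - th) *: (y1 - x) + th *: (y2 - x) - z.
    by apply/rowP => i; rewrite !mxE; ring.
  apply: (le_lt_trans (ler_enormD _ _)).
  have k1 := ler_enormD ((1 - th) *: (y1 - x)) (th *: (y2 - x)).
  rewrite !enormZ !ger0_norm ?subr_ge0// in k1.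
  have k2 : (1 - th) * enorm (y1 - x) <= (1 - th) * r by rewrite ler_wpM2l ?subr_ge0// ltW.
  have k3 : th * enorm (y2 - x) <= th * r by rewrite ler_wpM2l// ltW.
  have D0 := enorm_ge0 (y2 - y1).
  have k4 : enorm (y2 - y1) < 2 * r.
    by have := ler_enormB y2 x y1; rewrite [enorm (x - y1)]enormB; lra.
  have k5 : enorm (- z) <= enorm (y2 - y1) / 4.
    rewrite enormN enormZ nu1 mulr1 ger0_norm; last first.
      by rewrite !mulr_ge0 ?(ltW om0)// subr_ge0.
    rewrite mulrC ler_wpM2l//; have sq := sqr_ge0 (2 * th - 1).
    have q0 : 0 <= th * (1 - th) by rewrite mulr_ge0// subr_ge0.
    have := ler_wpM2r q0 om1; lra.
  lra.
(* The mean of v and w is also the mean velocity of the chord on [t - h, t + h], so [L_midpoint]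
   applies. *)
pose k := 2^-1 *: (v + w).
have kE : k = (t + h - (t - h))^-1 *: (y2 - y1).
  rewrite tht3 /k vE wE -scalerDr scalerA invfM; congr (_ *: _).
  by apply/rowP => i; rewrite !mxE; ring.
have om01' : 0 <= om <= 1 by rewrite (ltW om0).
have B1 : (J c (t - h) (t + h) <= ((2 * h) * (L x k + F x (m t) +
      (5 * om + 4 * Lcst M mu * om) * (1 + enorm k ^+ 2)))%:E)%E.
  have nu1' : enorm nu <= 1 by rewrite nu1.
  rewrite -tht3.
  exact: (chord_cost_le Ux cl (ltW om0) om01' nu1' th0 l3 (ltW htT) nrc kE).
have := minimizer_local mg Gc th0 (ltW l3) (ltW htT).
rewrite /c chord_start chord_end// -/c => /(_ erefl erefl).
rewrite (J_split Gg th0 (ltW l1) (ltW l2) (ltW htT)) => opt.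
have := le_trans (leeD A1 A2) (le_trans opt B1).
rewrite -EFinD lee_fin => {A1 A2 B1 opt}.
have Q := L_midpoint hL0 hL1 v w Ux.
have K : enorm k ^+ 2 <= (enorm v ^+ 2 + enorm w ^+ 2) / 2.
  rewrite /k enormZ exprMn real_normK ?num_real//.
  have := ler_enormD v w; have := enorm_ge0 (v + w).
  have := sqr_ge0 (enorm v - enorm w); move: (enorm v) (enorm w) (enorm (v + w)).
  move=> V W S sq S0 S1.
  have : S ^+ 2 <= (V + W) ^+ 2 by rewrite ler_pXn2r// ?nnegrE//; lra.
  lra.
have LC0 := Lcst_gt0 M hL1; have hK := ler_wpM2l (mulr_ge0 (ltW om0) (ltW LC0)) K.
have hK2 := ler_wpM2l (ltW om0) K; rewrite -/k in Q.
move=> H; apply: (le_trans Q); rewrite -(ler_pM2l h0).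
have h2 := ler_wpM2l (ltW h0) hK; have h3 := ler_wpM2l (ltW h0) hK2.
have h4 : 0 <= h * (om * Lcst M mu) by rewrite !mulr_ge0 ?ltW.
have h5 : 0 <= h * om by rewrite mulr_ge0 ?ltW.
have v2 := sqr_ge0 (enorm v); have w2 := sqr_ge0 (enorm w).
have m1 := mulr_ge0 h4 v2; have m2 := mulr_ge0 h4 w2.
have m3 := mulr_ge0 h5 v2; have m4 := mulr_ge0 h5 w2.
move: H h2 h3 h4 h5 m1 m2 m3 m4.
move: (L x v) (L x w) (L x k) (F x _) (Lcst M mu) => X1 X2 X3 X4 X5.
move: (enorm v ^+ 2) (enorm w ^+ 2) (enorm k ^+ 2) => V2 W2 K2; lra.
Qed.

(** A bound for 1 + |v|^2 that does not involve om, so that om can be chosen after it. *)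
Definition vcst : R := 1 + 16 * mu * (`|M + mu * M ^+ 2| + `|F x (m t)| + `|p1|
  + 2 * mu * enorm p2 ^+ 2 + (16 * mu)^-1).

(** Coercivity supplies four units of |v|^2 / (16 mu). Two absorb the linear term in p2 by Young's
    inequality, one absorbs the right-hand side, and the last bounds |v|^2. *)
Lemma velocity_bound (k : R) v : k * (16 * mu) <= 1 ->
  Phi v <= k * (1 + enorm v ^+ 2) -> 1 + enorm v ^+ 2 <= vcst.
Proof.
move=> hk; rewrite /Phi /vcst lerD2l => h.
have i0 : 0 < 16 * mu by rewrite mulr_gt0.
have hk' : k <= (16 * mu)^-1 by rewrite -[leRHS]mul1r ler_pdivlMr.
have c := L_coercive hL0 hL1 v Ux.
have d : - dot p2 v <= enorm p2 * enorm v.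
  by rewrite -dotNl -(enormN p2); exact: ler_dot.
rewrite mulrC -ler_pdivrMr//.
have v2 := sqr_ge0 (enorm v); have v3 : 0 <= 1 + enorm v ^+ 2 by lra.
have h1 := ler_wpM2r v3 hk'.
have y : enorm p2 * enorm v <= 2 * (enorm v ^+ 2 / (16 * mu)) + 2 * mu * enorm p2 ^+ 2.
  have := divr_ge0 (sqr_ge0 (enorm v - 4 * mu * enorm p2)) (ltW (mulr_gt0 (ltr0n R 8) mu_gt0)).
  have -> : (enorm v - 4 * mu * enorm p2) ^+ 2 / (8 * mu) =
    2 * (enorm v ^+ 2 / (16 * mu)) - enorm p2 * enorm v + 2 * mu * enorm p2 ^+ 2.
    by field; rewrite gt_eqF.
  lra.
have E : enorm v ^+ 2 / (4 * mu) = 4 * (enorm v ^+ 2 / (16 * mu)) by field; rewrite gt_eqF.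
rewrite E in c; rewrite [leRHS]mulrDr mulr1 in h1.
rewrite [(16 * mu)^-1 * enorm v ^+ 2]mulrC in h1.
have a1 := ler_norm (M + mu * M ^+ 2).
have := ler_norm (- F x (m t)); have := ler_norm (- p1); rewrite !normrN.
move: c h d y h1 a1; move: (L x v) (F x _) (dot p2 v) (enorm p2 * enorm v).
set K0 := M + _; set Q := 2 * mu * _; set I := (16 * mu)^-1.
set Z := enorm v ^+ 2 / _ => X1 X2 X3 X4.
move: (`|K0|) (`|X2|) (`|p1|) => N1 N2 N3; lra.
Qed.

(** Since rho(y) <= 0, the point y lies at most slightly outside the tangent half-space at x, and z
    is within om h of x. With z = g(t) it serves both directions of time: y = g(t - h) gives - v and
    y = g(t + h) gives w. *)
Lemma inner_normal_estimate (om r h : R) y z v : 0 < om <= 1 -> 0 < h ->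
  (forall y, enorm (y - x) < r -> `|rho y - dot (grad rho x) (y - x)| <=
     om * ga * enorm (y - x)) ->
  closure Omega y -> enorm (y - x) < r -> enorm (z - x) <= om * h ->
  v = h^-1 *: (y - z) -> dot nu v <= om * (2 + enorm v).
Proof.
move=> /andP[om0 om1] h0 H cly yr zx vE.
have := H y yr; rewrite ler_norml => /andP[h1 _]; have h2 := closure_rho hrho cly.
have E : y - x = h *: v + (z - x) by rewrite vE scalerA mulfV ?scale1r ?gt_eqF// subrKA.
have h3 : ga * dot nu (y - x) <= om * ga * enorm (y - x).
  by rewrite -dotZl -gradE; lra.
have h4 : dot nu (y - x) <= om * enorm (y - x).
  by rewrite -(ler_pM2l ga0) mulrCA mulrA.
have e1 : enorm (y - x) <= h * enorm v + om * h.
  by rewrite E; apply: (le_trans (ler_enormD _ _)); rewrite enormZ gtr0_norm// lerD2l.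
have h5 : - dot nu (z - x) <= om * h.
  rewrite -dotNr; apply: (le_trans (ler_dot _ _)); rewrite nu1 mul1r enormN//.
have h6 : dot nu (y - x) = h * dot nu v + dot nu (z - x).
  by rewrite E; move: (nu) => k; rewrite dotDr dotZr.
rewrite -(ler_pM2l h0).
have k1 := ler_wpM2l (ltW om0) e1.
have k2 : om * (om * h) <= om * h by rewrite ler_piMl// mulr_ge0 ?ltW.
move: h4 h5 h6 k1 k2; move: (dot nu v) (dot nu (z - x)) (dot nu (y - x)) (enorm (y - x)).
move: (enorm v) => V X1 X2 X3 X4; lra.
Qed.

Lemma optimal_velocities (om : R) :
  (forall r, 0 < r -> exists2 g, minimizer g & enorm (g t - x) < r) ->
  (forall e : R, 0 < e -> exists2 r : R, 0 < r & forall y, closure Omega y ->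
     enorm (y - x) < r -> `|u t y - u t x| <= e) ->
  0 < om <= 1 -> 4 * om * mu <= 1 ->
  exists v w, [/\ Phi v <= om * (7 + enorm p2) * (1 + enorm v ^+ 2),
    enorm (v - w) ^+ 2 / (4 * mu) <=
      om * (16 + 8 * Lcst M mu) * (1 + enorm v ^+ 2 + enorm w ^+ 2),
    dot nu (- v) <= om * (2 + enorm (- v)) & dot nu w <= om * (2 + enorm w)].
Proof.
move=> curves ucont om01 om4; have /andP[t0 tT'] := t_itv.
have /andP[om0 om1] := om01.
have [r1 r10 cl1] := close_exists tT Ux om0.
have [r2 r20 Hrho] := rho_close hrho x (mulr_gt0 om0 ga0).
have [r3 r30 push] := pushed_chord_inside hrho rx om01.
have [de de0 Hsd] := sd om0.
have [r r0 [rr1 rr2 rr3 rrd]] := scale_choice r10 r20 r30 de0.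
have rr2' := ltW (lt_of_double r0 rr2); have rr3' := ltW (lt_of_double r0 rr3).
have cl : close_to t x (2 * r) om.
  case: cl1 => HL HF; split=> [y yx|s y sT st yx].
    by apply: HL; exact: lt_le_trans rr1.
  by apply: HF => //; [exact: lt_le_trans st rr1|exact: lt_le_trans yx rr1].
have r20' : 0 < r / 2 by rewrite divr_gt0.
have [hE hE0 equi] := minimizer_equicontinuous r20'.
have Tt0 : 0 < T - t by rewrite subr_gt0.
have [h h0 [hhE ht hT hr]] := scale_choice hE0 t0 Tt0 r0.
have oh0 : 0 < om * h by rewrite mulr_gt0.
have [ru ru0 Hu] := ucont _ oh0.
(* The curve comes last: at time t it must be within om h of x, within r / 2 to stay near x during
   time h, and close enough for u(t, .) to vary by at most om h. *)
have [|g mg] := curves (Num.min (Num.min (om * h) (r / 2)) ru).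
  by rewrite !lt_min oh0 r20' ru0.
rewrite !lt_min => /andP[/andP[gx1 gx2] gx3].
have [[_ clg] _] := mg.
have hE' := lt_of_double h0 hhE; have ht' := lt_of_double h0 ht.
have hr' := lt_of_double h0 hr.
have hT' : t + h < T by rewrite -ltrBrDl; exact: lt_of_double hT.
have th0 : 0 <= t - h by rewrite subr_ge0 ltW.
have gnear s : t - h <= s <= t + h -> `|s - t| < r /\ enorm (g s - x) < r.
  move=> sth; have /andP[s1 s2] := sth.
  have sth' : `|s - t| <= h by rewrite ler_distl.
  split; first exact: le_lt_trans hr'.
  apply: (le_lt_trans (ler_enormB _ (g t) _)); rewrite (splitr r); apply: ltrD => //.
  have [st|/ltW ts] := leP s t; first rewrite enormB; apply: equi => //.
  - exact: le_trans s1.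
  - exact: ltW.
  - by rewrite -[t - s]ger0_norm ?subr_ge0// distrC (le_trans sth')// ltW.
  - exact: ltW.
  - exact: le_trans s2 (ltW hT').
  - by rewrite -[s - t]ger0_norm ?subr_ge0// (le_trans sth')// ltW.
have tmp : t - h <= t + h by rewrite lerD2l ge0_cp// ltW.
have thm : t - h <= t - h <= t + h by rewrite lexx tmp.
have thp : t - h <= t + h <= t + h by rewrite lexx tmp.
have clm : closure Omega (g (t - h)).
  by apply: clg; rewrite th0 (le_trans tmp)// ltW.
have clp : closure Omega (g (t + h)).
  by apply: clg; rewrite (le_trans th0 tmp) ltW.
have [_ gm] := gnear _ thm; have [_ gp] := gnear _ thp.
have Hrho' y : enorm (y - x) < r -> `|rho y - dot (grad rho x) (y - x)| <=
    om * ga * enorm (y - x).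
  move=> yr; have := Hrho x y; rewrite subrr enorm0 rx subr0; apply => //.
  exact: lt_le_trans rr2'.
exists (h^-1 *: (g t - g (t - h))), (h^-1 *: (g (t + h) - g t)); split.
- apply: (@backward_estimate om (2 * r) h g) => //.
  + move=> s /andP[s1 s2]; have [|st sx] := gnear s.
      by rewrite s1 (le_trans s2)// lerDl ltW.
    have r2r : r <= 2 * r by rewrite mulr_natl lerDl ltW.
    by split; exact: lt_le_trans r2r.
  + exact: ltW.
  + by apply: Hu => //; exact: clg.
  + apply: Hsd => //; first by rewrite subr_gt0 ht' (le_lt_trans tmp).
    rewrite addrAC subrr add0r normrN gtr0_norm//; apply: lt_le_trans rrd.
    by rewrite mulr_natl; exact: ltrD.
- apply: (@corner_estimate om r h g) => //.
  by move=> y1 y2 s cy1 cy2 yr1 yr2; apply: push => //; exact: lt_le_trans rr3'.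
- apply: (@inner_normal_estimate om r h (g (t - h)) (g t)) => //; first exact: ltW.
  by rewrite -scalerN opprB.
- by apply: (@inner_normal_estimate om r h (g (t + h)) (g t)) => //; exact: ltW.
Qed.

(** Because |v| is bounded independently of om, the corner estimate forces |v - w| <= th. The
    opposite one-sided bounds on the normal components of v and w then meet, and v is tangential up
    to 2 th. *)
Lemma Phi_near_tangent (e : R) :
  (forall r, 0 < r -> exists2 g, minimizer g & enorm (g t - x) < r) ->
  (forall e : R, 0 < e -> exists2 r : R, 0 < r & forall y, closure Omega y ->
     enorm (y - x) < r -> `|u t y - u t x| <= e) ->
  0 < e -> exists2 z, dot z nu = 0 & Phi z <= e.
Proof.
move=> curves ucont e0.
have P0 := enorm_ge0 p2; have LC0 := Lcst_gt0 M hL1.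
have [C2 C2E] : exists C, C = vcst by exists vcst.
have C21 : 1 <= C2.
  rewrite C2E /vcst lerDl mulr_ge0 ?mulr_ge0 ?(ltW mu_gt0)//.
  by rewrite !addr_ge0 ?mulr_ge0 ?sqr_ge0 ?invr_ge0 ?mulr_ge0 ?(ltW mu_gt0).
have [C1 C1E] : exists C, C = 7 + enorm p2 by eexists.
have [C3 C3E] : exists C, C = 16 + 8 * Lcst M mu by eexists.
have C10 : 0 < C1 by rewrite C1E ltr_wpDr.
have C30 : 0 < C3 by rewrite C3E ltr_wpDr// mulr_ge0// ltW.
have [D DE] : exists D, D = 4 * Lcst M mu * C2 + enorm p2 by eexists.
have C20 : 0 <= C2 by exact: le_trans C21.
have D0 : 0 <= D by rewrite DE addr_ge0// !mulr_ge0 ?(ltW LC0).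
(* The normal component will be at most 2 th: it must not exceed 1 for [L_perturb], and its removal,
   at price D per unit, may cost e / 2. *)
have [|th th0 Hth] := @small_parameter R [:: (2, 1); (2 * D, e / 2)].
  by rewrite /= ltr01 divr_gt0.
have th2 : th * 2 <= 1 by apply: Hth; rewrite !inE eqxx.
have thD : th * (2 * D) <= e / 2 by apply: Hth; rewrite !inE eqxx orbT.
(* The third pair is for the velocity bound, the fourth and fifth for |v - w| <= th, the sixth for
   the normal component, and the last leaves e / 2 for Phi v. *)
have [|om om0 Hom] := @small_parameter R [:: (1, 1); (4 * mu, 1); (C1 * (16 * mu), 1);
    (16 * mu * C3, 1); (24 * mu * C3 * C2, th ^+ 2); (3 + C2, th); (C1 * C2, e / 2)].
  by rewrite /= ltr01 exprn_gt0// th0 divr_gt0.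
have om1 : om <= 1 by rewrite -[om]mulr1; apply: Hom; rewrite !inE eqxx ?orbT.
have om2 : om * (4 * mu) <= 1 by apply: Hom; rewrite !inE eqxx ?orbT.
have om3 : om * (C1 * (16 * mu)) <= 1 by apply: Hom; rewrite !inE eqxx ?orbT.
have om4 : om * (16 * mu * C3) <= 1 by apply: Hom; rewrite !inE eqxx ?orbT.
have om5 : om * (24 * mu * C3 * C2) <= th ^+ 2 by apply: Hom; rewrite !inE eqxx ?orbT.
have om6 : om * (3 + C2) <= th by apply: Hom; rewrite !inE eqxx ?orbT.
have om7 : om * (C1 * C2) <= e / 2 by apply: Hom; rewrite !inE eqxx ?orbT.
have om01 : 0 < om <= 1 by rewrite om0.
have om2' : 4 * om * mu <= 1 by rewrite mulrAC mulrC.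
have [v [w []]] := optimal_velocities curves ucont om01 om2'.
rewrite -C1E -C3E => b1 b3 n1 n2.
have b2 : 1 + enorm v ^+ 2 <= C2.
  by rewrite C2E; apply: velocity_bound b1; rewrite -mulrA.
have v0 := enorm_ge0 v; have w0 := enorm_ge0 w; have vw0 := enorm_ge0 (v - w).
have b4 : enorm (v - w) <= th.
  rewrite -(@ler_pXn2r _ 2)// ?nnegrE ?(ltW th0)//; apply: le_trans om5.
  apply: (corner_absorb mu_gt0 (ltW om0) (ltW C30) (sqr_ge0 _) om4 b3 _ b2).
  by rewrite enormB; exact: enorm_sqr_le.
have vC : enorm v <= C2 by exact: le_trans (ler_1Dsqr _) b2.
have n3 : dot nu v = dot nu w + dot nu (v - w).
  by move: (nu) => k; rewrite -dotDr addrC subrK.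
have n4 : dot nu (v - w) <= th.
  by apply: le_trans b4; rewrite -[leRHS]mul1r -nu1; exact: ler_dot.
have wC : enorm w <= C2 + 1.
  have := ler_enorm_dist w v; rewrite lerBlDl => /le_trans; apply.
  by rewrite lerD// enormB (le_trans b4)// (le_trans _ th2)// mulr_natr mulr2n lerDl ltW.
have al : `|dot nu v| <= 2 * th.
  move: n1; rewrite enormN dotNr => n1.
  exact: (normal_absorb (ltW om0) (ltW th0) n1 n2 n3 n4 vC wC om6).
have [a aE] : exists a, a = dot nu v by eexists.
rewrite -aE in al.
have sgE (k : 'rV[R]_n) : `|a| *: (- Num.sg a *: k) = - a *: k.
  by rewrite scalerA mulrN [`|a| * _]mulrC -numEsg.
(* The projection v - a nu, written as a displacement of size |a| along a vector of norm at most 1,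
   to fit [L_perturb]. *)
exists (v + `|a| *: (- Num.sg a *: nu)).
  rewrite sgE; have : dot v nu = a by rewrite dotC.
  by move: nu1; move: (nu) => k k1 kv; rewrite dotDl dotZl kv -enorm_sqr k1 expr1n mulr1 subrr.
have a1 : 0 <= `|a| <= 1 by rewrite normr_ge0 /= (le_trans al)// mulrC.
have sg1 : enorm (- Num.sg a *: nu) <= 1.
  by rewrite enormZ normrN nu1 mulr1 normr_sg; case: (a != 0); rewrite ?lexx ?ler01.
have L1 : L x (v + `|a| *: (- Num.sg a *: nu)) <=
    L x v + `|a| * (4 * Lcst M mu * (1 + enorm v ^+ 2)).
  by apply: (L_perturb hL0 hL1) => //; apply: (le_trans sg1); rewrite lerDl.
have p3 : dot p2 (v + `|a| *: (- Num.sg a *: nu)) <= dot p2 v + `|a| * enorm p2.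
  rewrite dotDr lerD2l; have := ler_dot p2 (- Num.sg a *: nu) => k.
  have k' := ler_wpM2l P0 sg1; rewrite mulr1 in k'.
  move: (- Num.sg a *: nu) k k' => q k k'; rewrite dotZr ler_wpM2l//.
  exact: le_trans k k'.
have q1 : 4 * Lcst M mu * (1 + enorm v ^+ 2) <= 4 * Lcst M mu * C2.
  by rewrite ler_wpM2l// mulr_ge0// ltW.
have q2 := ler_wpM2l (normr_ge0 a) q1.
have q3 : `|a| * D <= 2 * th * D by rewrite ler_wpM2r.
have q4 : om * C1 * (1 + enorm v ^+ 2) <= om * C1 * C2.
  by rewrite ler_wpM2l// mulr_ge0// ltW.
move: b1 L1 p3 q2 q3 q4 thD om7; rewrite /Phi DE.
move: (L x (v + _)) (L x v) (F x _) (dot p2 (v + _)) (dot p2 v) => X1 X2 X3 X4 X5.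
move: (1 + enorm v ^+ 2) (4 * Lcst M mu * C2) (4 * Lcst M mu * (1 + _)) => Y1 Y2 Y3.
by move: (`|a|) => A; lra.
Qed.

End boundary_point.

End dynamic_programming.

Lemma within_continuous_snd {R : realType} {n : nat} (A : set (R * 'rV[R]_n))
    (f : R -> 'rV[R]_n -> R) t x :
  {within A, continuous (fun z : R * 'rV[R]_n => f z.1 z.2)} -> A (t, x) ->
  forall e : R, 0 < e -> exists2 r : R, 0 < r & forall y, A (t, y) ->
    enorm (y - x) < r -> `|f t y - f t x| <= e.
Proof.
move=> /subspace_continuousP/(_ (t, x)) fc Atx e e0.
have /cvgrPdist_lt/(_ e e0) := fc Atx.
rewrite /prop_near1 /within /= => /nbhs_ballP[r /= r0 H].
exists r => // y Aty yx; rewrite distrC ltW//; apply: (H (t, y)) => //.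
split=> /=; first exact: ballxx.
rewrite -ball_normE /ball_ /= distrC; apply: le_lt_trans yx; exact: norm_le_enorm.
Qed.

Theorem theorem4p12 (R : realType) (n : nat)
  (Omega U : set 'rV[R]_n) (rho : 'rV[R]_n -> R)
  (T kappa M mu : R)
  (L : 'rV[R]_n -> 'rV[R]_n -> R)
  (F G : 'rV[R]_n -> probability (Pt R n) R -> R)
  (u : R -> 'rV[R]_n -> R) (m : R -> probability (Pt R n) R) :
  open Omega -> bounded_set Omega -> C2_defining_function Omega rho ->
  0 < T -> open U -> closure Omega `<=` U ->
  hyp_D1 U Omega F G kappa -> hyp_D2 U Omega F G kappa -> hyp_D3 U Omega F ->
  hyp_L0 U L M -> hyp_L1 U L mu -> hyp_L2 U L -> hyp_L3 U L ->
  mild_solution Omega T L F G u m ->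
  forall (t : R) (x : 'rV[R]_n), dQ Omega T m t x ->
  forall (p1 : R) (p2 : 'rV[R]_n), superdiff Omega T u t x p1 p2 ->
    - p1 + Htau L rho x p2 = F x (m t).
Proof.
move=> _ _ hrho T0 oU clU hD1 hD2 _ hL0 hL1 _ _.
move=> [ucont [mPO [mcont [eta [etaG [mE [eta_min uE]]]]]]] t x [t_itv [xb xs]] p1 p2 sd.
have tT : 0 <= t <= T by case/andP: t_itv => *; rewrite !ltW.
have clx : closure Omega x by case: xb.
have curves r : 0 < r -> exists2 g, minimizer Omega T L F G m g & enorm (g t - x) < r.
  move=> r0; have [g sg gx] := supp_m_curve T0 etaG tT (mE t tT) xs r0.
  by exists g => //; exact: eta_min.
have utcont (e : R) : 0 < e -> exists2 r : R, 0 < r & forall y, closure Omega y ->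
    enorm (y - x) < r -> `|u t y - u t x| <= e.
  move=> e0; have [r r0 H] := within_continuous_snd ucont (x := x) (conj tT clx) e0.
  by exists r => // y cly; exact: H.
have up := Htau_le T0 oU clU hD1 hD2 hL0 hL1 mPO mcont uE hrho t_itv xb sd.
apply/eqP; rewrite eq_le addrC lerBlDr up lerBrDr /=; apply/ler_addgt0Pr => e e0.
have [z znu ze] := Phi_near_tangent T0 oU clU hD1 hD2 hL0 hL1 mPO mcont uE
  hrho t_itv xb sd curves utcont e0.
have low := Htau_ge T0 oU clU hD1 hD2 hL0 hL1 mPO mcont uE hrho t_itv xb sd znu.
move: ze low; rewrite /Phi; move: (Htau _ _ _ _) (L x z) (F x _) (dot p2 z).
by move=> H X Y Z; lra.
Qed.
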